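(* Let $s_\theta=\frac12+\frac{i\theta}{\log q}$, $0<\theta<\pi$, be a point of the open unitary axis at which $\mathcal E_s$ and the (meromorphically continued) scattering matrices $S(q^{s-1/2})$, $\mathcal S_{\mathrm{aut}}(s)$ are holomorphic, and set $$\mathfrak G_N(\theta)=\frac1{q+1}W^{-1/2}\mathcal E_{s_\theta}^*\chi_N\mathcal E_{s_\theta}W^{-1/2}-(2N+1)I_r\qquad(N\ge1).$$ Then $$\lim_{L\to\infty}\frac1L\sum_{N=1}^L\mathfrak G_N(\theta)=iS(e^{i\theta})^*\partial_\theta S(e^{i\theta})=:\mathcal M(\theta)$$ in $M_r(\mathbb C)$. Moreover $$\operatorname{tr}\mathcal M(\theta)=i\,\partial_\theta\log\det S(e^{i\theta})=i\,\partial_\theta\log\det\mathcal S_{\mathrm{aut}}(s_\theta),$$ where each logarithm is chosen locally. The traceless part of $\mathcal M(\theta)$ is recovered from the matrix-valued truncated automorphic Gram data and is not, in general, determined by either determinant.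
   Context: Let $q$ be a prime power, $a=\sqrt q$, $K=\mathbb F_q(\!(t^{-1})\!)$, $\mathcal T$ the $(q+1)$-regular Bruhat–Tits tree of $\mathrm{PGL}_2(K)$, $\Gamma<\mathrm{PGL}_2(K)$ a non-uniform arithmetic lattice, and $Y=\Gamma\backslash\mathcal T$. For a quotient vertex $v$ with lift $\widetilde v$ let $\Gamma_v=\operatorname{Stab}_\Gamma(\widetilde v)$ and $\lambda(v)=|\Gamma_v|^{-1}$; $L^2(Y,\lambda)$ has norm $\|f\|^2=\sum_v|f(v)|^2\lambda(v)$. The adjacency operator is $(Af)(v)=\sum_e[\Gamma_v:\Gamma_e]f(t(e))$, the sum over representatives $e$ of $\Gamma_v$-orbits of oriented tree edges issuing from $\widetilde v$, $\Gamma_e=\operatorname{Stab}_{\Gamma_v}(e)$, $t(e)$ the terminal quotient vertex; it is bounded and self-adjoint on $L^2(Y,\lambda)$ and is also applied to arbitrary functions on $V(Y)$. $Y$ has $r$ labelled cusps; they are cut in their homogeneous part, so that $V(Y)$ is the disjoint union of a finite core of $d\ge1$ vertices and rays of vertices $(c,n)$, $1\le c\le r$, $n\ge1$, increasing away from the core, with $(Af)(c,n)=qf(c,n-1)+f(c,n+1)$ for $n\ge2$, $(c,1)$ joined only to the core and (with index $1$) to $(c,2)$, and $\lambda(c,n)=w_c(q+1)q^{-n}$. The number $w_c>0$ is the cusp width; $W=\operatorname{diag}(w_1,\dots,w_r)$. Let $Uf=\lambda^{1/2}f$. Then $J=UAU^{-1}$ acts on $\ell^2(V(Y))=\mathbb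 C^d\oplus\bigoplus_{c=1}^r\ell^2(\mathbb N)$ as $J(u,g)=(H_Cu+Vg(1),h)$, $h(1)=ag(2)+V^*u$, $h(n)=a\{g(n-1)+g(n+1)\}$ ($n\ge2$), where $g(n)\in\mathbb C^r$; this defines the Hermitian matrix $H_C$ and the linear map $V:\mathbb C^r\to\mathbb C^d$. For $\zeta\in\mathbb C^\times$ set $x(\zeta)=a(\zeta+\zeta^{-1})$, $$F(\zeta)=H_C-x(\zeta)I_d+\frac{\zeta^{-1}}aVV^*,\qquad S(\zeta)=-I_r+\frac{\zeta^{-1}-\zeta}aV^*F(\zeta)^{-1}V .$$ Constant-term-normalized Eisenstein family: for $b\in\mathbb C^r$ and $\zeta=q^{s-1/2}$, $\mathcal E_s(b)$ is the generalized eigenfunction of $A$ with eigenvalue $q^s+q^{1-s}$ and cusp expansion $\mathcal E_s(b)(c,n)=q^{ns}b_c+q^{n(1-s)}(\mathcal S_{\mathrm{aut}}(s)b)_c$, unique when $F(\zeta)$ is invertible and $\zeta\neq\pm1$ (continued meromorphically elsewhere); this defines the $r\times r$ matrix $\mathcal S_{\mathrm{aut}}(s)$, which equals $W^{-1/2}S(\zeta)W^{1/2}$. $\chi_N$ is the coordinate projection retaining the finite core and the vertices $(c,n)$ with $n\le N$. $\mathcal E_{s}^*\chi_N\mathcal E_{s}$ is the $r\times r$ matrix with $(c,c')$ entry $\langle\chi_N\mathcal E_s(e_{c'}),\mathcal E_s(e_c)\rangle_{L^2(Y,\lambda)}$ (a finite sum), with inner product linear in the first variable and $e_c$ the standard vectors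 of $\mathbb C^r$. The traceless part of an $r\times r$ matrix $M$ is $M-\frac1r(\operatorname{tr}M)I_r$, and $M_r(\mathbb C)$ denotes the $r\times r$ complex matrices. *)

(* Defs.v *)
From HB Require Import structures.
From mathcomp Require Import all_boot all_order all_algebra finmap.
From mathcomp Require Import complex.
From mathcomp Require Import all_classical all_reals all_analysis.
Set Implicit Arguments.
Unset Strict Implicit.
Unset Printing Implicit Defensive.
Import Order.TTheory GRing.Theory Num.Theory.
Import numFieldNormedType.Exports.
Local Open Scope classical_set_scope.
Local Open Scope ring_scope.

Record fps (F : fieldType) := FPS { fcoef : nat -> F }.

HB.instance Definition _ (F : fieldType) := gen_eqMixin (fps F).
HB.instance Definition _ (F : fieldType) := gen_choiceMixin (fps F).

Section PowerSeries.
Variable F : fieldType.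
Implicit Types (a b c : fps F) (n i : nat).

Lemma fpsP a b : (forall n, fcoef a n = fcoef b n) -> a = b.
Proof. by case: a b => [f] [g] /= /funext ->. Qed.

Definition fps0 : fps F := FPS (fun=> 0).
Definition fps1 : fps F := FPS (fun n => (n == 0%N)%:R).
Definition fpsX : fps F := FPS (fun n => (n == 1%N)%:R).
Definition fps_opp a : fps F := FPS (fun n => - fcoef a n).
Definition fps_add a b : fps F := FPS (fun n => fcoef a n + fcoef b n).
Definition fps_mul a b : fps F :=
  FPS (fun n => \sum_(i < n.+1) fcoef a i * fcoef b (n - i)).

Fact fps_addA : associative fps_add.
Proof. by move=> a b c; apply: fpsP => n /=; rewrite addrA. Qed.
Fact fps_addC : commutative fps_add.
Proof. by move=> a b; apply: fpsP => n /=; rewrite addrC. Qed.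
Fact fps_add0 : left_id fps0 fps_add.
Proof. by move=> a; apply: fpsP => n /=; rewrite add0r. Qed.
Fact fps_addN : left_inverse fps0 fps_opp fps_add.
Proof. by move=> a; apply: fpsP => n /=; rewrite addNr. Qed.

HB.instance Definition _ :=
  GRing.isZmodule.Build (fps F) fps_addA fps_addC fps_add0 fps_addN.

Let tr n a : {poly F} := \poly_(i < n.+1) fcoef a i.

Let tr_mul n a b i : (i <= n)%N ->
  fcoef (fps_mul a b) i = (tr n a * tr n b)`_i.
Proof.
move=> le_in; rewrite coefM; apply: eq_bigr => -[j /= ltji] _.
rewrite !coef_poly ltnS (leq_trans _ le_in) //.
by rewrite ltnS (leq_trans (leq_subr _ _) le_in).
Qed.

Fact fps_mulA : associative fps_mul.
Proof.
move=> a b c; apply: fpsP => n; rewrite !(@tr_mul n) //.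
have -> : (tr n a * tr n (fps_mul b c))`_n = (tr n a * (tr n b * tr n c))`_n.
  rewrite !coefM; apply: eq_bigr => i _; congr (_ * _).
  by rewrite coef_poly ltnS leq_subr (@tr_mul n) // leq_subr.
have -> : (tr n (fps_mul a b) * tr n c)`_n = ((tr n a * tr n b) * tr n c)`_n.
  rewrite !coefM; apply: eq_bigr => -[i /= ltin] _; congr (_ * _).
  by rewrite coef_poly ltin (@tr_mul n).
by rewrite mulrA.
Qed.

Fact fps_mulC : commutative fps_mul.
Proof. by move=> a b; apply: fpsP => n; rewrite !(@tr_mul n) // mulrC. Qed.

Fact fps_mul1 : left_id fps1 fps_mul.
Proof.
move=> a; apply: fpsP => n /=; rewrite big_ord_recl /= mul1r subn0.
by rewrite big1 ?addr0 // => i _; rewrite mul0r.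
Qed.

Fact fps_mulDl : left_distributive fps_mul fps_add.
Proof.
move=> a b c; apply: fpsP => n /=; rewrite -big_split /=.
by apply: eq_bigr => i _; rewrite mulrDl.
Qed.

Fact fps1_neq0 : fps1 != fps0.
Proof.
apply/eqP => /(congr1 (fun a => fcoef a 0%N)) /= /eqP.
by rewrite oner_eq0.
Qed.

HB.instance Definition _ := GRing.Zmodule_isComNzRing.Build (fps F)
  fps_mulA fps_mulC fps_mul1 fps_mulDl fps1_neq0.

Definition fps_unit : {pred fps F} := fun a => `[< exists b, b * a = 1 >].
Definition fps_inv a : fps F :=
  if a \in fps_unit then xget 0 [set b | b * a = 1] else a.

Fact fps_mulV : {in fps_unit, left_inverse 1 fps_inv *%R}.
Proof.
move=> a ua; rewrite /fps_inv ua.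
by move: ua; rewrite unfold_in => /asboolP exb; apply: (xgetPex 0 exb).
Qed.
Fact fps_unitPl a b : b * a = 1 -> fps_unit a.
Proof. by move=> ba; apply/asboolP; exists b. Qed.
Fact fps_inv_out : {in [predC fps_unit], fps_inv =1 id}.
Proof. by move=> a; rewrite inE /= /fps_inv => /negbTE ->. Qed.

HB.instance Definition _ := GRing.ComNzRing_hasMulInverse.Build (fps F)
  fps_mulV fps_unitPl fps_inv_out.

Fact fps_neq0 a : a != 0 -> exists n, fcoef a n != 0.
Proof.
move=> a0; apply: contrapT => /forallNP h; case/eqP: a0.
by apply: fpsP => n /=; apply/eqP/negPn/negP/h.
Qed.

Fact fps_integral : GRing.integral_domain_axiom (fps F).
Proof.
move=> a b ab0; apply: contraT; rewrite negb_or => /andP[/fps_neq0 a0 /fps_neq0 b0].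
case: (ex_minnP a0) => m am minm; case: (ex_minnP b0) => n bn minn.
have /eqP : fcoef (a * b) (m + n) = 0 by rewrite ab0.
have lt_m : (m < (m + n).+1)%N by rewrite ltnS leq_addr.
rewrite /= (bigD1 (Ordinal lt_m)) //= addKn big1 ?addr0.
  by rewrite mulf_eq0 (negbTE am) (negbTE bn).
move=> [i /= lti] /eqP ine; case: (ltngtP i m) => [ltim | ltmi | eim].
- have [-> |/minm] := eqVneq (fcoef a i) 0; first by rewrite mul0r.
  by rewrite leqNgt ltim.
- have [-> |/minn] := eqVneq (fcoef b (m + n - i)) 0; first by rewrite mulr0.
  rewrite leq_subRL; last by rewrite -ltnS.
  by rewrite leq_add2r leqNgt ltmi.
- by case: ine; apply: val_inj.
Qed.

HB.instance Definition _ := GRing.ComUnitRing_isIntegral.Build (fps F)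
  fps_integral.

End PowerSeries.

Section BruhatTits.
Variable F : finFieldType.

(* The power series variable [fpsX F] stands for t^-1. *)
Definition laurent : fieldType := {fraction fps F}.
Definition unif : laurent := FracField.tofrac (fpsX F).
Definition O_K : set laurent := [set x | exists p : fps F, x = FracField.tofrac p].

Definition O_lattice : set (set 'cV[laurent]_2) :=
  [set L | exists2 B : 'M[laurent]_2, B \in unitmx &
     L = [set B *m u | u in [set u : 'cV[laurent]_2 | forall i, O_K (u i 0)]]].

Definition homothety (c : laurent) (L : set 'cV[laurent]_2) :
  set 'cV[laurent]_2 := [set c *: u | u in L].

(* The vertices are the homothety classes of O_K-lattices in K^2. *)
Definition hclass := set (set 'cV[laurent]_2).

Definition vertex : set hclass :=
  [set X | exists2 L, O_lattice L & X = [set homothety c L | c in [set c | c != 0]]].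

Definition tree_adjacent (X Y : hclass) : Prop :=
  exists L M, [/\ X L, Y M, homothety unif L `<=` M, M `<=` L
                & M <> L /\ M <> homothety unif L].

Definition neighbours (X : hclass) : set hclass :=
  [set Y | vertex Y /\ tree_adjacent X Y].

(* An element of PGL_2(K) is the set of all nonzero multiples of an invertible
   matrix. *)
Definition pgl := set 'M[laurent]_2.
Definition pclass (g : 'M[laurent]_2) : pgl := [set c *: g | c in [set c | c != 0]].
Definition PGL2 : set pgl := [set pclass g | g in [set g | g \in unitmx]].
Definition pgl_mul (a b : pgl) : pgl := [set x *m y | x in a & y in b].
Definition pgl_inv (a : pgl) : pgl := [set invmx x | x in a].

Definition pgl_act (a : pgl) (X : hclass) : hclass :=
  [set [set x *m u | u in L] | x in a & L in X].

Definition subgroup (G : set pgl) : Prop :=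
  [/\ G `<=` PGL2, G (pclass 1%:M) &
      forall a b, G a -> G b -> G (pgl_mul a (pgl_inv b))].

Definition grp_order (G : set pgl) : nat := #|` fset_set G|.

Definition cosets (G H : set pgl) : set (set pgl) :=
  [set [set pgl_mul a h | h in H] | a in G].

Definition grp_index (G H : set pgl) : nat := #|` fset_set (cosets G H)|.

Definition stab (G : set pgl) (X : hclass) : set pgl :=
  [set a | G a /\ pgl_act a X = X].

Definition orbit_equiv (G : set pgl) (X Y : hclass) : Prop :=
  exists2 a, G a & pgl_act a X = Y.

(* The Haar covolume of G is, up to normalisation, the sum of 1/|G_X| over the
   G-orbits of vertices X; the partial sums are bounded here over finite families
   of pairwise inequivalent vertices. *)
Definition finite_covolume (G : set pgl) : Prop :=
  exists B : rat, forall s : seq hclass, uniq s ->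
    (forall X, X \in s -> vertex X) ->
    (forall X Y, X \in s -> Y \in s -> orbit_equiv G X Y -> X = Y) ->
    \sum_(X <- s) (grp_order (stab G X))%:R^-1 <= B.

(* A subgroup of PGL_2(K) is discrete iff its vertex stabilizers are finite. *)
Definition is_lattice (G : set pgl) : Prop :=
  [/\ subgroup G, forall X, vertex X -> finite_set (stab G X) & finite_covolume G].

(* The quotient of the tree is infinite. *)
Definition nonuniform (G : set pgl) : Prop :=
  ~ exists s : seq hclass, forall X, vertex X ->
      exists2 Y, Y \in s & orbit_equiv G X Y.

Definition subring (A : set laurent) : Prop :=
  [/\ A 1, forall x y, A x -> A y -> A (x - y) & forall x y, A x -> A y -> A (x * y)].

Definition subfield (k : set laurent) : Prop :=
  subring k /\ forall x, k x -> k x^-1.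

Definition generated_field (E : set laurent) : set laurent :=
  [set x | forall k, subfield k -> E `<=` k -> k x].

Definition transcendental (k0 : set laurent) (T : laurent) : Prop :=
  forall P : {poly laurent}, P != 0 -> (forall i, k0 P`_i) -> P.[T] != 0.

(* A global function field: a finite extension of F_p(T), T transcendental over
   the prime field F_p. *)
Definition function_field (k : set laurent) : Prop :=
  subfield k /\
  exists2 T, k T /\ transcendental (generated_field set0) T &
  exists (m : nat) (e : 'I_m -> laurent), (forall i, k (e i)) /\
    forall x, k x -> exists2 c : 'I_m -> laurent,
      forall i, generated_field [set T] (c i) & x = \sum_(i < m) c i * e i.

Definition dense_subfield (k : set laurent) : Prop :=
  forall (x : laurent) (n : nat), exists y z,
    [/\ k y, O_K z & x - y = unif ^+ n * z].

(* The nontrivial valuation rings of k: the local rings at the places of k. *)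
Definition place_of (k B : set laurent) : Prop :=
  [/\ subring B, B `<=` k, B <> k & forall x, k x -> B x \/ B x^-1].

(* The elements of k regular at every place other than the place k :&: O_K. *)
Definition regular_ring (k : set laurent) : set laurent :=
  [set x | k x /\ forall B, place_of k B -> B <> k `&` O_K -> B x].

Definition PGL2_over (A : set laurent) : set pgl :=
  [set pclass g | g in [set g : 'M[laurent]_2 |
     [/\ g \in unitmx, forall i j, A (g i j) & forall i j, A (invmx g i j)]]].

Definition commensurable (G H : set pgl) : Prop :=
  finite_set (cosets G (G `&` H)) /\ finite_set (cosets H (G `&` H)).

(* K is the completion of the dense function field k at the place k :&: O_K. A
   non-uniform arithmetic lattice comes from an isotropic k-form of PGL_2, hence
   from PGL_2 over k itself. *)
Definition arithmetic_subgroup (G : set pgl) : Prop :=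
  exists (k : set laurent) (a : pgl),
    [/\ function_field k, dense_subfield k, PGL2 a &
        commensurable G
          [set pgl_mul (pgl_mul a g) (pgl_inv a) | g in PGL2_over (regular_ring k)]].

Definition nonuniform_arithmetic_lattice (G : set pgl) : Prop :=
  [/\ is_lattice G, nonuniform G & arithmetic_subgroup G].

End BruhatTits.

(* [R[i]] typed as a [numClosedFieldType], so that it gets its norm topology. *)
Definition Cplx (R : realType) : numClosedFieldType := R[i].

Section Complex.
Variable R : realType.
Local Notation C := (Cplx R).

Definition toC (x : R) : C := Complex x 0.
Definition cexp (z : C) : C :=
  toC (expR (complex.Re z)) * Complex (cos (complex.Im z)) (sin (complex.Im z)).

Definition cderivable (f : R -> C) (t : R) : Prop :=
  derivable (fun u => complex.Re (f u)) t 1 /\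
  derivable (fun u => complex.Im (f u)) t 1.
Definition cderive (f : R -> C) (t : R) : C :=
  Complex (derive1 (fun u => complex.Re (f u)) t)
          (derive1 (fun u => complex.Im (f u)) t).

(* [l] is the value at [z] of a holomorphic continuation of [f] from a punctured
   neighbourhood of [z] to a full neighbourhood; [f z] itself is disregarded. *)
Definition continues (f : C -> C) (z l : C) : Prop :=
  exists g : C -> C, [/\ \forall w \near z, derivable g w 1,
                         \forall w \near z^', f w = g w & g z = l].
Definition holomorphic_at (f : C -> C) (z : C) : Prop := exists l, continues f z l.
Definition continuation (f : C -> C) (z : C) : C := xget 0 [set l | continues f z l].

Definition local_log (f l : R -> C) (t : R) : Prop :=
  \forall u \near t, {for u, continuous l} /\ cexp (l u) = f u.

Definition adjmx m n (M : 'M[C]_(m, n)) : 'M[C]_(n, m) := (map_mx Num.conj M)^T.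

Definition traceless r (M : 'M[C]_r) : 'M[C]_r := M - (r%:R^-1 * \tr M)%:M.

Definition cesaro_mean r (G : nat -> 'M[C]_r) (L : nat) : 'M[C]_r :=
  L%:R^-1 *: \sum_(1 <= N < L.+1) G N.

End Complex.

Definition label (d r : nat) : choiceType := ('I_d + 'I_r * nat)%type.
Definition core d r (i : 'I_d) : label d r := inl i.
(* The vertex (c, n), n >= 1. *)
Definition cusp d r (c : 'I_r) (n : nat) : label d r := inr (c, n.-1).

Section Quotient.
Variables (R : realType) (F : finFieldType) (G : set (pgl F)) (d r : nat).
Local Notation C := (Cplx R).
Variable lift : label d r -> hclass F.

Definition quotient_vertex (v : label d r) (X : hclass F) : label d r :=
  xget v [set u | orbit_equiv G (lift u) X].

Definition edge_orbits (v : label d r) : set (set (hclass F)) :=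
  [set [set pgl_act a Y | a in stab G (lift v)] | Y in neighbours (lift v)].

(* An oriented edge issuing from [lift v] is given by its terminal vertex. *)
Definition adjacency (f : label d r -> C) (v : label d r) : C :=
  \sum_(o \in edge_orbits v)
    let Y := xget (lift v) o in
    (grp_index (stab G (lift v)) (stab (stab G (lift v)) Y))%:R
      * f (quotient_vertex v Y).

Definition lambda (v : label d r) : R := (grp_order (stab G (lift v)))%:R^-1.

Definition delta (u v : label d r) : C := (v == u)%:R.

End Quotient.

Record cusped_quotient (R : realType) (F : finFieldType) (G : set (pgl F))
    (d r : nat) := CuspedQuotient {
  lift : label d r -> hclass F;
  width : 'I_r -> R;
  core_gt0 : (0 < d)%N;
  lift_vertex : forall v, vertex (lift v);
  lift_surj : forall X, vertex X -> exists v, orbit_equiv G (lift v) X;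
  lift_inj : forall u v, orbit_equiv G (lift u) (lift v) -> u = v;
  width_gt0 : forall c, 0 < width c;
  lambda_cusp : forall c n, (1 <= n)%N ->
    lambda R G lift (cusp d c n) = width c * (#|F|%:R + 1) / #|F|%:R ^+ n;
  adjacency_cusp : forall (f : label d r -> Cplx R) c n, (2 <= n)%N ->
    adjacency G lift f (cusp d c n)
    = #|F|%:R * f (cusp d c n.-1) + f (cusp d c n.+1);
  adjacency_cusp1 : forall c c' n, (1 <= n)%N ->
    adjacency G lift (delta R (cusp d c' n)) (cusp d c 1)
    = ((c' == c) && (n == 2%N))%:R
}.

Section Scattering.
Variables (R : realType) (F : finFieldType) (G : set (pgl F)) (d r : nat).
Variable Y : cusped_quotient R G d r.
Local Notation C := (Cplx R).
Local Notation q := (#|F|%:R : R).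
Local Notation A := (adjacency G (lift Y)).
Local Notation lam := (lambda R G (lift Y)).

Definition sqrt_q : C := toC (Num.sqrt q).

Definition jacobi (f : label d r -> C) (v : label d r) : C :=
  toC (Num.sqrt (lam v)) * A (fun u => toC (Num.sqrt (lam u))^-1 * f u) v.

Definition core_mx : 'M[C]_d :=
  \matrix_(i, j) jacobi (delta R (core r j)) (core r i).
Definition coupling_mx : 'M[C]_(d, r) :=
  \matrix_(i, c) jacobi (delta R (cusp d c 1)) (core r i).

Definition F_mx (z : C) : 'M[C]_d :=
  core_mx - (sqrt_q * (z + z^-1))%:M
  + (z^-1 / sqrt_q) *: (coupling_mx *m adjmx coupling_mx).

Definition S_formula (z : C) : 'M[C]_r :=
  - 1%:M + ((z^-1 - z) / sqrt_q) *:
    (adjmx coupling_mx *m invmx (F_mx z) *m coupling_mx).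

Definition S_mx (z : C) : 'M[C]_r :=
  \matrix_(i, j) continuation (fun w => S_formula w i j) z.

Definition qpow (s : C) : C := cexp (s * toC (ln q)).

Definition is_eisenstein (s : C) (b : 'cV[C]_r) (f : label d r -> C) : Prop :=
  (forall v, A f v = (qpow s + qpow (1 - s)) * f v) /\
  exists b' : 'cV[C]_r, forall c n, (1 <= n)%N ->
    f (cusp d c n) = qpow (n%:R * s) * b c 0 + qpow (n%:R * (1 - s)) * b' c 0.

(* Meaningful at the s for which [F_mx (qpow (s - 1/2))] is invertible and
   qpow (s - 1/2) <> 1, -1: there the solution is unique. *)
Definition eis_generic (s : C) (b : 'cV[C]_r) : label d r -> C :=
  xget (fun=> 0) [set f | is_eisenstein s b f].

Definition S_aut_generic (s : C) : 'M[C]_r :=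
  xget 0 [set M | forall (b : 'cV[C]_r) c n, (1 <= n)%N ->
    eis_generic s b (cusp d c n)
    = qpow (n%:R * s) * b c 0 + qpow (n%:R * (1 - s)) * (M *m b) c 0].

Definition eis (s : C) (b : 'cV[C]_r) (v : label d r) : C :=
  continuation (fun w => eis_generic w b v) s.

Definition S_aut (s : C) : 'M[C]_r :=
  \matrix_(i, j) continuation (fun w => S_aut_generic w i j) s.

Definition s_theta (t : R) : C := Complex (2%:R^-1) (t / ln q).
Definition circle (t : R) : C := cexp (Complex 0 t).

Definition holomorphic_point (t : R) : Prop :=
  [/\ forall b v, holomorphic_at (fun w => eis_generic w b v) (s_theta t),
      forall i j, holomorphic_at (fun w => S_formula w i j)
                                 (qpow (s_theta t - 2%:R^-1)) &
      forall i j, holomorphic_at (fun w => S_aut_generic w i j) (s_theta t)].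

(* The support of the projection chi_N. *)
Definition truncation (N : nat) : set (label d r) :=
  [set v | (exists i, v = core r i) \/
           (exists c n, [/\ (1 <= n)%N, (n <= N)%N & v = cusp d c n])].

Definition std_basis (c : 'I_r) : 'cV[C]_r := delta_mx c 0.

Definition gram (N : nat) (s : C) : 'M[C]_r :=
  \matrix_(c, c') \sum_(v \in truncation N)
    eis s (std_basis c') v * (eis s (std_basis c) v)^* * toC (lam v).

Definition W_invsqrt : 'M[C]_r := diag_mx (\row_c toC (Num.sqrt (width Y c))^-1).

Definition normalized_gram (N : nat) (t : R) : 'M[C]_r :=
  toC (q + 1)^-1 *: (W_invsqrt *m gram N (s_theta t) *m W_invsqrt).

Definition renormalized_gram (N : nat) (t : R) : 'M[C]_r :=
  normalized_gram N t - (2 * N + 1)%:R%:M.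

Definition time_delay (t : R) : 'M[C]_r :=
  'i *: (adjmx (S_mx (circle t)) *m
         \matrix_(i, j) cderive (fun u => S_mx (circle u) i j) t).

End Scattering.

(* Main.v *)
(* In the coordinates of the Jacobi operator, the generalized eigenfunctions with
   parameter [z = e^(i theta)] restrict to the core as the columns of a matrix [U] with
   [V^* U = a (1 + S)] and [H U + V (z + z^-1 S) = x U].  Green's identity for the
   solutions at two angles gives the unitarity of [S] when the angles agree, and, divided
   by the difference of the eigenvalues and taken to the limit, the Maass-Selberg relation
   [U^* U = 1 + i S^* S' + (z - z^-1)^-1 (z S^* - z^-1 S)].  The truncated Gram matrix is
   [U^* U] plus the sum of [(z^n + z^-n S)^* (z^n + z^-n S)] over [1 <= n <= N], hence
   [(2 N + 1) + i S^* S'] plus multiples of [z^(2 N)] and [z^(-2 N)], whose Cesaro means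
   vanish.  The trace formulas are Jacobi's formula for the derivative of a determinant.

   For the last assertion, the subgroup of [SL_2(F_2[t])] of matrices with lower left entry
   divisible by [t] has an apartment as fundamental domain: one core vertex and two cusps
   of different widths.  Exchanging the labels of the cusps preserves both determinants
   and exchanges the diagonal entries of [i S^* S']. *)
From HB Require Import structures.
From mathcomp Require Import all_boot all_order all_algebra.
From mathcomp Require Import finmap perm complex.
From mathcomp Require Import all_classical all_reals all_analysis.
From mathcomp Require Import ring lra zify.
Require Import Defs.
Set Implicit Arguments.
Unset Strict Implicit.
Unset Printing Implicit Defensive.
Import Order.TTheory GRing.Theory Num.Theory.
Import numFieldNormedType.Exports.
Local Open Scope classical_set_scope.
Local Open Scope ring_scope.

(** * Laurent series *)

(** At the given angle [F] may be singular, so [U] and [S] need not be given there by their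
    formulas. Identities at that angle are therefore obtained as limits along nearby angles, where
    [F] is invertible because the zeros of its determinant are isolated. Holomorphy of the
    Eisenstein family supplies the limit [U0] of [U]. Green's identity is taken between the fixed
    [U0] and a variable [U]: division by the difference of the eigenvalues then asks only for
    convergence of [U], and the derivative falls on [S] alone.

    The symmetry behind Green's identity is a double count of the group elements that carry one
    vertex next to another.

    In the example [S = -1 + f(z) v v^T] with a scalar [f], where [v] is [(sqrt 2, 2)] or
    [(2, sqrt 2)] according to the labelling. The determinant depends on [v] only through
    [v^T v = 6], whereas [i S^* S'] is a multiple of [v v^T], whose diagonal entries are in the
    ratio of 2 to 4. *)

Section FpsTheory.
Variable F : fieldType.
Implicit Types (p r : fps F) (n : nat).

Lemma fcoefD p r n : fcoef (p + r) n = fcoef p n + fcoef r n.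
Proof. by []. Qed.

Lemma fcoefM0 p r : fcoef (p * r) 0 = fcoef p 0 * fcoef r 0.
Proof. by rewrite /= big_ord1. Qed.

Definition fpsC (c : F) : fps F := FPS (fun n => if n is 0%N then c else 0).

Fact fpsC_additive : zmod_morphism fpsC.
Proof. by move=> c c'; apply: fpsP => -[|n] //=; rewrite subr0. Qed.
HB.instance Definition _ :=
  GRing.isZmodMorphism.Build F (fps F) fpsC fpsC_additive.
Fact fpsC_monoid : monoid_morphism fpsC.
Proof.
split; first by apply: fpsP => -[|n].
move=> c c'; apply: fpsP => -[|n] /=; first by rewrite big_ord1.
by rewrite big_ord_recl /= big1 ?addr0 ?mulr0 // => i _; rewrite mul0r.
Qed.
HB.instance Definition _ :=
  GRing.isMonoidMorphism.Build F (fps F) fpsC fpsC_monoid.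

Definition fps_shift p : fps F := FPS (fun n => fcoef p n.+1).

Lemma fcoefXM p n : fcoef (fpsX F * p) n = if n is m.+1 then fcoef p m else 0.
Proof.
case: n => [|n]; first by rewrite /= big_ord1 mul0r.
rewrite /= 2!big_ord_recl /= mul0r add0r mul1r /= subSS subn0.
by rewrite big1 ?addr0 // => i _; rewrite /= mul0r.
Qed.

Lemma fcoefXnM k p n :
  fcoef (fpsX F ^+ k * p) n = if (n < k)%N then 0 else fcoef p (n - k).
Proof.
elim: k n => [|k IH] n; first by rewrite expr0 mul1r subn0.
by rewrite exprS -mulrA fcoefXM; case: n => [|n] //; rewrite IH.
Qed.

Lemma fpsX_neq0 : fpsX F != 0.
Proof.
apply/eqP => /(congr1 (fun p => fcoef p 1)) /= /eqP; by rewrite oner_eq0.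
Qed.

Lemma fps_split p : p = fpsC (fcoef p 0) + fpsX F * fps_shift p.
Proof.
apply: fpsP => -[|n]; rewrite fcoefD fcoefXM ?addr0 //=.
by rewrite add0r.
Qed.

(** The first [n] coefficients of [1 / p]. Each new one is solved from a coefficient of [p * g = 1]
    and uses all earlier ones, hence the list. *)
Fixpoint inv_coefs p n : seq F :=
  if n is m.+1 then
    let s := inv_coefs p m in
    rcons s ((fcoef p 0)^-1 *
             ((m == 0%N)%:R - \sum_(i < m) fcoef p (m - i) * s`_i))
  else [::].

Lemma fps_unitE p : (p \is a GRing.unit) = (fcoef p 0 != 0).
Proof.
apply/idP/idP => [up|p0].
  have /(congr1 (fun p => fcoef p 0)) := mulrV up; rewrite fcoefM0 /= => e.
  by apply/eqP => z; move/eqP: e; rewrite z mul0r eq_sym oner_eq0.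
have sz n : size (inv_coefs p n) = n.
  by elim: n => //= n IH; rewrite size_rcons IH.
pose g := FPS (fun n => (inv_coefs p n.+1)`_n).
have gE n i : (i < n)%N -> (inv_coefs p n)`_i = fcoef g i.
  elim: n => // n IH; rewrite ltnS leq_eqVlt => /orP[/eqP -> //|lt].
  by rewrite /= nth_rcons sz lt IH.
apply/unitrP; exists g; suff pg : p * g = 1 by split => //; rewrite mulrC.
apply: fpsP => n; rewrite mulrC /= big_ord_recr /= subnn nth_rcons sz ltnn eqxx.
rewrite mulrC mulrA mulfV // mul1r addrC.
under [X in _ - X]eq_bigr => i _ do rewrite gE // mulrC.
by rewrite subrK.
Qed.

Lemma fps_Xn_unit p : p != 0 ->
  exists k u, u \is a GRing.unit /\ p = fpsX F ^+ k * u.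
Proof.
move=> /fps_neq0 ex; case: (ex_minnP ex) => k pk mink.
exists k, (FPS (fun n => fcoef p (n + k))); rewrite fps_unitE /=; split => //.
apply: fpsP => n; rewrite fcoefXnM /=; case: ltnP => h; last by rewrite subnK.
by apply/eqP; apply: contraTT h => /mink; rewrite -leqNgt.
Qed.

End FpsTheory.

(* What the tree uses of a discretely valued field: [vO] is the valuation ring,
   [vX] a uniformizer and [vC] a section of the residue map. *)
Record dvfield (F : finFieldType) (K : fieldType) := DVField {
  vO : set K;
  vX : K;
  vC : {rmorphism F -> K};
  vO1 : vO 1;
  vOB : forall x y, vO x -> vO y -> vO (x - y);
  vOM : forall x y, vO x -> vO y -> vO (x * y);
  vOX : vO vX;
  vX_neq0 : vX != 0;
  vXinvN : ~ vO vX^-1;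
  vOC : forall c, vO (vC c);
  vO_split : forall x, vO x -> exists c y, vO y /\ x = vC c + vX * y;
  vO_unit_or : forall x, vO x ->
    (x != 0 /\ vO x^-1) \/ exists2 y, vO y & x = vX * y;
  v_repr : forall x, x != 0 ->
    exists (k : int) u, [/\ vO u, vO u^-1 & x = vX ^ k * u]
}.

Section LaurentFin.
Variable F : finFieldType.
Local Notation K := (laurent F).
Local Notation X := (unif F).
Implicit Types x y : K.

Definition fpsK (p : fps F) : K := FracField.tofrac p.
HB.instance Definition _ := GRing.RMorphism.copy fpsK (@FracField.tofrac (fps F)).

Lemma fpsK_inj : injective fpsK.
Proof. by move=> x y /eqP; rewrite tofrac_eq => /eqP. Qed.

Lemma fpsK_eq0 p : (fpsK p == 0) = (p == 0).
Proof. exact: tofrac_eq0. Qed.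

Lemma unifE : X = fpsK (fpsX F).
Proof. by []. Qed.

Lemma unif_neq0 : X != 0.
Proof. by rewrite unifE fpsK_eq0 fpsX_neq0. Qed.

Lemma OK_fps p : O_K (fpsK p).
Proof. by exists p. Qed.

Lemma OK1 : O_K (1 : K). Proof. by exists 1; rewrite rmorph1. Qed.
Lemma OKB x y : O_K x -> O_K y -> O_K (x - y).
Proof. by move=> [p ->] [r ->]; exists (p - r); rewrite tofracB. Qed.
Lemma OKM x y : O_K x -> O_K y -> O_K (x * y).
Proof. by move=> [p ->] [r ->]; exists (p * r); rewrite tofracM. Qed.
Lemma OKX : O_K X. Proof. by exists (fpsX F). Qed.

Definition KC (c : F) : K := fpsK (fpsC c).
HB.instance Definition _ := GRing.RMorphism.copy KC (fpsK \o @fpsC F).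

Lemma OKC c : O_K (KC c). Proof. by eexists. Qed.

Lemma OK_split x : O_K x -> exists c y, O_K y /\ x = KC c + X * y.
Proof.
move=> [p ->]; exists (fcoef p 0), (fpsK (fps_shift p)); split; first by eexists.
by rewrite -[LHS]/(fpsK p) {1}[p]fps_split rmorphD rmorphM.
Qed.

Lemma OK_unit_or x : O_K x -> (x != 0 /\ O_K x^-1) \/ exists2 y, O_K y & x = X * y.
Proof.
move=> /[dup] ox [p xE]; have [p0|p0] := eqVneq (fcoef p 0) 0.
  right; exists (fpsK (fps_shift p)); first by eexists.
  rewrite xE -[LHS]/(fpsK p) {1}[p]fps_split p0 rmorphD rmorphM.
  by rewrite [fpsC 0]raddf0 raddf0 add0r.
have up : p \is a GRing.unit by rewrite fps_unitE.
left; split; first by rewrite xE -[FracField.tofrac p]/(fpsK p) fpsK_eq0; apply: contraTneq up => ->; rewrite unitr0.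
exists p^-1; rewrite xE -[LHS]/((fpsK p)^-1) -[RHS]/(fpsK p^-1).
by rewrite rmorphV.
Qed.

Lemma XinvNOK : ~ O_K X^-1.
Proof.
case=> p e; have : X * fpsK p = 1 by rewrite -[fpsK p]e mulfV ?unif_neq0.
rewrite unifE -rmorphM -(rmorph1 fpsK) => /fpsK_inj.
move/(congr1 (fun p => fcoef p 0)); rewrite fcoefXM /= => /eqP.
by rewrite eq_sym oner_eq0.
Qed.

Lemma laurent_repr x : x != 0 -> exists (k : int) u, [/\ O_K u, O_K u^-1 & x = X ^ k * u].
Proof.
move=> x0.
have [p [r [r0 xE]]] : exists p r, r != 0 /\ x = fpsK p / fpsK r.
  elim/quotW: x x0 => f _; exists f.1, f.2; split; first exact: denom_ratioP.
  apply: (canRL (mulfK _)); first by rewrite fpsK_eq0 denom_ratioP.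
  (* The identity [x * r = p] is checked on representing pairs, by cross multiplication. *)
  rewrite /fpsK; unlock FracField.tofrac; rewrite -[LHS]FracField.pi_mul.
  apply/eqmodP; rewrite /= FracField.equivfE /FracField.mulf.
  by rewrite !numden_Ratio ?oner_eq0 ?mulr1 ?denom_ratioP // mulrC.
have p0 : p != 0 by apply: contraNneq x0 => p0; rewrite xE p0 rmorph0 mul0r.
have [i [u [uu pE]]] := fps_Xn_unit p0; have [j [v [vv rE]]] := fps_Xn_unit r0.
exists (i%:Z - j%:Z), (fpsK (u / v)); split.
  exact: OK_fps.
- by rewrite -rmorphV ?unitrM ?unitrV ?uu //; exact: OK_fps.
rewrite xE pE rE !rmorphM !rmorphXn rmorphV //= -unifE expfzDr ?unif_neq0 //.
by rewrite -exprnN invfM mulrACA.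
Qed.

Definition laurent_dv : dvfield F K :=
  DVField OK1 OKB OKM OKX unif_neq0 XinvNOK OKC OK_split OK_unit_or laurent_repr.

End LaurentFin.

(** * Lattice classes *)

Lemma ord2P (i : 'I_2) : i = 0 \/ i = 1.
Proof. by case: i => -[|[|//]] hi; [left|right]; apply: val_inj. Qed.

Section Mx2.
Variable R : comUnitRingType.
Definition mx2 (a b c d : R) : 'M[R]_2 :=
  \matrix_(i, j) if i == 0 then if j == 0 then a else b
                 else if j == 0 then c else d.

Lemma mx2_eta (M : 'M[R]_2) : M = mx2 (M 0 0) (M 0 1) (M 1 0) (M 1 1).
Proof.
apply/matrixP => i j; rewrite mxE.
by case: (ord2P i) => ->; case: (ord2P j) => ->.
Qed.

Lemma mx2E a b c d :
  (mx2 a b c d 0 0 = a) * (mx2 a b c d 0 1 = b) *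
  (mx2 a b c d 1 0 = c) * (mx2 a b c d 1 1 = d).
Proof. by rewrite !mxE. Qed.

Lemma mx2_inj a b c d a' b' c' d' : mx2 a b c d = mx2 a' b' c' d' ->
  [/\ a = a', b = b', c = c' & d = d'].
Proof.
move=> /matrixP e; split.
- by have := e 0 0; rewrite !mx2E.
- by have := e 0 1; rewrite !mx2E.
- by have := e 1 0; rewrite !mx2E.
- by have := e 1 1; rewrite !mx2E.
Qed.

Lemma mulmx2 a b c d a' b' c' d' : mx2 a b c d *m mx2 a' b' c' d' =
  mx2 (a * a' + b * c') (a * b' + b * d') (c * a' + d * c') (c * b' + d * d').
Proof.
rewrite [LHS]mx2_eta; congr mx2; rewrite !mxE big_ord_recl big_ord1 !mxE //=.
Qed.

Lemma scalemx2 k a b c d : k *: mx2 a b c d = mx2 (k * a) (k * b) (k * c) (k * d).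
Proof. by rewrite [LHS]mx2_eta !mxE. Qed.

Lemma mx2_scalar k : k%:M = mx2 k 0 0 k.
Proof. by rewrite [LHS]mx2_eta !mxE. Qed.

Lemma det_mx2 a b c d : \det (mx2 a b c d) = a * d - b * c.
Proof.
rewrite (expand_det_row _ 0) !big_ord_recl big_ord0 /cofactor !det_mx11 !mxE /=.
by rewrite expr0 expr1 mul1r mulN1r mulrN addr0.
Qed.

Lemma invmx2 a b c d : a * d - b * c \is a GRing.unit ->
  invmx (mx2 a b c d) = (a * d - b * c)^-1 *: mx2 d (- b) (- c) a.
Proof.
move=> u; have um : mx2 a b c d \in unitmx by rewrite unitmxE det_mx2.
apply: (can_inj (mulKmx um)); rewrite mulmxV // -scalemxAr mulmx2 scalemx2.
rewrite mx2_scalar; congr mx2.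
- by rewrite mulrN mulVr.
- by rewrite mulrN [b * a]mulrC addNr mulr0.
- by rewrite mulrN [d * c]mulrC subrr mulr0.
- by rewrite mulrN [_ + d * a]addrC [d * a]mulrC [c * b]mulrC mulVr.
Qed.
End Mx2.

Section Lattices.
Variables (F : finFieldType) (K : fieldType) (V : dvfield F K).
Local Notation X := (vX V).
Local Notation O := (vO V).
Local Notation KC := (vC V).
Implicit Types (x y c : K) (B N g : 'M[K]_2).

Lemma vO0 : O 0. Proof. by rewrite -(subrr 1); apply: vOB; exact: vO1. Qed.
Lemma vON x : O x -> O (- x).
Proof. by move=> hx; rewrite -sub0r; apply: vOB => //; exact: vO0. Qed.
Lemma vOD x y : O x -> O y -> O (x + y).
Proof. by move=> hx hy; rewrite -[y]opprK; apply: vOB => //; apply: vON. Qed.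
Lemma vOXn n x : O x -> O (x ^+ n).
Proof.
by move=> ox; elim: n => [|n IH]; rewrite ?expr0 ?exprS; [exact: vO1|apply: vOM].
Qed.

Lemma vO_Xz (k : int) : O (X ^ k) <-> (0 <= k)%R.
Proof.
split; last by case: k => // k _; apply: vOXn; exact: vOX.
case: k => // k; rewrite NegzE => h; exfalso; apply: (@vXinvN _ _ V).
have -> : X^-1 = X ^ (- k.+1%:Z) * X ^+ k.
  rewrite -exprnN exprS invfM -mulrA mulVf ?mulr1 // expf_neq0 //.
  exact: vX_neq0.
by apply: vOM => //; apply: vOXn; exact: vOX.
Qed.

Definition MO m n (N : 'M[K]_(m, n)) := forall i j, O (N i j).

Lemma OK_sum n (f : 'I_n -> K) : (forall i, O (f i)) -> O (\sum_i f i).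
Proof.
move=> h; elim: n f h => [|n IH] f h; first by rewrite big_ord0; exact: vO0.
by rewrite big_ord_recl; apply: vOD => //; apply: IH.
Qed.

Lemma MOM m n p (A : 'M[K]_(m, n)) (B : 'M[K]_(n, p)) : MO A -> MO B -> MO (A *m B).
Proof. by move=> hA hB i j; rewrite mxE; apply: OK_sum => k; apply: vOM. Qed.

Lemma MOD m n (A B : 'M[K]_(m, n)) : MO A -> MO B -> MO (A + B).
Proof. by move=> hA hB i j; rewrite mxE; apply: vOD. Qed.

Lemma MOZ m n x (A : 'M[K]_(m, n)) : O x -> MO A -> MO (x *: A).
Proof. by move=> hx hA i j; rewrite mxE; apply: vOM. Qed.

Lemma MO2P a b c d : MO (mx2 a b c d) <-> [/\ O a, O b, O c & O d].
Proof.
split=> [h|[ha hb hc hd] i j]; last by rewrite mxE; do 2?case: ifP.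
by split; [have := h 0 0|have := h 0 1|have := h 1 0|have := h 1 1]; rewrite mx2E.
Qed.

Definition lat B : set 'cV[K]_2 :=
  [set B *m u | u in [set u : 'cV[K]_2 | forall i, O (u i 0)]].

Definition homoth c (L : set 'cV[K]_2) := [set c *: u | u in L].

Definition cls B : set (set 'cV[K]_2) :=
  [set homoth c (lat B) | c in [set c | c != 0]].

Definition pclassK g : set 'M[K]_2 := [set c *: g | c in [set c | c != 0]].

Lemma homoth_lat c B : homoth c (lat B) = lat (c *: B).
Proof.
apply/seteqP; split=> w.
  by move=> [v [u hu <-] <-]; exists u => //; rewrite scalemxAl.
by move=> [u hu <-]; exists (B *m u); [exists u | rewrite scalemxAl].
Qed.

Lemma image_lat g B : [set g *m u | u in lat B] = lat (g *m B).
Proof.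
apply/seteqP; split=> w.
  by move=> [v [u hu <-] <-]; exists u => //; rewrite mulmxA.
by move=> [u hu <-]; exists (B *m u); [exists u | rewrite mulmxA].
Qed.

(** It suffices to test the columns of [B'], the images of the standard basis: the coordinates of
    column [j] in the basis [B] form column [j] of [invmx B *m B']. *)
Lemma lat_sub B B' : B \in unitmx -> lat B' `<=` lat B <-> MO (invmx B *m B').
Proof.
move=> uB; split=> [h i j|h w [u hu <-]].
  have /h[u hu e] : lat B' (B' *m (delta_mx j 0 : 'cV_2)).
    exists (delta_mx j 0) => // k; rewrite mxE eqxx andbT.
    by case: eqP => _; [exact: vO1|exact: vO0].
  have -> : (invmx B *m B') i j = u i 0.
    by rewrite -[u](mulKmx uB) e mulmxA -colE [RHS]mxE.
  exact: hu.
exists ((invmx B *m B') *m u); last by rewrite -mulmxA mulKVmx.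
have hu' : MO u by move=> i j; rewrite ord1.
by move=> i; exact: (MOM h hu').
Qed.

Lemma lat_eq B B' : B \in unitmx -> B' \in unitmx ->
  lat B = lat B' <-> MO (invmx B *m B') /\ MO (invmx B' *m B).
Proof.
move=> uB uB'; rewrite -!lat_sub //; split=> [->|[h1 h2]]; first by split.
by apply/seteqP.
Qed.

Lemma clsP B L : cls B L <-> exists2 c, c != 0 & L = lat (c *: B).
Proof.
split=> [[c c0 <-]|[c c0 ->]]; first by exists c => //; rewrite homoth_lat.
by exists c => //; rewrite homoth_lat.
Qed.

Lemma unitmxZr c B : c != 0 -> (c *: B \in unitmx) = (B \in unitmx).
Proof. by move=> c0; rewrite !unitmxE detZ unitrM unitfE expf_neq0. Qed.

Lemma cls_scale c B : c != 0 -> cls (c *: B) = cls B.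
Proof.
move=> c0; apply/seteqP; split=> L /clsP[k k0 ->]; apply/clsP.
  by exists (k * c); rewrite ?mulf_neq0 // scalerA.
by exists (k / c); rewrite ?mulf_neq0 ?invr_eq0 // scalerA mulfVK.
Qed.

Lemma cls_lat B B' : lat B = lat B' -> cls B = cls B'.
Proof. by rewrite /cls => ->. Qed.

Lemma cls_eq B B' : cls B = cls B' <-> exists2 c, c != 0 & lat (c *: B) = lat B'.
Proof.
split=> [e|[c c0 e]]; last by rewrite -(cls_scale B c0); apply: cls_lat.
have : cls B' (lat B') by apply/clsP; exists 1; rewrite ?oner_neq0 ?scale1r.
by rewrite -e => /clsP[c c0 ->]; exists c.
Qed.

Lemma pclassP g h : pclassK g h <-> exists2 c, c != 0 & h = c *: g.
Proof. by split=> [[c c0 <-]|[c c0 ->]]; exists c. Qed.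

(** Classes are sets of nonzero multiples and scalars commute with matrix products, so elementwise
    images of classes are again classes. Group elements and vertices can thus be handled through
    representing matrices. *)
Lemma act_cls g B : [set [set x *m u | u in L] | x in pclassK g & L in cls B] = cls (g *m B).
Proof.
apply/seteqP; split=> M.
  move=> [h /pclassP[c c0 ->] [L /clsP[k k0 ->] <-]].
  rewrite image_lat -scalemxAl -scalemxAr scalerA; apply/clsP.
  by exists (c * k); rewrite ?mulf_neq0.
move=> /clsP[c c0 ->]; exists g; first by exists 1; rewrite ?scale1r //=; exact: oner_neq0.
exists (lat (c *: B)); first by apply/clsP; exists c.
by rewrite image_lat scalemxAr.
Qed.

Lemma pgl_mulE g h : [set x *m y | x in pclassK g & y in pclassK h] = pclassK (g *m h).
Proof.
apply/seteqP; split=> M.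
  move=> [_ /pclassP[c c0 ->] [_ /pclassP[k k0 ->] <-]]; apply/pclassP.
  by exists (c * k); rewrite ?mulf_neq0 // -scalemxAl -scalemxAr scalerA.
move=> /pclassP[c c0 ->]; exists (c *: g); first by apply/pclassP; exists c.
exists h; last by rewrite scalemxAl.
by apply/pclassP; exists 1; rewrite ?oner_neq0 ?scale1r.
Qed.

Lemma pgl_invE g : g \in unitmx -> [set invmx x | x in pclassK g] = pclassK (invmx g).
Proof.
move=> ug; apply/seteqP; split=> M.
  move=> [_ /pclassP[c c0 ->] <-]; apply/pclassP; exists c^-1; rewrite ?invr_eq0 //.
  by rewrite invmxZ // unitmxZr.
move=> /pclassP[c c0 ->]; exists (c^-1 *: g).
  by apply/pclassP; exists c^-1; rewrite ?invr_eq0.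
by rewrite invmxZ ?unitmxZr ?invr_eq0 // invrK.
Qed.

Lemma pclass_eq g h : pclassK g = pclassK h <-> exists2 c, c != 0 & h = c *: g.
Proof.
split=> [e|[c c0 ->]].
  by apply/pclassP; rewrite e; apply/pclassP; exists 1; rewrite ?oner_neq0 ?scale1r.
apply/seteqP; split=> M /pclassP[k k0 ->]; apply/pclassP.
  by exists (k / c); rewrite ?mulf_neq0 ?invr_eq0 // scalerA mulfVK.
by exists (k * c); rewrite ?mulf_neq0 // scalerA.
Qed.

(* [step N]: the lattice [N O^2] lies strictly between [X O^2] and [O^2]. *)
Definition step N := [/\ N \in unitmx, MO N, MO (X *: invmx N),
  ~ MO (invmx N) & ~ MO (X^-1 *: N)].

Lemma XinvmxZ N : N \in unitmx -> invmx (X *: invmx N) = X^-1 *: N.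
Proof. by move=> uN; rewrite invmxZ ?unitmxZr ?unitmx_inv ?vX_neq0 // invmxK. Qed.

Lemma step_sym N : step N -> step (X *: invmx N).
Proof.
move=> [uN h1 h2 h3 h4]; split=> //.
- by rewrite unitmxZr ?vX_neq0 // unitmx_inv.
- by rewrite XinvmxZ // scalerA mulfV ?vX_neq0 // scale1r.
- by rewrite XinvmxZ.
- by rewrite scalerA mulVf ?vX_neq0 // scale1r.
Qed.

Definition classAdj (Y Z : set (set 'cV[K]_2)) : Prop :=
  exists L M, [/\ Y L, Z M, homoth X L `<=` M, M `<=` L
                & M <> L /\ M <> homoth X L].

(** In a basis of the larger lattice adjacency depends on a single relative matrix [N]: the two
    inclusions say that [N] and [X *: invmx N] are integral, the two inequalities that neither has
    an integral inverse. *)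
Lemma adj_cls B B' : B \in unitmx -> B' \in unitmx ->
  classAdj (cls B) (cls B') <-> exists2 c, c != 0 & step (c *: (invmx B *m B')).
Proof.
move=> uB uB'; have X0 := vX_neq0 V.
have key b b' : b != 0 -> b' != 0 ->
  [/\ homoth X (lat (b *: B)) `<=` lat (b' *: B'),
    lat (b' *: B') `<=` lat (b *: B) & lat (b' *: B') <> lat (b *: B) /\
    lat (b' *: B') <> homoth X (lat (b *: B))] <->
  step (b' / b *: (invmx B *m B')).
  move=> b0 b'0; rewrite homoth_lat scalerA.
  have ub : b *: B \in unitmx by rewrite unitmxZr.
  have ub' : b' *: B' \in unitmx by rewrite unitmxZr.
  have uXb : (X * b) *: B \in unitmx by rewrite unitmxZr ?mulf_neq0.
  set N := b' / b *: _.
  have uN : N \in unitmx.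
    by rewrite unitmxZr ?mulf_neq0 ?invr_eq0 // unitmx_mul unitmx_inv uB.
  have NE : N = invmx (b *: B) *m (b' *: B').
    by rewrite invmxZ // -scalemxAl -scalemxAr scalerA mulrC.
  have NVE : invmx N = invmx (b' *: B') *m (b *: B).
    apply: (can_inj (mulKmx uN)); rewrite mulmxV // NE -mulmxA mulKVmx //.
    by rewrite mulVmx.
  have XN : X *: invmx N = invmx (b' *: B') *m ((X * b) *: B).
    by rewrite NVE scalemxAr scalerA.
  have XVN : X^-1 *: N = invmx ((X * b) *: B) *m (b' *: B').
    by rewrite NE !invmxZ // invfM -!scalemxAl scalerA.
  have s1 := lat_sub ((X * b) *: B) ub'; rewrite -XN in s1.
  have s2 := lat_sub (b' *: B') ub; rewrite -NE in s2.
  split=> [[/s1 h1 /s2 h2 [h3 h4]]|[_ /s2 h1 /s1 h2 h3 h4]].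
    split=> //; first by move=> h; apply: h3; apply/lat_eq => //; rewrite -NE -NVE.
    by move=> h; apply: h4; apply/lat_eq => //; rewrite -XVN -XN.
  split=> //; split; first by move=> /lat_eq; rewrite -NVE -NE => -[].
  by move=> /lat_eq; rewrite -XVN -XN => /(_ ub' uXb) [].
split=> [[L [M [/clsP[b b0 ->] /clsP[b' b'0 ->] h1 h2 h3]]]|[c c0 hN]].
  exists (b' / b); first by rewrite mulf_neq0 ?invr_eq0.
  by apply/key.
have := (key 1 c (oner_neq0 _) c0).2; rewrite divr1 => /(_ hN) [h1 h2 h3].
exists (lat (1 *: B)), (lat (c *: B')); split=> //.
  by apply/clsP; exists 1; rewrite ?oner_neq0.
by apply/clsP; exists c.
Qed.

Lemma adj_clsM B N : B \in unitmx -> step N -> classAdj (cls B) (cls (B *m N)).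
Proof.
move=> uB sN; apply/adj_cls => //; first by rewrite unitmx_mul uB; case: sN.
by exists 1; rewrite ?oner_neq0 // scale1r mulKmx.
Qed.

(** If [X L < M < L], then [X M < X L < M]: the relative matrix [N] becomes [X *: invmx N], and
    [step] is symmetric under this exchange. *)
Lemma adj_sym B B' : B \in unitmx -> B' \in unitmx ->
  classAdj (cls B) (cls B') -> classAdj (cls B') (cls B).
Proof.
move=> uB uB' /adj_cls[] // c c0 s.
apply/adj_cls => //; exists (X / c); first by rewrite mulf_neq0 ?invr_eq0 ?vX_neq0.
have -> : (X / c) *: (invmx B' *m B) = X *: invmx (c *: (invmx B *m B')).
  have u : c *: (invmx B *m B') \in unitmx by case: s.
  rewrite -scalerA; congr (_ *: _).
  apply: (can_inj (mulKmx u)); rewrite mulmxV // -scalemxAr -!scalemxAl.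
  by rewrite scalerA mulVf // scale1r -mulmxA mulKVmx // mulVmx.
exact: step_sym.
Qed.

Lemma adj_act g B B' : g \in unitmx -> B \in unitmx -> B' \in unitmx ->
  classAdj (cls B) (cls B') -> classAdj (cls (g *m B)) (cls (g *m B')).
Proof.
move=> ug uB uB' /adj_cls[] // c c0 s.
apply/adj_cls; rewrite ?unitmx_mul ?ug //.
have -> : invmx (g *m B) = invmx B *m invmx g.
  have u : g *m B \in unitmx by rewrite unitmx_mul ug.
  by apply: (can_inj (mulKmx u)); rewrite mulmxV // -mulmxA mulKVmx // mulmxV.
by exists c; rewrite // -mulmxA mulKmx.
Qed.

(* The [q + 1] neighbours of the standard vertex, one for each line of [F^2]. *)
Definition nbr_mx (p : option F) : 'M[K]_2 :=
  if p is Some c then mx2 X (KC c) 0 1 else mx2 1 0 0 X.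

Lemma det_nbr_mx p : \det (nbr_mx p) = X.
Proof. by case: p => [c|]; rewrite /= det_mx2; ring. Qed.

Lemma nbr_mx_unit p : nbr_mx p \in unitmx.
Proof. by rewrite unitmxE det_nbr_mx unitfE vX_neq0. Qed.

Lemma MO_nbr p : MO (nbr_mx p).
Proof.
by case: p => [c|]; apply/MO2P; split; (exact: vOX || exact: vOC || exact: vO0 || exact: vO1).
Qed.

Lemma Xinv_nbr p : X *: invmx (nbr_mx p) =
  if p is Some c then mx2 1 (- KC c) 0 X else mx2 X 0 0 1.
Proof.
have X0 := vX_neq0 V.
case: p => [c|]; rewrite /= invmx2 ?mulr1 ?mul1r ?mul0r ?mulr0 ?subr0 ?unitfE //;
  by rewrite !scalemx2; congr mx2; rewrite ?mulVKf ?oppr0 ?mulr0 ?mulfV ?mulr1.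
Qed.

Lemma step_nbr p : step (nbr_mx p).
Proof.
have X0 := vX_neq0 V; have uN := nbr_mx_unit p.
have iE : invmx (nbr_mx p) = X^-1 *: (X *: invmx (nbr_mx p)).
  by rewrite scalerA mulVf // scale1r.
split=> //; first exact: MO_nbr.
- by rewrite Xinv_nbr; case: (p) => [c|]; apply/MO2P;
   split; try (exact: vOX || exact: vO0 || exact: vO1); apply: vON; exact: vOC.
- rewrite iE Xinv_nbr; case: (p) => [c|]; rewrite scalemx2 mulr1 => /MO2P[];
  by [move/vXinvN | move=> _ _ _ /vXinvN].
- case: (p) => [c|]; rewrite /= scalemx2 mulr1 => /MO2P[];
  by [move=> _ _ _ /vXinvN | move/vXinvN].
Qed.

Lemma KC_unit (c : F) : c != 0 -> O (KC c)^-1.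
Proof. by move=> c0; rewrite -fmorphV; exact: vOC. Qed.

Lemma MO_invmx N : MO N -> N \in unitmx -> O (\det N)^-1 -> MO (invmx N).
Proof.
rewrite unitmxE [N]mx2_eta => /MO2P[h0 h1 h2 h3]; rewrite det_mx2 => u hd.
rewrite invmx2 // ; apply: MOZ => //; apply/MO2P; split=> //; exact: vON.
Qed.

Lemma mul_delta0 N j : N *m delta_mx j 0 = mx2 (N 0 j) 0 (N 1 j) 0.
Proof.
apply/matrixP => i k; rewrite !mxE (bigD1 j) //= big1 => [|l /negbTE lj].
  by rewrite mxE eqxx addr0; case: (ord2P i) => ->; case: (ord2P k) => ->;
    rewrite /= ?mulr0 ?mulr1.
by rewrite mxE lj mulr0.
Qed.

Lemma mul_delta1 N j : N *m delta_mx j 1 = mx2 0 (N 0 j) 0 (N 1 j).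
Proof.
apply/matrixP => i k; rewrite !mxE (bigD1 j) //= big1 => [|l /negbTE lj].
  by rewrite mxE eqxx addr0; case: (ord2P i) => ->; case: (ord2P k) => ->;
    rewrite /= ?mulr0 ?mulr1.
by rewrite mxE lj mulr0.
Qed.

(** The integral matrix [invmx N *m P] has determinant [X / \det N]. Since [invmx N] is not
    integral, [X] divides [\det N]; so this determinant has an integral inverse, and the matrix is
    invertible over [O]. *)
Lemma lat_nbrE N P : step N -> step P -> \det P = X -> lat P `<=` lat N ->
  lat N = lat P.
Proof.
move=> [uN MN _ nMN _] [uP _ _ _ _] dP /(iffLR (lat_sub _ uN)) h.
apply/lat_eq => //; split; first exact: h.
have -> : invmx P *m N = invmx (invmx N *m P).
  have u : invmx N *m P \in unitmx by rewrite unitmx_mul unitmx_inv uN.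
  by apply: (can_inj (mulKmx u)); rewrite mulmxV // -mulmxA mulKVmx // mulVmx.
apply: MO_invmx; rewrite ?unitmx_mul ?unitmx_inv ?uN //.
rewrite det_mulmx det_inv dP invfM invrK.
have : O (\det N).
  by rewrite [N]mx2_eta det_mx2; apply: vOB; apply: vOM; apply: MN.
case/vO_unit_or => [[_ hd]|[z Oz ->]]; first by case: nMN; exact: MO_invmx.
by rewrite mulrAC mulfV ?vX_neq0 // mul1r.
Qed.

(** [N] is not divisible by [X], so one of its columns is nonzero modulo [X]; the line of [F^2]
    spanned by that column is the label [p]. It suffices to write [nbr_mx p] as [X *: A + N *m D],
    because [X O^2] lies in [N O^2]. *)
Lemma step_lat N : step N -> exists p, lat N = lat (nbr_mx p).
Proof.
move=> sN; have [uN MN XN nMN nXN] := sN; have X0 := vX_neq0 V.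
suff [p hp] : exists p, MO (invmx N *m nbr_mx p).
  exists p; apply: lat_nbrE => //; [exact: step_nbr|exact: det_nbr_mx|].
  exact/lat_sub.
suff [p [A [D [hA hD e]]]] : exists p A D, [/\ MO A, MO D & nbr_mx p = X *: A + N *m D].
  exists p; rewrite e mulmxDr mulKmx // -scalemxAr scalemxAl.
  by apply: MOD => //; apply: MOM.
have MOdelta j k : MO (delta_mx j k : 'M[K]_2).
  by move=> i l; rewrite mxE; case: (_ && _); [exact: vO1|exact: vO0].
have O0 := vO0; have O1 := vO1 V.
have [j [hy|hx]] : exists j, (N 1 j != 0 /\ O (N 1 j)^-1) \/
   [/\ N 0 j != 0, O (N 0 j)^-1 & exists2 z, O z & N 1 j = X * z].
  apply: contrapT => h; apply: nXN => i j; rewrite mxE.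
  case: (vO_unit_or (MN 1 j)) => [h1|[z Oz e1]]; first by case: h; exists j; left.
  case: (vO_unit_or (MN 0 j)) => [[h0 h0']|[z' Oz' e0]].
    by case: h; exists j; right; split=> //; exists z.
  by case: (ord2P i) => ->; rewrite ?e0 ?e1 mulKf.
(* Divided by its lower entry the column becomes [(c + X z, 1)], and the residue [c] labels the
   neighbour. *)
- have [c [z [Oz e]]] := vO_split (vOM (MN 0 j) hy.2).
  exists (Some c), (mx2 1 (- z) 0 0), ((N 1 j)^-1 *: delta_mx j 1); split.
  + by apply/MO2P; split=> //; exact: vON.
  + by apply: MOZ => //; case: hy.
  rewrite -scalemxAr mul_delta1 !scalemx2 mulVf; last by case: hy.
  rewrite [_ * N 0 j]mulrC e [RHS]mx2_eta !mxE /= !mulr0 mulr1 !addr0 mulrN addrC.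
  by rewrite addrK add0r.
(* The lower entry is divisible by [X], so modulo [X] the line is spanned by [(1, 0)]. *)
- have [h0 h0' [z Oz e]] := hx.
  exists None, (mx2 0 0 (- (z / N 0 j)) 1), ((N 0 j)^-1 *: delta_mx j 0); split.
  + by apply/MO2P; split=> //; apply: vON; apply: vOM.
  + exact: MOZ.
  rewrite -scalemxAr mul_delta0 !scalemx2 mulVf // e.
  rewrite [RHS]mx2_eta !mxE /= !mulr0 mulr1 !addr0 add0r; congr mx2.
  by rewrite mulrN [_^-1 * _]mulrC -mulrA addNr.
Qed.

Lemma adj_clsP B : B \in unitmx ->
  [set Z | (exists2 B', B' \in unitmx & Z = cls B') /\ classAdj (cls B) Z] =
  [set cls (B *m nbr_mx p) | p in [set: option F]].
Proof.
move=> uB; apply/seteqP; split=> Z /=.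
  move=> [[B' uB' ->] /adj_cls[] // c c0 /step_lat[p hp]]; exists p => //.
  rewrite -(cls_scale B' c0); apply: cls_lat.
  by rewrite -image_lat -hp image_lat -scalemxAr mulKVmx.
move=> [p _ <-]; split; last by apply: adj_clsM => //; exact: step_nbr.
by exists (B *m nbr_mx p); rewrite ?unitmx_mul ?uB ?nbr_mx_unit.
Qed.

Definition classPGL : set (set 'M[K]_2) := [set pclassK g | g in [set g | g \in unitmx]].
Definition cmul (a b : set 'M[K]_2) : set 'M[K]_2 := [set x *m y | x in a & y in b].
Definition cinv (a : set 'M[K]_2) : set 'M[K]_2 := [set invmx x | x in a].
Definition cact (a : set 'M[K]_2) (Y : set (set 'cV[K]_2)) : set (set 'cV[K]_2) :=
  [set [set x *m u | u in L] | x in a & L in Y].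
Definition classVertex (Y : set (set 'cV[K]_2)) :=
  exists2 B, B \in unitmx & Y = cls B.

Lemma cmulA a b a' : classPGL a -> classPGL b -> classPGL a' ->
  cmul a (cmul b a') = cmul (cmul a b) a'.
Proof. by move=> [g ug <-] [h uh <-] [k uk <-]; rewrite /cmul !pgl_mulE mulmxA. Qed.

Lemma cmul1 a : classPGL a -> cmul (pclassK 1%:M) a = a.
Proof. by move=> [g ug <-]; rewrite /cmul !pgl_mulE mul1mx. Qed.

Lemma cmulV a : classPGL a -> cmul (cinv a) a = pclassK 1%:M.
Proof. by move=> [g ug <-]; rewrite /cmul /cinv pgl_invE // !pgl_mulE mulVmx. Qed.

Lemma cmulrV a : classPGL a -> cmul a (cinv a) = pclassK 1%:M.
Proof. by move=> [g ug <-]; rewrite /cmul /cinv pgl_invE // !pgl_mulE mulmxV. Qed.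

Lemma cinv_PGL a : classPGL a -> classPGL (cinv a).
Proof.
by move=> [g ug <-]; rewrite /cinv pgl_invE //; exists (invmx g) => //=; rewrite unitmx_inv.
Qed.

Lemma cinvK a : classPGL a -> cinv (cinv a) = a.
Proof.
by move=> [g ug <-]; rewrite /cinv !pgl_invE ?unitmx_inv // invmxK.
Qed.

Lemma cact1 Y : classVertex Y -> cact (pclassK 1%:M) Y = Y.
Proof. by move=> [B uB ->]; rewrite /cact act_cls mul1mx. Qed.

Lemma cactM a b Y : classPGL a -> classPGL b -> classVertex Y ->
  cact (cmul a b) Y = cact a (cact b Y).
Proof.
move=> [g ug <-] [h uh <-] [B uB ->].
by rewrite /cact /cmul pgl_mulE !act_cls mulmxA.
Qed.

Lemma vertex_cact a Y : classPGL a -> classVertex Y -> classVertex (cact a Y).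
Proof.
move=> [g ug <-] [B uB ->]; rewrite /cact act_cls.
by exists (g *m B); rewrite // unitmx_mul ug.
Qed.

Lemma adj_cact a Y Z : classPGL a -> classVertex Y -> classVertex Z -> classAdj Y Z ->
  classAdj (cact a Y) (cact a Z).
Proof.
move=> [g ug <-] [B uB ->] [B' uB' ->]; rewrite /cact !act_cls; exact: adj_act.
Qed.

Lemma adj_csym Y Z : classVertex Y -> classVertex Z -> classAdj Y Z -> classAdj Z Y.
Proof. by move=> [B uB ->] [B' uB' ->]; exact: adj_sym. Qed.

Lemma adj_finite Y : classVertex Y -> finite_set [set Z | classVertex Z /\ classAdj Y Z].
Proof.
by move=> [B uB ->]; rewrite [X in finite_set X]adj_clsP //; apply: finite_image.
Qed.

End Lattices.

(** * Groups acting on graphs *)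

Section FsetCount.
Variables T U : choiceType.

Lemma card_fset_image (f : T -> U) (A : set T) : finite_set A ->
  {in A &, injective f} ->
  #|` fset_set (f @` A)| = #|` fset_set A|.
Proof.
move=> finA injf; rewrite fset_set_image //; apply: card_in_imfset => x y /=.
by rewrite !in_fset_set //; exact: injf.
Qed.

Lemma card_fibers (f : T -> U) (A : set T) (B : set U) c :
  finite_set A -> f @` A = B ->
  (forall y, B y -> #|` fset_set (A `&` f @^-1` [set y])| = c) ->
  #|` fset_set A| = (c * #|` fset_set B|)%N.
Proof.
move=> finA fAB h; rewrite -fAB fset_set_image //.
rewrite card_fset_sum1 (partition_big_imfset _ f) /=.
rewrite [RHS]mulnC [in RHS]card_fset_sum1 big_distrl /= big_seq [RHS]big_seq.
apply: eq_bigr => y /imfsetP[x /=]; rewrite in_fset_set // => /set_mem Ax yE.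
rewrite mul1n -(h y) -?fAB; last by exists x.
rewrite [RHS]card_fset_sum1 [LHS]big_fset_condE; congr (\sum_(_ <- enum_fset _) _)%N.
apply/fsetP => z; rewrite !inE !in_fset_set; try exact: finA; try exact: finite_setIl.
rewrite in_setI; congr andb.
by apply/eqP/idP => [e|/set_mem //]; apply/mem_set.
Qed.

Lemma sum_indicator (C : pzSemiRingType) (A : {fset T}) (Q : pred T) :
  \sum_(i <- A) (if Q i then 1 else 0 : C) = #|` [fset i in A | Q i]%fset|%:R.
Proof. by rewrite -big_mkcond /= big_fset_condE card_fset_sum1 natr_sum. Qed.

End FsetCount.

(** The group laws are assumed only on [G]: they fail for products of arbitrary sets of matrices and
    hold for classes of invertible ones. *)
Section TreeAction.
Variables (P H : choiceType) (mul : P -> P -> P) (inv : P -> P) (one : P).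
Variables (act : P -> H -> H) (vertex : set H) (nbr : H -> set H) (G : set P).
Hypothesis G1 : G one.
Hypothesis GM : forall a b, G a -> G b -> G (mul a b).
Hypothesis GV : forall a, G a -> G (inv a).
Hypothesis mulA : forall a b c, G a -> G b -> G c -> mul a (mul b c) = mul (mul a b) c.
Hypothesis mul1 : forall a, G a -> mul one a = a.
Hypothesis mulV : forall a, G a -> mul (inv a) a = one.
Hypothesis mulrV : forall a, G a -> mul a (inv a) = one.
Hypothesis invK : forall a, G a -> inv (inv a) = a.
Hypothesis act1 : forall x, vertex x -> act one x = x.
Hypothesis actM : forall a b x, G a -> G b -> vertex x ->
  act (mul a b) x = act a (act b x).
Hypothesis vact : forall a x, G a -> vertex x -> vertex (act a x).
Hypothesis nbrv : forall x y, nbr x y -> vertex y.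
Hypothesis nbrG : forall a x y, G a -> vertex x -> nbr x y -> nbr (act a x) (act a y).
Hypothesis nbrC : forall x y, vertex x -> nbr x y -> nbr y x.
Hypothesis nbr_fin : forall x, vertex x -> finite_set (nbr x).

Definition gstab (S : set P) (x : H) : set P := [set a | S a /\ act a x = x].
Hypothesis stab_fin : forall x, vertex x -> finite_set (gstab G x).

Definition gcosets (S T : set P) : set (set P) := [set [set mul a h | h in T] | a in S].
Definition gequiv x y := exists2 a, G a & act a x = y.

Lemma aactK a x : G a -> vertex x -> act (inv a) (act a x) = x.
Proof. by move=> Ga vx; rewrite -actM ?mulV ?act1 //; exact: GV. Qed.

Lemma amulK a b : G a -> G b -> mul (inv a) (mul a b) = b.
Proof. by move=> Ga Gb; rewrite mulA ?mulV ?mul1 //; exact: GV. Qed.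

Lemma amulKV a b : G a -> G b -> mul a (mul (inv a) b) = b.
Proof. by move=> Ga Gb; rewrite mulA ?mulrV ?mul1 //; exact: GV. Qed.

Lemma gequiv_sym x y : vertex x -> gequiv x y -> gequiv y x.
Proof. by move=> vx [a Ga <-]; exists (inv a); [exact: GV|exact: aactK]. Qed.

Lemma gequiv_trans x y z : vertex x -> gequiv x y -> gequiv y z -> gequiv x z.
Proof.
by move=> vx [a Ga <-] [b Gb <-]; exists (mul b a); [exact: GM|exact: actM].
Qed.

Lemma gstabM x a b : vertex x -> gstab G x a -> gstab G x b -> gstab G x (mul a b).
Proof. by move=> vx [Ga ax] [Gb bx]; split; [exact: GM|rewrite actM // bx]. Qed.

Lemma gstabV x a : vertex x -> gstab G x a -> gstab G x (inv a).
Proof. by move=> vx [Ga ax]; split; [exact: GV|rewrite -{1}ax aactK]. Qed.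

Lemma amul1r b : G b -> mul b one = b.
Proof. by move=> Gb; rewrite -(mulV Gb) mulA ?mulrV ?mul1 //; exact: GV. Qed.

Lemma gstab_act a x : G a -> vertex x ->
  gstab G (act a x) = [set mul (mul a b) (inv a) | b in gstab G x].
Proof.
move=> Ga vx; have GVa := GV Ga; apply/seteqP; split=> b /=.
  move=> [Gb e]; exists (mul (mul (inv a) b) a); last first.
    rewrite -[mul (mul (inv a) b) a]mulA // amulKV //; last exact: GM.
    by rewrite -mulA // mulrV // amul1r.
  split; first by apply: GM => //; exact: GM.
  by rewrite actM //; [rewrite actM ?e ?aactK //; exact: vact|exact: GM].
move=> [c [Gc cx] <-]; split; first by apply: GM => //; exact: GM.
rewrite actM //; [|exact: GM|exact: vact].
by rewrite aactK // actM // cx.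
Qed.

Lemma card_gstab_act a x : G a -> vertex x -> finite_set (gstab G x) ->
  finite_set (gstab G (act a x)) /\
  #|` fset_set (gstab G (act a x))| = #|` fset_set (gstab G x)|.
Proof.
move=> Ga vx fin; rewrite gstab_act //; split; first exact: finite_image.
have GVa := GV Ga; apply: card_fset_image => // b c /set_mem[Gb _] /set_mem[Gc _] e.
have key d : G d -> mul (inv a) (mul (mul (mul a d) (inv a)) a) = d.
  move=> Gd; have Gad : G (mul a d) by exact: GM.
  by rewrite -[mul (mul (mul a d) _) a]mulA // mulV // amul1r // amulK.
by rewrite -(key b) // e key.
Qed.

Lemma fiber_coset (S : set P) a y : (forall b, S b -> G b) ->
  (forall b c, S b -> S c -> S (mul b c)) -> (forall b, S b -> S (inv b)) ->
  S a -> vertex y ->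
  [set b | S b /\ act b y = act a y] = [set mul a h | h in gstab S y].
Proof.
move=> SG SM SV Sa vy; apply/seteqP; split=> b /=.
  move=> [Sb e]; exists (mul (inv a) b); last by rewrite amulKV //; exact: SG.
  split; first by apply: SM => //; exact: SV.
  by rewrite actM ?e ?aactK //; [exact: SG|apply: GV; exact: SG|exact: SG].
by move=> [h [Sh hy] <-]; split; [exact: SM|rewrite actM ?hy //; exact: SG].
Qed.

(** Orbit-stabilizer: the coset of [a] is the set of all elements that send [y] to [act a y]. *)
Lemma index_orbit x y : vertex x -> nbr x y ->
  #|` fset_set (gcosets (gstab G x) (gstab (gstab G x) y))| =
  #|` fset_set [set act a y | a in gstab G x]|.
Proof.
move=> vx xy; have vy := nbrv xy; set S := gstab G x.
have SG b : S b -> G b by case.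
have SM b c : S b -> S c -> S (mul b c) by exact: gstabM.
have SV b : S b -> S (inv b) by exact: gstabV.
have -> : gcosets S (gstab S y) =
    [set [set b | S b /\ act b y = z] | z in [set act a y | a in S]].
  apply/seteqP; split=> C /=.
    move=> [a Sa <-]; exists (act a y); first by exists a.
    by rewrite fiber_coset.
  move=> [_ [a Sa <-] <-]; exists a => //.
  by rewrite fiber_coset.
apply: card_fset_image; first by apply: finite_image; exact: stab_fin.
move=> z w /set_mem[a Sa <-] /set_mem[b Sb <-] e.
have : [set b | S b /\ act b y = act a y] a by [].
by rewrite e => -[].
Qed.

Definition gorbits x := [set [set act a y | a in gstab G x] | y in nbr x].

Lemma gorbit_eq x y z : vertex x -> nbr x y -> nbr x z ->
  ([set act a y | a in gstab G x] = [set act a z | a in gstab G x]) <->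
  [set act a z | a in gstab G x] y.
Proof.
move=> vx xy xz; have vy := nbrv xy; have vz := nbrv xz; split=> [<-|[a Sa e]].
  by exists one; [split=> //; exact: act1|exact: act1].
have Ga : G a by case: Sa.
apply/seteqP; split=> w [b Sb <-]; have Gb : G b by case: Sb.
  by exists (mul b a); [exact: gstabM|rewrite actM // e].
exists (mul b (inv a)); first by apply: gstabM => //; exact: gstabV.
by rewrite -e actM ?aactK //; [exact: GV|exact: vact].
Qed.

(** Each index is the size of an edge orbit and [f] is constant on orbits, so the weighted sum over
    orbits, with representatives chosen by [xget], is a plain sum over neighbours. *)
Lemma orbit_sum (C : comPzRingType) (f : H -> C) x : vertex x ->
  (forall y a, nbr x y -> gstab G x a -> f (act a y) = f y) ->
  \sum_(o \in gorbits x)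
    (#|` fset_set (gcosets (gstab G x) (gstab (gstab G x) (xget x o)))|)%:R * f (xget x o)
  = \sum_(y <- fset_set (nbr x)) f y.
Proof.
move=> vx finv; have fin := nbr_fin vx.
rewrite fsbig_finite; last exact: finite_image.
rewrite /gorbits fset_set_image // [RHS](partition_big_imfset _ (fun y => [set act a y | a in gstab G x])) /=.
rewrite big_seq [RHS]big_seq; apply: eq_bigr => o /imfsetP[y /=].
rewrite in_fset_set // => /set_mem xy ->{o}; set o := [set act a y | a in gstab G x].
have oy : o y by apply/gorbit_eq.
have ox : o (xget x o) by apply: (xgetPex x); exists y.
have onbr z : o z -> nbr x z.
  by move=> [a [Ga ax] <-]; rewrite -{1}ax; exact: nbrG.
have xz := onbr _ ox; have oE : o = [set act a (xget x o) | a in gstab G x].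
  by apply/esym/gorbit_eq.
rewrite index_orbit // -oE.
have fo z : o z -> f z = f (xget x o).
  by rewrite {1}oE => -[a Sa <-]; exact: finv.
rewrite card_fset_sum1 natr_sum big_distrl /= big_seq.
under eq_bigr => z.
  rewrite in_fset_set; last by apply: finite_image; exact: stab_fin.
  move=> /set_mem oz; rewrite mul1r -(fo _ oz); over.
rewrite -big_seq [RHS]big_fset_condE; congr (\sum_(_ <- enum_fset _) _).
apply/fsetP => z; rewrite in_fset_set; last by apply: finite_image; exact: stab_fin.
rewrite !inE /= in_fset_set //; apply/idP/andP => [/set_mem oz|[/set_mem xz' /eqP e]].
  by split; [apply/mem_set; exact: onbr|apply/eqP/gorbit_eq => //; exact: onbr].
by apply/mem_set; move: e => /gorbit_eq; apply.
Qed.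

Definition nbr_count x u : nat := #|` fset_set [set y | nbr x y /\ gequiv u y]|.

(** The map from [g] to [act g u] sends this set onto the neighbours of [x] in the orbit of [u], and
    its fibres are cosets of the stabilizer of [u]. *)
Lemma nbr_countE x u : vertex x -> vertex u ->
  finite_set [set g | G g /\ nbr x (act g u)] /\
  #|` fset_set [set g | G g /\ nbr x (act g u)]| =
  (#|` fset_set (gstab G u)| * nbr_count x u)%N.
Proof.
move=> vx vu; set M := [set g | _].
have fibE a : M a -> M `&` (act^~ u) @^-1` [set act a u] = [set mul a h | h in gstab G u].
  move=> [Ga na]; rewrite -fiber_coset //.
  by apply/seteqP; split=> b /= [h1 h2]; [split=> //; case: h1|split=> //; split=> //; rewrite h2].
have imM : (act^~ u) @` M = [set y | nbr x y /\ gequiv u y].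
  apply/seteqP; split=> y /=.
    by move=> [g [Gg ng] <-]; split=> //; exists g.
  by move=> [ny [g Gg e]]; exists g => //; split=> //; rewrite e.
have finI : finite_set ((act^~ u) @` M).
  by rewrite imM; apply: finite_setIl; exact: nbr_fin.
have finM : finite_set M.
  have -> : M = \bigcup_(y in (act^~ u) @` M) (M `&` (act^~ u) @^-1` [set y]).
    apply/seteqP; split=> b.
      by move=> Mb; exists (act b u); [exists b|].
    by move=> [y _ []].
  apply: bigcup_finite => // y [a Ma <-]; rewrite fibE //.
  by apply: finite_image; exact: stab_fin.
split=> //; apply: (card_fibers (f := act^~ u)) => // y.
rewrite -imM => -[a Ma <-]; rewrite fibE //; apply: card_fset_image.
  exact: stab_fin.
have Ga : G a by case: Ma.
move=> b c /set_mem[Gb _] /set_mem[Gc _] e.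
by rewrite -(amulK Ga Gb) e amulK.
Qed.

(** Inversion matches the [g] with [act g u] next to [x] and the [g] with [act g x] next to [u].
    Divided by both stabilizer orders, this is the symmetry of the adjacency operator for the weight
    [lambda]. *)
Lemma nbr_count_sym x u : vertex x -> vertex u ->
  (#|` fset_set (gstab G u)| * nbr_count x u =
   #|` fset_set (gstab G x)| * nbr_count u x)%N.
Proof.
move=> vx vu; have [fin1 <-] := nbr_countE vx vu; have [fin2 <-] := nbr_countE vu vx.
have -> : [set g | G g /\ nbr u (act g x)] = inv @` [set g | G g /\ nbr x (act g u)].
  apply/seteqP; split=> g /=.
    move=> [Gg n]; exists (inv g); last exact: invK.
    split; first exact: GV.
    have := nbrG (GV Gg) vu n; rewrite aactK // => n'; apply: nbrC => //.
    by apply: vact => //; exact: GV.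
  move=> [h [Gh n] <-]; split; first exact: GV.
  have := nbrG (GV Gh) vx n; rewrite aactK // => n'; apply: nbrC => //.
  by apply: vact => //; exact: GV.
rewrite card_fset_image // => a b /set_mem[Ga _] /set_mem[Gb _] e.
by rewrite -[a]invK // e invK.
Qed.

End TreeAction.

Section Transfer.
Variables (F : finFieldType) (G : set (pgl F)).
Local Notation V := (laurent_dv F).
Hypothesis subG : subgroup G.
Hypothesis finG : forall x, vertex x -> finite_set (stab G x).
Local Notation one := (pclass (1%:M : 'M[laurent F]_2)).

Lemma vertexE (x : hclass F) : vertex x <-> classVertex V x.
Proof.
split=> [[L [B uB ->] ->]|[B uB ->]]; first by exists B.
by exists (lat V B) => //; exists B.
Qed.

Lemma neighboursE (x : hclass F) :
  neighbours x = [set z | classVertex V z /\ classAdj V x z].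
Proof. by apply/seteqP; split=> z [/vertexE vz ad]; split. Qed.

Let PG a : G a -> classPGL a.
Proof. by case: subG => h _ _ /h. Qed.
Let G1 : G one. Proof. by case: subG. Qed.
Let GV a : G a -> G (pgl_inv a).
Proof.
move=> Ga; case: subG => _ _ /(_ _ _ G1 Ga).
by rewrite -[pgl_mul _ _]/(cmul _ _) cmul1 //; apply: cinv_PGL; exact: PG.
Qed.
Let GM a b : G a -> G b -> G (pgl_mul a b).
Proof.
move=> Ga Gb; case: subG => _ _ /(_ _ _ Ga (GV Gb)).
by rewrite -[pgl_inv (pgl_inv b)]/(cinv (cinv b)) cinvK //; exact: PG.
Qed.

Let mulA a b c : G a -> G b -> G c ->
  pgl_mul a (pgl_mul b c) = pgl_mul (pgl_mul a b) c.
Proof. by move=> /PG ha /PG hb /PG hc; exact: cmulA. Qed.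
Let mul1 a : G a -> pgl_mul one a = a.
Proof. by move=> /PG; exact: cmul1. Qed.
Let mulV a : G a -> pgl_mul (pgl_inv a) a = one.
Proof. by move=> /PG; exact: cmulV. Qed.
Let mulrV a : G a -> pgl_mul a (pgl_inv a) = one.
Proof. by move=> /PG; exact: cmulrV. Qed.
Let invK a : G a -> pgl_inv (pgl_inv a) = a.
Proof. by move=> /PG; exact: cinvK. Qed.
Let act1 x : vertex x -> pgl_act one x = x.
Proof. by move=> /vertexE; exact: cact1. Qed.
Let actM a b x : G a -> G b -> vertex x ->
  pgl_act (pgl_mul a b) x = pgl_act a (pgl_act b x).
Proof. by move=> /PG ha /PG hb /vertexE; exact: cactM. Qed.
Let vact a x : G a -> vertex x -> vertex (pgl_act a x).
Proof. by move=> /PG ha /vertexE vx; apply/vertexE; exact: vertex_cact. Qed.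
Let nbrv (x y : hclass F) : neighbours x y -> vertex y.
Proof. by case. Qed.
Let nbrG a x y : G a -> vertex x -> neighbours x y ->
  neighbours (pgl_act a x) (pgl_act a y).
Proof.
move=> Ga vx [vy ad]; split; first exact: vact.
by apply: (@adj_cact _ _ V); [exact: PG|exact/vertexE|exact/vertexE|].
Qed.
Let nbrC (x y : hclass F) : vertex x -> neighbours x y -> neighbours y x.
Proof.
move=> vx [vy ad]; split=> //.
by apply: (@adj_csym _ _ V) => //; exact/vertexE.
Qed.
Lemma neighbours_finite (x : hclass F) : vertex x -> finite_set (neighbours x).
Proof. by move=> /vertexE vx; rewrite neighboursE; exact: adj_finite. Qed.
Let nbr_fin := neighbours_finite.

Lemma grp_order_gt0 x : vertex x -> (0 < grp_order (stab G x))%N.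
Proof.
move=> vx; rewrite cardfs_gt0; apply/fset0Pn; exists one.
by rewrite in_fset_set; [apply/mem_set; split=> //; exact: act1|exact: finG].
Qed.

Lemma orbit_equiv_sym x y : vertex x -> orbit_equiv G x y -> orbit_equiv G y x.
Proof. exact: (gequiv_sym GV mulV act1 actM). Qed.

Lemma orbit_equiv_trans x y z : vertex x ->
  orbit_equiv G x y -> orbit_equiv G y z -> orbit_equiv G x z.
Proof. exact: (gequiv_trans GM actM). Qed.

Lemma grp_order_equiv x y : vertex x -> finite_set (stab G x) -> orbit_equiv G x y ->
  finite_set (stab G y) /\ grp_order (stab G y) = grp_order (stab G x).
Proof.
move=> vx fin [a Ga <-].
exact: (card_gstab_act GM GV mulA mul1 mulV mulrV act1 actM vact Ga vx fin).
Qed.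

Variables (R : realType) (d r : nat) (lift : label d r -> hclass F).
Hypothesis liftv : forall v, vertex (lift v).
Hypothesis lift_surj : forall x, vertex x -> exists v, orbit_equiv G (lift v) x.
Hypothesis lift_inj : forall u v, orbit_equiv G (lift u) (lift v) -> u = v.

Lemma quotient_vertexP v y : vertex y -> orbit_equiv G (lift (quotient_vertex G lift v y)) y.
Proof. by move=> /lift_surj; exact: xgetPex. Qed.

Lemma quotient_vertexE u v y : orbit_equiv G (lift u) y -> quotient_vertex G lift v y = u.
Proof.
move=> e; have h := e; case: h => a Ga ay.
have vy : vertex y by rewrite -ay; exact: vact.
apply: lift_inj; apply: orbit_equiv_trans; [exact: liftv|exact: quotient_vertexP|].
exact: orbit_equiv_sym.
Qed.

Lemma adjacency_sum (f : label d r -> Cplx R) v :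
  adjacency G lift f v =
  \sum_(y <- fset_set (neighbours (lift v))) f (quotient_vertex G lift v y).
Proof.
apply: (orbit_sum G1 GM GV mulA mul1 mulV mulrV act1 actM vact nbrv nbrG nbr_fin finG
  (liftv v) (f := fun y => f (quotient_vertex G lift v y))) => y a xy [Ga _].
congr f; apply: quotient_vertexE.
have vy := nbrv xy; apply: orbit_equiv_trans; first exact: liftv.
  exact: quotient_vertexP.
by exists a.
Qed.

Definition edge_count (v u : label d r) : nat :=
  #|` fset_set [set y | neighbours (lift v) y /\ orbit_equiv G (lift u) y]|.

Lemma edge_count_sym u v :
  (grp_order (stab G (lift u)) * edge_count v u =
   grp_order (stab G (lift v)) * edge_count u v)%N.
Proof.
exact (nbr_count_sym GM GV mulA mul1 mulV mulrV invK act1 actM vact nbrG nbrC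
  nbr_fin finG (liftv v) (liftv u)).
Qed.

Lemma adjacency_delta u v :
  adjacency G lift (delta R u) v = (edge_count v u)%:R.
Proof.
rewrite adjacency_sum.
have deltaE w : delta R u w = if w == u then 1 else 0 by rewrite /delta; case: eqP.
under [LHS]eq_bigr => y _ do rewrite deltaE.
rewrite [LHS]sum_indicator; congr ((#|` _|)%:R).
have fin : finite_set [set y | neighbours (lift v) y /\ orbit_equiv G (lift u) y].
  exact: finite_setIl (nbr_fin (liftv v)).
apply/fsetP => y; rewrite !inE /= !in_fset_set //; last exact: nbr_fin.
apply/andP/idP => [[/set_mem ny /eqP e]|/set_mem[ny e]].
  by apply/mem_set; split=> //; rewrite -e; apply: quotient_vertexP; exact: nbrv ny.
by split; [exact/mem_set|apply/eqP; exact: quotient_vertexE].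
Qed.

End Transfer.

(** * Caratheodory derivatives *)

Section Coord.
Variable R : realType.
Local Notation C := (Cplx R).
Local Notation Re := complex.Re.
Local Notation Im := complex.Im.

HB.instance Definition _ := GRing.RMorphism.copy (@toC R) (real_complex R).

Lemma toC_le (x y : R) : (toC x <= toC y) = (x <= y).
Proof. exact: lecR. Qed.
Lemma toC_lt (x y : R) : (toC x < toC y) = (x < y).
Proof. exact: ltcR. Qed.

Lemma ReD (x y : C) : Re (x + y) = Re x + Re y.
Proof. by case: x; case: y. Qed.
Lemma ImD (x y : C) : Im (x + y) = Im x + Im y.
Proof. by case: x; case: y. Qed.
Lemma ReB (x y : C) : Re (x - y) = Re x - Re y.
Proof. by case: x; case: y. Qed.
Lemma ImB (x y : C) : Im (x - y) = Im x - Im y.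
Proof. by case: x; case: y. Qed.
Lemma Re_toCM a (x : C) : Re (toC a * x) = a * Re x.
Proof. by case: x => x y /=; rewrite mul0r subr0. Qed.
Lemma Im_toCM a (x : C) : Im (toC a * x) = a * Im x.
Proof. by case: x => x y /=; rewrite mul0r addr0. Qed.

Lemma norm_toC (x : R) : `|toC x| = toC `|x|.
Proof. by rewrite [LHS]normc_def /= expr0n addr0 sqrtr_sqr. Qed.

Lemma norm_Re (z : C) : toC `|Re z| <= `|z|.
Proof. exact: normc_ge_Re. Qed.

Lemma norm_Im (z : C) : toC `|Im z| <= `|z|.
Proof.
rewrite [leRHS]normc_def lecR -sqrtr_sqr; apply: ler_wsqrtr.
by rewrite lerDr sqr_ge0.
Qed.

Lemma CplxE (z : C) : z = toC (Re z) + 'i%C * toC (Im z).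
Proof. exact: complexE. Qed.

Lemma norm_i : `|'i%C : C| = 1.
Proof. by rewrite [LHS]normc_def /= expr0n add0r expr1n sqrtr1. Qed.

Lemma norm_le_ReIm (z : C) : `|z| <= toC (`|Re z| + `|Im z|).
Proof.
rewrite {1}[z]CplxE rmorphD; apply: le_trans (ler_normD _ _) _.
by rewrite normrM norm_i mul1r !norm_toC.
Qed.

Lemma gt0_toC (e : C) : 0 < e -> e = toC (Re e) /\ 0 < Re e.
Proof. by case: e => x y; rewrite ltcE /= => /andP[/eqP ->]. Qed.

Lemma cvg_Re T (F : set_system T) (FF : Filter F) (f : T -> C) (l : C) :
  f x @[x --> F] --> l -> Re (f x) @[x --> F] --> Re l.
Proof.
move=> /cvgrPdist_lt h; apply/cvgrPdist_lt => e e0.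
have /h : 0 < toC e by rewrite toC_lt.
apply: filterS => x; rewrite -toC_lt -ReB; apply: le_lt_trans; exact: norm_Re.
Qed.

Lemma cvg_Im T (F : set_system T) (FF : Filter F) (f : T -> C) (l : C) :
  f x @[x --> F] --> l -> Im (f x) @[x --> F] --> Im l.
Proof.
move=> /cvgrPdist_lt h; apply/cvgrPdist_lt => e e0.
have /h : 0 < toC e by rewrite toC_lt.
apply: filterS => x; rewrite -toC_lt -ImB; apply: le_lt_trans; exact: norm_Im.
Qed.

Lemma cvg_ReIm T (F : set_system T) (FF : Filter F) (f : T -> C) (l : C) :
  Re (f x) @[x --> F] --> Re l -> Im (f x) @[x --> F] --> Im l ->
  f x @[x --> F] --> l.
Proof.
move=> /cvgrPdist_lt hr /cvgrPdist_lt hi; apply/cvgrPdist_lt => e /gt0_toC[-> e0].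
have e2 : 0 < Re e / 2 by rewrite divr_gt0.
near=> x.
apply: le_lt_trans (norm_le_ReIm _) _; rewrite toC_lt ReB ImB [Re e]splitr ltrD //.
  by near: x; exact: hr.
by near: x; exact: hi.
Unshelve. all: by end_near. Qed.

Lemma cvg_toC T (F : set_system T) (FF : Filter F) (f : T -> R) (l : R) :
  f x @[x --> F] --> l -> toC (f x) @[x --> F] --> toC l.
Proof. by move=> h; apply: cvg_ReIm => //=; exact: cvg_cst. Qed.

Lemma cvg_mx T (F : set_system T) (FF : Filter F) m n (f : T -> 'M[C]_(m, n))
  (l : 'M[C]_(m, n)) :
  (forall i j, f x i j @[x --> F] --> l i j) -> f x @[x --> F] --> l.
Proof.
move=> h; apply/cvg_mx_entourageP => A eA.
apply: filter_forall => i; apply: filter_forall => j.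
have hA : F [set x | A (l i j, f x i j)].
  by have /cvg_entourageP /(_ A eA) := h i j.
suff : F [set x | (l i j, f x i j) \in A] by [].
by apply: filterS hA => x ?; exact/mem_set.
Qed.

End Coord.

(* [slope F t d f c]: Caratheodory's form of "[f] has derivative [c] at [t]"; [F] is
   the filter of neighbourhoods of [t] and [d u] the increment [u - t]. *)
Section Slope.
Variables (C : numFieldType) (T : Type) (F : set_system T) (FF : Filter F) (t : T) (d : T -> C).
Hypothesis Ft : forall P : set T, F P -> P t.
Hypothesis d0 : d x @[x --> F] --> (0 : C).
Implicit Types (f g : T -> C) (c k : C).

Definition slope f c := exists phi : T -> C,
  [/\ phi x @[x --> F] --> c, phi t = c & \forall u \near F, f u - f t = d u * phi u].

Lemma slope_near f g c : (\forall u \near F, f u = g u) -> slope f c -> slope g c.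
Proof.
move=> fg [phi [h1 h2 h3]]; exists phi; split=> //; have e := Ft fg.
by apply: filterS2 fg h3 => u <-; rewrite -e.
Qed.

Lemma slope_cst k : slope (fun=> k) 0.
Proof.
exists (fun=> 0); split=> //; first exact: cvg_cst.
by apply: nearW => u; rewrite subrr mulr0.
Qed.

Lemma slope_inc k : slope (fun x => d x + k) 1.
Proof.
exists (fun=> 1); split=> //; first exact: cvg_cst.
have dt : d t = 0.
  apply/eqP; apply: contraT => dt0; have /cvgrPdist_lt := d0.
  by move=> /(_ `|d t|); rewrite normr_gt0 => /(_ dt0)/Ft; rewrite sub0r normrN ltxx.
by apply: nearW => u; rewrite mulr1 dt add0r addrK.
Qed.

Lemma slope_cvg f c : slope f c -> f u @[u --> F] --> f t.
Proof.
move=> [phi [h1 h2 h3]].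
have -> : f t = f t + 0 * c by rewrite mul0r addr0.
have : f t + d u * phi u @[u --> F] --> f t + 0 * c.
  by apply: cvgD; [exact: cvg_cst|exact: cvgM].
apply: cvg_trans; apply: near_eq_cvg; apply: filterS h3 => u e.
by rewrite -e addrC subrK.
Qed.

Lemma slopeD f g c c' : slope f c -> slope g c' -> slope (fun x => f x + g x) (c + c').
Proof.
move=> [phi [h1 h2 h3]] [psi [k1 k2 k3]]; exists (fun x => phi x + psi x); split.
- exact: cvgD.
- by rewrite h2 k2.
apply: filterS2 h3 k3 => u e e'.
by rewrite mulrDr -e -e' opprD addrACA.
Qed.

Lemma slopeM f g c c' : slope f c -> slope g c' ->
  slope (fun x => f x * g x) (c * g t + f t * c').
Proof.
move=> [phi [h1 h2 h3]] sg; have cg := slope_cvg sg; have [psi [k1 k2 k3]] := sg.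
exists (fun x => phi x * g x + f t * psi x); split.
- by apply: cvgD; apply: cvgM => //; exact: cvg_cst.
- by rewrite h2 k2.
apply: filterS2 h3 k3 => u e e'.
by rewrite mulrDr mulrA -e mulrCA -e' mulrBl mulrBr addrA subrK.
Qed.

Lemma slopeV f c : f t != 0 -> slope f c -> slope (fun x => (f x)^-1) (- c / f t ^+ 2).
Proof.
move=> f0 sf; have cf := slope_cvg sf; have [phi [h1 h2 h3]] := sf.
exists (fun x => - phi x * ((f x)^-1 * (f t)^-1)); split.
- rewrite expr2 invfM; apply: cvgM; first exact: cvgN.
  by apply: cvgM; [exact: cvgV|exact: cvg_cst].
- by rewrite h2 expr2 invfM.
have fu0 : \forall u \near F, f u != 0.
  have /cvgrPdist_lt /(_ `|f t|) := cf; rewrite normr_gt0 => /(_ f0).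
  by apply: filterS => u; apply: contraTneq => ->; rewrite subr0 ltxx.
apply: filterS2 h3 fu0 => u e fu.
rewrite [RHS]mulrA mulrN -e opprB mulrBl; congr (_ - _).
  by rewrite mulrCA mulfV // mulr1.
by rewrite mulrA mulfV // mul1r.
Qed.

Lemma slope_sum I (s : seq I) (f : I -> T -> C) (c : I -> C) :
  (forall j, slope (f j) (c j)) ->
  slope (fun x => \sum_(j <- s) f j x) (\sum_(j <- s) c j).
Proof.
move=> h; elim: s => [|j s IH].
  rewrite big_nil; apply: slope_near (slope_cst 0).
  by apply: nearW => u; rewrite big_nil.
rewrite big_cons; apply: slope_near (slopeD (h j) IH).
by apply: nearW => u; rewrite big_cons.
Qed.

Lemma slopeZ k f c : slope f c -> slope (fun x => k * f x) (k * c).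
Proof. by move=> h; have := slopeM (slope_cst k) h; rewrite mul0r add0r. Qed.

(** Jacobi's formula, from the Leibniz expansion: the terms in which row [i] is differentiated add
    up to the determinant with row [i] replaced by that of [c], and expansion along this row gives
    the cofactors of [f t]. *)
Lemma slope_det n (f : T -> 'M[C]_n) (c : 'M[C]_n) :
  (forall i j, slope (fun u => f u i j) (c i j)) ->
  slope (fun u => \det (f u)) (\tr (\adj (f t) *m c)).
Proof.
move=> h.
have prodD m (p : 'I_m -> T -> C) (e : 'I_m -> C) : (forall i, slope (p i) (e i)) ->
    slope (fun u => \prod_i p i u) (\sum_i e i * \prod_(j | j != i) p j t).
  elim: m p e => [|m IH] p e hp.
    rewrite big_ord0; apply: slope_near (slope_cst 1).
    by apply: nearW => u; rewrite big_ord0.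
  have := slopeM (hp ord0) (IH _ _ (fun i => hp (fintype.lift ord0 i))).
  have -> : e ord0 * \prod_(i < m) p (fintype.lift ord0 i) t +
      p ord0 t * (\sum_(i < m) e (fintype.lift ord0 i) * \prod_(j < m | j != i) p (fintype.lift ord0 j) t) =
      \sum_(i < m.+1) e i * \prod_(j < m.+1 | j != i) p j t.
    rewrite big_ord_recl; congr (_ * _ + _).
      by rewrite [RHS]big_mkcond big_ord_recl /= mul1r; apply: eq_bigr.
    rewrite big_distrr /=; apply: eq_bigr => i _.
    rewrite mulrCA; congr (_ * _).
    rewrite [in RHS]big_mkcond [in LHS]big_mkcond big_ord_recl /=; congr (_ * _).
  apply: slope_near; apply: nearW => u; by rewrite big_ord_recl.
have -> : \tr (\adj (f t) *m c) =
    \sum_(s : 'S_n) (-1) ^+ s * \sum_i c i (s i) * \prod_(j | j != i) f t j (s j).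
  rewrite mxtrace_mulC; under [LHS]eq_bigr => i _ do rewrite mxE.
  transitivity (\sum_i \det (\matrix_(k, j) if k == i then c i j else f t k j)).
    apply: eq_bigr => i _; rewrite (expand_det_row _ i); apply: eq_bigr => j _.
    rewrite !mxE eqxx /cofactor; congr (_ * (_ * \det _)).
    by apply/matrixP => k l; rewrite !mxE eq_sym (negbTE (neq_lift _ _)).
  under [LHS]eq_bigr => i _ do rewrite /determinant.
  rewrite exchange_big /=; apply: eq_bigr => s _; rewrite big_distrr /=.
  apply: eq_bigr => i _; congr (_ * _).
  rewrite (bigD1 i) //= mxE eqxx; congr (_ * _); apply: eq_bigr => j /negbTE ji.
  by rewrite mxE ji.
apply: (@slope_sum _ (index_enum {perm 'I_n}) (fun s u => (-1) ^+ s * \prod_i f u i (s i))).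
by move=> s; apply: slopeZ; apply: prodD.
Qed.

End Slope.

Section ComplexSlope.
Variable C : numFieldType.

Definition cslope (f : C -> C) (t c : C) := slope (nbhs t) t (fun u => u - t) f c.

Lemma nbhs_at (t : C) (P : set C) : nbhs t P -> P t.
Proof. exact: nbhs_singleton. Qed.

Lemma nbhsF (t : C) : Filter (nbhs t).
Proof. exact: nbhs_filter. Qed.

Lemma cvg_pt (t : C) : x @[x --> nbhs t] --> t.
Proof. exact: cvg_id. Qed.

Lemma cvg_inc (t : C) : u - t @[u --> nbhs t] --> (0 : C).
Proof. by rewrite -(subrr t); apply: cvgB; [exact: cvg_pt|exact: cvg_cst]. Qed.

Lemma cvg_shift (t : C) : h + t @[h --> 0^'] --> t.
Proof.
have h : h + t @[h --> nbhs (0 : C)] --> t.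
  by rewrite -[X in _ --> X]add0r; apply: cvgD; [exact: cvg_pt|exact: cvg_cst].
by rewrite /dnbhs; exact: (cvg_within_filter _ h).
Qed.

Lemma near_shift0 (t : C) (P : set C) :
  (\forall u \near nbhs t, P u) -> \forall h \near 0^', P (h + t).
Proof. exact: cvg_shift. Qed.

Lemma slope_comp T (F : set_system T) (FF : Filter F) (t : T) (d : T -> C)
    (d0 : d x @[x --> F] --> (0 : C)) (g : C -> C) (f : T -> C) c c' :
  cslope g (f t) c' -> slope F t d f c -> slope F t d (g \o f) (c' * c).
Proof.
move=> [psi [k1 k2 k3]] sf; have cf := slope_cvg FF d0 sf; have [phi [h1 h2 h3]] := sf.
exists (fun x => psi (f x) * phi x); split.
- apply: cvgM => //; exact: (cvg_comp _ _ cf k1).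
- by rewrite h2 k2.
have k3' : \forall u \near F, g (f u) - g (f t) = (f u - f t) * psi (f u).
  exact: (cf _ k3).
apply: filterS2 h3 k3' => u e /= ->.
by rewrite e -mulrA [phi u * _]mulrC.
Qed.

Lemma near0_neq0 : \forall h \near (0 : C)^', h != 0.
Proof. exact: nbhs_dnbhs_neq. Qed.

Lemma cslope_derivable (f : C -> C) t c : cslope f t c -> derivable f t 1.
Proof.
move=> [phi [h1 h2 h3]]; apply/cvg_ex; exists c.
have cp : phi (h + t) @[h --> 0^'] --> c by apply: (cvg_comp _ _ (@cvg_shift t) h1).
apply: cvg_trans cp; apply: near_eq_cvg.
have h3' := near_shift0 h3.
apply: filterS2 near0_neq0 h3' => h h0; rewrite addrK => e.
by rewrite /= [h%:A]mulr1 e scalerA mulVf // scale1r.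
Qed.

Lemma derivable_cslope (f : C -> C) t : derivable f t 1 -> cslope f t (derive f t 1).
Proof.
rewrite /derivable /derive; set c := lim _ => hc.
exists (fun u => if u == t then c else (u - t)^-1 * (f u - f t)); split.
- apply/cvgrPdist_lt => e e0.
  have /cvgrPdist_lt /(_ e e0) h := hc.
  have h' : \forall x \near nbhs (0 : C), x != 0 ->
     `|c - x^-1 *: ((f \o shift t) (x *: 1) - f t)| < e by exact: h.
  have h'' : \forall u \near nbhs t, u - t != 0 ->
     `|c - (u - t)^-1 *: ((f \o shift t) ((u - t) *: 1) - f t)| < e.
    exact: (@cvg_inc t _ h').
  apply: filterS h'' => u /=.
  have [->|ut] := eqVneq u t; first by rewrite [c - c]subrr normr0.
  by rewrite subr_eq0 => /(_ ut); rewrite [_%:A]mulr1 subrK.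
- by rewrite eqxx.
- apply: nearW => u; case: eqP => [->|/eqP ut]; first by rewrite !subrr mul0r.
  by rewrite mulrA mulfV ?mul1r // subr_eq0.
Qed.

(** Multiplicativity carries the derivative from 0 to [z], through [f u = f z * f (u - z)]. *)
Lemma cslope_mul_morph (f : C -> C) z : {morph f : x y / x + y >-> x * y} ->
  cslope f 0 1 -> cslope f z (f z).
Proof.
move=> fM s0; have ci := @cvg_inc z.
have h2 := slope_inc (nbhsF z) (@nbhs_at z) ci 0.
have h0 : cslope f (z - z + 0) 1 by rewrite subrr addr0.
have := slopeZ (nbhsF z) ci (f z) (@slope_comp _ _ (nbhsF z) _ _ ci f (fun u => u - z + 0) _ _ h0 h2).
rewrite !mulr1; apply: (slope_near (nbhsF z)); first exact: nbhs_at.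
by apply: nearW => u /=; rewrite -fM addr0 addrC subrK.
Qed.

Lemma cslope_cst k z : cslope (fun=> k) z 0.
Proof. exact: slope_cst. Qed.

Lemma cslope_near f g z c : (\forall u \near nbhs z, f u = g u) ->
  cslope f z c -> cslope g z c.
Proof. by apply: slope_near; exact: nbhs_at. Qed.

Lemma cslopeD f g z c c' : cslope f z c -> cslope g z c' ->
  cslope (fun x => f x + g x) z (c + c').
Proof. exact: slopeD. Qed.

Lemma cslopeM f g z c c' : cslope f z c -> cslope g z c' ->
  cslope (fun x => f x * g x) z (c * g z + f z * c').
Proof. by apply: slopeM; exact: cvg_inc. Qed.

Lemma cslopeV f z c : f z != 0 -> cslope f z c ->
  cslope (fun x => (f x)^-1) z (- c / f z ^+ 2).
Proof. by apply: slopeV; exact: cvg_inc. Qed.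

Lemma cslope_comp (g f : C -> C) z c c' : cslope g (f z) c' -> cslope f z c ->
  cslope (g \o f) z (c' * c).
Proof. by apply: slope_comp; exact: cvg_inc. Qed.

Lemma cslope_cvg f z c : cslope f z c -> f u @[u --> nbhs z] --> f z.
Proof. by apply: slope_cvg; exact: cvg_inc. Qed.

Lemma cslope_id z : cslope id z 1.
Proof.
have := slope_inc (nbhsF z) (@nbhs_at z) (@cvg_inc z) z.
apply: (slope_near (nbhsF z)); first exact: nbhs_at.
by apply: nearW => u; rewrite subrK.
Qed.

Lemma cslope_affine k m z : cslope (fun w => (w + k) * m) z m.
Proof.
have := cslopeM (cslopeD (cslope_id z) (cslope_cst k z)) (cslope_cst m z).
by rewrite addr0 mulr0 addr0 mul1r.
Qed.

Lemma cslope_inv z : z != 0 -> cslope (fun w => w^-1) z (- 1 / z ^+ 2).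
Proof. by move=> z0; exact: (cslopeV z0 (cslope_id z)). Qed.

End ComplexSlope.

Section SlopeExtra.
Variables (C : numFieldType) (T : Type) (F : set_system T) (FF : Filter F) (t : T).
Variable d : T -> C.
Hypothesis d0 : d x @[x --> F] --> (0 : C).

Lemma near_cvg_neq0 (f : T -> C) l : f u @[u --> F] --> l -> l != 0 ->
  \forall u \near F, f u != 0.
Proof.
move=> /cvgrPdist_lt /(_ `|l|); rewrite normr_gt0 => h /h.
by apply: filterS => u; apply: contraTneq => ->; rewrite subr0 ltxx.
Qed.

Lemma cvg_sqr (f : T -> C) (l : C) : f u @[u --> F] --> l -> f u ^+ 2 @[u --> F] --> l ^+ 2.
Proof.
move=> h; have -> : (fun u => f u ^+ 2) = (fun u => f u * f u) by apply/funext.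
by rewrite expr2; exact: cvgM.
Qed.

Lemma cvg_mul (f g : T -> C) (l k : C) : f u @[u --> F] --> l -> g u @[u --> F] --> k ->
  f u * g u @[u --> F] --> l * k.
Proof. exact: cvgM. Qed.

Lemma cvg_mulr_cst (f : T -> C) (l k : C) : f u @[u --> F] --> l -> f u * k @[u --> F] --> l * k.
Proof. by move=> h; apply: cvgM => //; exact: cvg_cst. Qed.

Lemma cvg_addl_cst (f : T -> C) (l k : C) : f u @[u --> F] --> l -> k + f u @[u --> F] --> k + l.
Proof. by move=> h; apply: cvgD => //; exact: cvg_cst. Qed.

(** A nonzero derivative keeps [f] off the value [f t], so punctured neighbourhoods can be pulled
    back along [f]. *)
Lemma slope_neq (f : T -> C) c : slope F t d f c -> c != 0 ->
  \forall u \near F, d u != 0 -> f u != f t.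
Proof.
move=> [phi [h1 h2 h3]] c0; apply: filterS2 h3 (near_cvg_neq0 h1 c0) => u e p0 du0.
by rewrite -subr_eq0 e mulf_neq0.
Qed.

(** Continuity of [l] suffices, since the difference quotient of [g] along [l] stays away from 0 and
    can be divided out. This differentiates logarithms without fixing a branch. *)
Lemma slope_lift (g : C -> C) (l : T -> C) c k : cslope g (l t) c -> c != 0 ->
  l u @[u --> F] --> l t -> slope F t d (g \o l) k -> slope F t d l (k / c).
Proof.
move=> [phi [h1 h2 h3]] c0 cl [psi [k1 k2 k3]].
have cp : phi (l u) @[u --> F] --> c by apply: (cvg_comp _ _ cl h1).
exists (fun u => psi u / phi (l u)); split.
- by apply: cvgM => //; exact: cvgV.
- by rewrite k2 h2.
have h3' : \forall u \near F, g (l u) - g (l t) = (l u - l t) * phi (l u).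
  exact: (cl _ h3).
apply: filterS3 (near_cvg_neq0 cp c0) h3' k3 => u p0 e /= e'.
by rewrite mulrA -e' e mulfK.
Qed.

End SlopeExtra.

Section Punctured.
Variable C : numFieldType.

Lemma derivable_cvg (g : C -> C) z : derivable g z 1 -> g u @[u --> nbhs z] --> g z.
Proof. by move=> /derivable_cslope s; exact: (slope_cvg _ (@cvg_inc C z) s). Qed.

Lemma cvg_dnbhs (K : numFieldType) (f : K -> C) (z : K) (l : C) :
  f u @[u --> nbhs z] --> l -> f u @[u --> z^'] --> l.
Proof. by move=> h; rewrite /dnbhs; exact: (cvg_within_filter _ h). Qed.

Lemma derivable_cvg_dnbhs (f g : C -> C) z : derivable g z 1 ->
  (\forall w \near z^', f w = g w) -> f u @[u --> z^'] --> g z.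
Proof.
move=> /derivable_cvg /cvg_dnbhs h e; apply: cvg_trans h; apply: near_eq_cvg.
by apply: filterS e => w ->.
Qed.

Lemma dnbhs_cvg_unique (f : C -> C) (z l l' : C) :
  f u @[u --> z^'] --> l -> f u @[u --> z^'] --> l' -> l = l'.
Proof. by move=> h h'; apply: (cvg_unique _ h h'); exact: norm_hausdorff. Qed.

Lemma near_dnbhs (P : set C) z : (\forall w \near nbhs z, P w) -> \forall w \near z^', P w.
Proof. by move=> h; rewrite /dnbhs /within /=; apply: filterS h. Qed.

(** Points [w != z] near [z] are interior to the punctured neighbourhood; so one local continuation
    at [z] also serves at all nearby points. *)
Lemma near_dnbhs_near (P : set C) z : (\forall w \near z^', P w) ->
  \forall w \near nbhs z, w != z -> P w /\ \forall x \near w^', P x.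
Proof.
move=> h; have h' : \forall w \near nbhs z, w != z -> P w by exact: h.
have := near_join h'; apply: filterS => w hw wz; split.
  exact: (nbhs_singleton hw wz).
have wz' : \forall x \near nbhs w, x - z != 0.
  apply: (@near_cvg_neq0 C C (nbhs w) _ (fun x => x - z) (w - z)).
    by apply: cvgB; [exact: cvg_pt|exact: cvg_cst].
  by rewrite subr_eq0.
apply: near_dnbhs; apply: filterS2 hw wz' => x hx; rewrite subr_eq0; exact: hx.
Qed.

(** Pulls a continuation back along a change of variable [phi] with nonzero derivative at [s]. The
    constants [k] and [m] leave room for the conjugation by cusp widths. *)
Lemma comp_near (g f : C -> C) (phi : C -> C) (c : C -> C) s (k m : C) :
  (forall w, cslope phi w (c w)) -> c s != 0 -> (\forall w \near nbhs (phi s), derivable g w 1) ->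
  (\forall w \near (phi s)^', f w = g w) ->
  (\forall w \near nbhs s, derivable (fun w => k * g (phi w) * m) w 1) /\
  (\forall w \near s^', f (phi w) = g (phi w)).
Proof.
move=> sphi c0 dg e.
have cphi : phi w @[w --> nbhs s] --> phi s by exact: (cslope_cvg (sphi s)).
split.
  have dg' : \forall w \near nbhs s, derivable g (phi w) 1 by exact: (cphi _ dg).
  apply: filterS dg' => w /derivable_cslope sg.
  have h1 := cslope_comp sg (sphi w).
  have h2 := cslopeM (cslopeM (cslope_cst k w) h1) (cslope_cst m w).
  exact: (cslope_derivable h2).
have e' : \forall w \near nbhs (phi s), w != phi s -> f w = g w by exact: e.
have e2 : \forall w \near nbhs s, phi w != phi s -> f (phi w) = g (phi w) by exact: (cphi _ e').
have ne := slope_neq (nbhsF s) (sphi s) c0.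
have e3 : \forall w \near nbhs s, w != s -> f (phi w) = g (phi w).
  by apply: filterS2 e2 ne => w h1 h2 ws; apply: h1; apply: h2; rewrite subr_eq0.
exact: e3.
Qed.

Lemma dnbhs_neq z : \forall w \near (z : C)^', w != z.
Proof. exact: nbhs_dnbhs_neq. Qed.

End Punctured.

Section RealSlope.
Variable R : realType.
Local Notation C := (Cplx R).

Definition rslope (f : R -> C) (t : R) (c : C) :=
  slope (nbhs t) t (fun u => toC (u - t)) f c.

Lemma rinc_cvg0 (t : R) : toC (u - t) @[u --> nbhs t] --> (0 : C).
Proof. by apply: cvg_toC; exact: cvg_inc. Qed.

Lemma rslope_near (f g : R -> C) t c : (\forall u \near nbhs t, f u = g u) ->
  rslope f t c -> rslope g t c.
Proof. exact: (slope_near (nbhsF t) (@nbhs_at R t)). Qed.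

Lemma rslopeD (f g : R -> C) t c c' : rslope f t c -> rslope g t c' ->
  rslope (fun x => f x + g x) t (c + c').
Proof. exact: (slopeD (nbhsF t)). Qed.

Lemma rslopeM (f g : R -> C) t c c' : rslope f t c -> rslope g t c' ->
  rslope (fun x => f x * g x) t (c * g t + f t * c').
Proof. exact: (slopeM (nbhsF t) (rinc_cvg0 t)). Qed.

Lemma rslope_cst k t : rslope (fun=> k) t 0.
Proof. exact: (slope_cst (nbhsF t)). Qed.

Lemma rslope_comp (g : C -> C) (f : R -> C) t c c' : cslope g (f t) c' -> rslope f t c ->
  rslope (g \o f) t (c' * c).
Proof. exact: (slope_comp (nbhsF t) (rinc_cvg0 t)). Qed.

Lemma rslope_cvg (f : R -> C) t c : rslope f t c -> f u @[u --> nbhs t] --> f t.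
Proof. exact: (slope_cvg (nbhsF t) (rinc_cvg0 t)). Qed.

Lemma rslope_sum I (s : seq I) (f : I -> R -> C) t (c : I -> C) :
  (forall j, rslope (f j) t (c j)) ->
  rslope (fun x => \sum_(j <- s) f j x) t (\sum_(j <- s) c j).
Proof. exact: (slope_sum (nbhsF t) (@nbhs_at R t)). Qed.

Lemma rslope_det n (f : R -> 'M[C]_n) t (c : 'M[C]_n) :
  (forall i j, rslope (fun u => f u i j) t (c i j)) ->
  rslope (fun u => \det (f u)) t (\tr (\adj (f t) *m c)).
Proof. exact: (slope_det (nbhsF t) (@nbhs_at R t) (rinc_cvg0 t)). Qed.

Lemma rslope_cderive (f : R -> C) t c : rslope f t c ->
  cderivable f t /\ cderive f t = c.
Proof.
move=> [phi [h1 h2 h3]].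
have key (p : C -> R) : (forall x y, p (x - y) = p x - p y) ->
    (forall a x, p (toC a * x) = a * p x) ->
    p (phi x) @[x --> nbhs t] --> p c ->
    derivable (fun u => p (f u)) t 1 /\ derive1 (fun u => p (f u)) t = p c.
  move=> pB pM cp.
  suff cv : h^-1 *: (p (f (h + t)) - p (f t)) @[h --> 0^'] --> p c.
    split; last by rewrite /derive1; apply/cvg_lim.
    apply/cvg_ex; exists (p c); apply: cvg_trans cv; apply: near_eq_cvg.
    by apply: nearW => h /=; rewrite [h%:A]mulr1.
  have cp' : p (phi (h + t)) @[h --> 0^'] --> p c.
    by apply: (cvg_comp _ _ (@cvg_shift R t) cp).
  apply: cvg_trans cp'; apply: near_eq_cvg.
  have h3' := near_shift0 h3.
  apply: filterS2 (@near0_neq0 R) h3' => h h0; rewrite addrK => e.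
  by rewrite -pB e pM scalerA mulVf // scale1r.
have [d1 e1] := key _ (@ReB R) (@Re_toCM R) (cvg_Re _ h1).
have [d2 e2] := key _ (@ImB R) (@Im_toCM R) (cvg_Im _ h1).
split; last by rewrite /cderive e1 e2; case: (c).
split; [exact: d1|exact: d2].
Unshelve. all: by end_near. Qed.

End RealSlope.

(** * The complex exponential *)

Section Cexp.
Variable R : realType.
Local Notation C := (Cplx R).
Local Notation Re := complex.Re.
Local Notation Im := complex.Im.
Implicit Types (z w : C).

Lemma CplxP z w : Re z = Re w -> Im z = Im w -> z = w.
Proof. by case: z => a b; case: w => c d /= -> ->. Qed.

Lemma cexpD z w : cexp (z + w) = cexp z * cexp w.
Proof.
rewrite /cexp ReD ImD expRD cosD sinD rmorphM -!mulrA; congr (_ * _).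
rewrite [RHS]mulrCA; congr (_ * _).
by apply: CplxP => /=; rewrite // addrC.
Qed.

Lemma cexp0 : cexp 0 = 1 :> C.
Proof. by rewrite /cexp /= expR0 cos0 sin0 rmorph1 mul1r. Qed.

Lemma cexpN z : cexp (- z) = (cexp z)^-1.
Proof.
have e : cexp z * cexp (- z) = 1 by rewrite -cexpD subrr cexp0.
have z0 : cexp z != 0 by apply/eqP => h; move: e; rewrite h mul0r => /eqP; rewrite eq_sym oner_eq0.
by rewrite -[LHS](mulKf z0) e mulr1.
Qed.

Lemma cexp_neq0 z : cexp z != 0.
Proof.
have e : cexp z * cexp (- z) = 1 by rewrite -cexpD subrr cexp0.
by apply/eqP => h; move: e; rewrite h mul0r => /eqP; rewrite eq_sym oner_eq0.
Qed.

Lemma cexpB z w : cexp (z - w) = cexp z / cexp w.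
Proof. by rewrite cexpD cexpN. Qed.

Lemma cexpMn (n : nat) z : cexp (n%:R * z) = cexp z ^+ n.
Proof.
elim: n => [|n IH]; first by rewrite mul0r cexp0.
by rewrite -natr1 mulrDl mul1r cexpD IH exprSr.
Qed.

Lemma cslope_expR0 : cslope (@expR R) 0 1.
Proof.
have [d e] := is_derive_expR (0 : R); have := derivable_cslope d.
by rewrite e expR0.
Qed.
Lemma cslope_cos0 : cslope (@cos R) 0 0.
Proof.
have [d e] := is_derive_cos (0 : R); have := derivable_cslope d.
by rewrite e sin0 oppr0.
Qed.
Lemma cslope_sin0 : cslope (@sin R) 0 1.
Proof.
have [d e] := is_derive_sin (0 : R); have := derivable_cslope d.
by rewrite e cos0.
Qed.

Lemma norm_half_sum (h : C) (A B : C) (r : R) : `|A| + `|B| <= toC r ->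
  `|toC (Re h) * A + toC (Im h) * B| <= `|h| * toC r.
Proof.
move=> hr; apply: le_trans (ler_normD _ _) _; rewrite !normrM !norm_toC.
apply: (@le_trans _ _ (`|h| * `|A| + `|h| * `|B|)).
  by rewrite lerD // ler_wpM2r // ?norm_Re ?norm_Im.
by rewrite -mulrDr ler_wpM2l.
Qed.

Lemma cslope_cexp0 : cslope (@cexp R) 0 1.
Proof.
have [pe [e1 e2 e3]] := cslope_expR0.
have [pc [c1 c2 c3]] := cslope_cos0.
have [ps [s1 s2 s3]] := cslope_sin0.
have cRe : Re h @[h --> nbhs (0 : C)] --> (0 : R) by exact: (cvg_Re _ (@cvg_pt C 0)).
have cIm : Im h @[h --> nbhs (0 : C)] --> (0 : R) by exact: (cvg_Im _ (@cvg_pt C 0)).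
(* With [x = Re h] and [y = Im h], the remainder [cexp h - 1 - h] equals [x * A h + y * B h], where
   [A] and [B] tend to 0; [r] is a real bound for [|A| + |B|]. *)
pose A (h : C) : C := toC (pe (Re h)) * Complex (cos (Im h)) (sin (Im h)) - 1.
pose B (h : C) : C := Complex (pc (Im h)) (ps (Im h) - 1).
pose r (h : C) : R := (`|pe (Re h) * cos (Im h) - 1| + `|pe (Re h) * sin (Im h)|) +
   (`|pc (Im h)| + `|ps (Im h) - 1|).
have hr h : `|A h| + `|B h| <= toC (r h).
  rewrite rmorphD /=; apply: lerD; last exact: (norm_le_ReIm (B h)).
  by apply: le_trans (norm_le_ReIm _) _; rewrite toC_le /A ReB ImB Re_toCM Im_toCM /= subr0.
have cpe : pe (Re h) @[h --> nbhs (0 : C)] --> (1 : R) by exact: (cvg_comp _ _ cRe e1).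
have cpc : pc (Im h) @[h --> nbhs (0 : C)] --> (0 : R) by exact: (cvg_comp _ _ cIm c1).
have cps : ps (Im h) @[h --> nbhs (0 : C)] --> (1 : R) by exact: (cvg_comp _ _ cIm s1).
have ccos : cos (Im h) @[h --> nbhs (0 : C)] --> (1 : R).
  have := @continuous_cos R 0; rewrite /continuous_at cos0; exact: cvg_comp cIm.
have csin : sin (Im h) @[h --> nbhs (0 : C)] --> (0 : R).
  have := @continuous_sin R 0; rewrite /continuous_at sin0; exact: cvg_comp cIm.
have cr : r h @[h --> nbhs (0 : C)] --> (0 : R).
  have e0 : (`|(1 : R) * 1 - 1| + `|(1 : R) * 0|) + (`|(0 : R)| + `|(1 : R) - 1|) = 0.
    by rewrite mulr1 mulr0 subrr normr0 !addr0.
  rewrite -e0; apply: cvgD; apply: cvgD; apply: cvg_norm => //.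
  - by apply: cvgB; [exact: cvgM|exact: cvg_cst].
  - exact: cvgM.
  - by apply: cvgB => //; exact: cvg_cst.
have key : \forall h \near nbhs (0 : C), cexp h - 1 = h + (toC (Re h) * A h + toC (Im h) * B h).
  have e3' : \forall h \near nbhs (0 : C), expR (Re h) - expR 0 = (Re h - 0) * pe (Re h).
    exact: (cRe _ e3).
  have c3' : \forall h \near nbhs (0 : C), cos (Im h) - cos 0 = (Im h - 0) * pc (Im h).
    exact: (cIm _ c3).
  have s3' : \forall h \near nbhs (0 : C), sin (Im h) - sin 0 = (Im h - 0) * ps (Im h).
    exact: (cIm _ s3).
  move: e3' c3' s3'; apply: filterS3 => h /=.
  rewrite !subr0 expR0 cos0 sin0 subr0 => he hc hs.
  apply: CplxP; rewrite /cexp /A /B !(ReB, ImB, ReD, ImD, Re_toCM, Im_toCM) /=.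
    by rewrite mulrBr mulr1 mulrA -he -hc; lra.
  by rewrite !subr0 mulrA -he mulrBr mulr1 -hs; lra.
exists (fun h => if h == 0 then 1 else h^-1 * (cexp h - 1)); split.
- apply/cvgrPdist_lt => e /gt0_toC[-> e0].
  have /cvgrPdist_lt /(_ _ e0) cr' := cr.
  move: cr' key; apply: filterS2 => h; rewrite sub0r normrN => rh kh.
  case: ifPn => [_|h0]; first by rewrite [1 - 1]subrr normr0 toC_lt.
  rewrite kh mulrDr mulVf // opprD addrA subrr add0r normrN normrM normfV.
  rewrite ltr_pdivrMl ?normr_gt0 //.
  apply: le_lt_trans (norm_half_sum h (hr h)) _.
  rewrite ltr_pM2l ?normr_gt0 // toC_lt; apply: le_lt_trans rh; exact: ler_norm.
- by rewrite eqxx.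
apply: nearW => h; rewrite subr0 cexp0.
case: ifPn => [/eqP ->|h0]; first by rewrite cexp0 subrr mul0r.
by rewrite mulrA mulfV // mul1r.
Qed.

Lemma cslope_cexp z : cslope (@cexp R) z (cexp z).
Proof. exact: (cslope_mul_morph _ cexpD cslope_cexp0). Qed.

Lemma cslope_cexp_comp (f : C -> C) z c : cslope f z c ->
  cslope (fun w => cexp (f w)) z (cexp (f z) * c).
Proof. exact: (cslope_comp (cslope_cexp (f z))). Qed.

Lemma rslope_cexp_comp (f : R -> C) t c : rslope f t c ->
  rslope (fun u => cexp (f u)) t (cexp (f t) * c).
Proof. exact: (rslope_comp (cslope_cexp (f t))). Qed.

Lemma cexp_surj (w : C) : w != 0 -> exists z, cexp z = w.
Proof.
move=> w0; pose x := Re w; pose y := Im w; pose p := Num.sqrt (x ^+ 2 + y ^+ 2).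
have p20 : 0 < x ^+ 2 + y ^+ 2.
  rewrite lt_neqAle addr_ge0 ?sqr_ge0 // andbT eq_sym paddr_eq0 ?sqr_ge0 //.
  rewrite !sqrf_eq0; apply: contra w0 => /andP[/eqP x0 /eqP y0].
  by apply/eqP; exact: CplxP.
have p0 : 0 < p by rewrite sqrtr_gt0.
have pp : p ^+ 2 = x ^+ 2 + y ^+ 2 by rewrite sqr_sqrtr // ltW.
have xp : -1 <= x / p <= 1.
  rewrite -ler_norml normrM normfV (gtr0_norm p0) ler_pdivrMr // mul1r.
  by rewrite -sqrtr_sqr; apply: ler_wsqrtr; rewrite lerDl sqr_ge0.
have sE : Num.sqrt (1 - (x / p) ^+ 2) = `|y| / p.
  have -> : 1 - (x / p) ^+ 2 = (y / p) ^+ 2.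
    rewrite !expr_div_n pp; apply: (mulIf (lt0r_neq0 p20)).
    by rewrite mulrBl mul1r !mulfVK ?lt0r_neq0 //; lra.
  by rewrite sqrtr_sqr normrM normfV (gtr0_norm p0).
exists (Complex (ln p) (if 0 <= y then acos (x / p) else - acos (x / p))).
apply: CplxP; rewrite /cexp ?Re_toCM ?Im_toCM /= lnK ?posrE //.
  by case: ifP => _; rewrite ?cosN acosK ?in_itv //= mulrC mulfVK ?lt0r_neq0.
case: ifP => hy; rewrite ?sinN sin_acos // sE.
  by rewrite ger0_norm // mulrC mulfVK ?lt0r_neq0.
rewrite ltr0_norm ?ltNge ?hy //.
by rewrite mulNr opprK mulrC mulfVK ?lt0r_neq0.
Qed.

(* The principal logarithm on the right half plane; junk elsewhere. *)
Definition clog (z : C) : C :=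
  Complex (ln (Num.sqrt (Re z ^+ 2 + Im z ^+ 2))) (atan (Im z / Re z)).

Lemma clogK z : 0 < Re z -> cexp (clog z) = z.
Proof.
move=> x0; set x := Re z in x0 *; set y := Im z; pose p := Num.sqrt (x ^+ 2 + y ^+ 2).
have p20 : 0 < x ^+ 2 + y ^+ 2 by rewrite ltr_pwDl ?exprn_gt0 ?sqr_ge0.
have p0 : 0 < p by rewrite sqrtr_gt0.
have cE : cos (atan (y / x)) = x / p.
  rewrite cos_atan; have -> : 1 + (y / x) ^+ 2 = (x ^+ 2 + y ^+ 2) / x ^+ 2.
    by rewrite expr_div_n mulrDl mulfV // expf_neq0 // lt0r_neq0.
  by rewrite sqrtrM ?ltW // sqrtrV ?sqr_ge0 // sqrtr_sqr gtr0_norm // invfM invrK mulrC.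
have c0 : cos (atan (y / x)) != 0 by rewrite cE mulf_neq0 ?invr_eq0 ?lt0r_neq0.
apply: CplxP; rewrite /cexp /clog ?Re_toCM ?Im_toCM /= lnK ?posrE // -/p -/x -/y.
  by rewrite cE mulrC mulfVK ?lt0r_neq0.
have -> : sin (atan (y / x)) = tan (atan (y / x)) * cos (atan (y / x)).
  by rewrite /tan mulfVK.
by rewrite atanK cE [_ * (x / p)]mulrA mulfVK ?lt0r_neq0 // mulrC mulfVK ?lt0r_neq0.
Qed.

Lemma cvg_clog T (F : set_system T) (FF : Filter F) (f : T -> C) (l : C) : 0 < Re l ->
  f x @[x --> F] --> l -> clog (f x) @[x --> F] --> clog l.
Proof.
move=> l0 cf; have cr := cvg_Re FF cf; have ci := cvg_Im FF cf.
have cs : Re (f x) ^+ 2 + Im (f x) ^+ 2 @[x --> F] --> Re l ^+ 2 + Im l ^+ 2.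
  have c2r : Re (f x) ^+ 2 @[x --> F] --> Re l ^+ 2 := cvg_sqr FF cr.
  have c2i : Im (f x) ^+ 2 @[x --> F] --> Im l ^+ 2 := cvg_sqr FF ci.
  exact: (cvgD c2r c2i).
have p20 : 0 < Re l ^+ 2 + Im l ^+ 2 by rewrite ltr_pwDl ?exprn_gt0 ?sqr_ge0.
apply: cvg_ReIm => /=.
  apply: (cvg_comp _ _ (cvg_comp _ _ cs (@sqrt_continuous R _))).
  by apply: continuous_ln; rewrite sqrtr_gt0.
have cd : Im (f x) / Re (f x) @[x --> F] --> Im l / Re l.
  apply: cvgM; first exact: ci.
  by apply: cvgV; [rewrite lt0r_neq0|exact: cr].
exact: (cvg_comp _ _ cd (@continuous_atan R _)).
Qed.

(** One logarithm of [f t] is fixed; the quotient [f u / f t] stays near 1, in the half plane where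
    [clog] is continuous. *)
Lemma local_log_exists (f : R -> C) t : f t != 0 ->
  (\forall u \near nbhs t, f x @[x --> nbhs u] --> f u) -> exists l, local_log f l t.
Proof.
move=> f0 cf; have [z0 z0E] := cexp_surj f0.
exists (fun u => z0 + clog (f u / f t)).
have cq u : f x @[x --> nbhs u] --> f u -> f x / f t @[x --> nbhs u] --> f u / f t.
  by exact: cvg_mulr_cst.
have ct := cq t (nbhs_singleton cf).
have hp : \forall u \near nbhs t, 0 < Re (f u / f t).
  have c1 : Re (f u / f t) @[u --> nbhs t] --> (1 : R).
    have c1' := cvg_Re _ ct.
    rewrite mulfV // in c1'.
    exact: c1'.
  have /cvgrPdist_lt h := c1; have := h 1 ltr01.
  by apply: filterS => u; rewrite ltr_norml => /andP[_]; lra.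
move: cf hp; apply: filterS2 => u cu pu; split.
  have h : z0 + clog (f x / f t) @[x --> nbhs u] --> z0 + clog (f u / f t).
    have h1 := cq u cu.
    have h2 := cvg_clog (nbhsF u) pu h1.
    exact: (cvg_addl_cst (nbhsF u) h2).
  exact: h.
by rewrite cexpD z0E clogK // mulrC mulfVK.
Qed.

Lemma local_log_slope (f l : R -> C) t c : rslope f t c -> f t != 0 ->
  local_log f l t -> rslope l t (c / f t).
Proof.
move=> sf f0 ll; have [cl e] := nbhs_singleton ll.
have cl' : l x @[x --> nbhs t] --> l t by exact: cl.
rewrite -e in f0 *.
apply: (slope_lift _ (cslope_cexp (l t)) f0 cl').
apply: slope_near sf; first exact: nbhs_at.
by move: ll; apply: filterS => u [_ <-].
Qed.

End Cexp.

(** * Holomorphic continuation and Cesaro means *)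

Section Continuation.
Variable R : realType.
Local Notation C := (Cplx R).
Implicit Types (f g : C -> C) (z l : C).

(** The continued value is a limit over a punctured neighbourhood. Its uniqueness follows, and
    identities pass to it by limits alone. *)
Lemma continues_cvg f z l : continues f z l -> f u @[u --> z^'] --> l.
Proof.
move=> [g [dg e <-]]; apply: derivable_cvg_dnbhs e.
exact: (nbhs_singleton dg).
Qed.

Lemma continues_uniq f z l l' : continues f z l -> continues f z l' -> l = l'.
Proof. move=> /continues_cvg h /continues_cvg; exact: (dnbhs_cvg_unique h). Qed.

Lemma continuationE f z l : continues f z l -> continuation f z = l.
Proof.
move=> h; apply: (continues_uniq (f := f) (z := z)) => //.
by apply: (xgetPex 0); exists l.
Qed.

Lemma derivable_continues f z : (\forall w \near nbhs z, derivable f w 1) ->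
  continues f z (f z).
Proof. by move=> h; exists f; split=> //; apply: near_dnbhs; exact: nearW. Qed.

(** A single [g] computes the continuation at all points near [z]: at [z] by its choice, at other
    points because [f] and [g] agree around them. *)
Lemma holomorphic_continuation f z : holomorphic_at f z -> exists g : C -> C,
  [/\ \forall w \near nbhs z, derivable g w 1,
      \forall w \near z^', f w = g w &
      \forall w \near nbhs z, continuation f w = g w].
Proof.
move=> [l [g [dg e gz]]]; exists g; split=> //.
have h1 := near_dnbhs_near e; have h2 := near_join dg.
move: h1 h2; apply: filterS2 => w h1 h2.
apply: continuationE; case: (boolP (w == z)) => [/eqP wz|wz].
  by rewrite wz; exists g; split=> //.
have [_ ew] := h1 wz; exists g; split=> //.
Qed.

Lemma holomorphic_near f z : holomorphic_at f z -> \forall w \near nbhs z, holomorphic_at f w.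
Proof.
move=> [l [g [dg e gz]]]; have h1 := near_dnbhs_near e; have h2 := near_join dg.
move: h1 h2; apply: filterS2 => w h1 h2; exists (g w); exists g.
case: (boolP (w == z)) => [/eqP -> //|wz].
by have [_ ew] := h1 wz; split.
Qed.

End Continuation.

Section Cesaro.
Variable R : realType.
Local Notation C := (Cplx R).

Lemma sum_geo (K : fieldType) (z : K) L : z != 1 ->
  \sum_(1 <= N < L.+1) z ^+ N = z * (z ^+ L - 1) / (z - 1).
Proof.
move=> z1; apply: (canRL (mulfK _)); first by rewrite subr_eq0.
elim: L => [|L IH]; first by rewrite big_geq // mul0r subrr mulr0.
rewrite big_nat_recr //= mulrDl IH !exprS; ring.
Qed.

(** The geometric sums are bounded by [2 / |z - 1|], independently of [L]. *)
Lemma cesaro_geo (z : C) : `|z| = 1 -> z != 1 ->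
  L%:R^-1 * \sum_(1 <= N < L.+1) z ^+ N @[L --> \oo] --> (0 : C).
Proof.
move=> nz z1.
have h0 : 0 < 2 / `|z - 1| by rewrite divr_gt0 // normr_gt0 subr_eq0.
have [bE b0] := gt0_toC h0; set b := complex.Re _ in bE b0.
apply/cvgrPdist_lt => e /gt0_toC[-> e0]; set e' := complex.Re e in e0 *.
near=> L; rewrite sub0r normrN.
have L0 : 0 < L%:R :> R.
  by near: L; exact: nbhs_infty_gtr.
have hL : b / e' < L%:R by near: L; exact: nbhs_infty_gtr.
apply: (@le_lt_trans _ _ (toC (L%:R^-1 * b))); last first.
  by rewrite toC_lt mulrC ltr_pdivrMr // mulrC -ltr_pdivrMr.
rewrite normrM sum_geo // rmorphM fmorphV rmorph_nat normfV normr_nat.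
rewrite ler_wpM2l ?invr_ge0 ?ler0n // -[X in _ <= X]/(toC b) -bE normrM normfV ler_wpM2r ?invr_ge0 //.
rewrite normrM nz mul1r; apply: le_trans (ler_normB _ _) _.
by rewrite normrX nz expr1n normr1.
Unshelve. all: by end_near. Qed.

Lemma cesaro_const L (m : C) : (0 < L)%N -> L%:R^-1 * \sum_(1 <= N < L.+1) m = m.
Proof.
move=> L0; rewrite sumr_const_nat subSS subn0 -[m *+ L]mulr_natl mulrA mulVf ?mul1r //.
by rewrite pnatr_eq0 -lt0n.
Qed.

Lemma cesaro_oscillating r (G : nat -> 'M[C]_r) (M P Q : 'M[C]_r) (z w : C) :
  `|z| = 1 -> z != 1 -> `|w| = 1 -> w != 1 ->
  (forall N, (1 <= N)%N -> G N = M + z ^+ N *: P + w ^+ N *: Q) ->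
  cesaro_mean G @ \oo --> M.
Proof.
move=> nz z1 nw w1 GE; apply: cvg_mx => i j.
have h : M i j + ((L%:R^-1 * \sum_(1 <= N < L.+1) z ^+ N) * P i j +
    (L%:R^-1 * \sum_(1 <= N < L.+1) w ^+ N) * Q i j) @[L --> \oo] --> M i j.
  have e0 : M i j = M i j + (0 * P i j + 0 * Q i j) by rewrite !mul0r !addr0.
  rewrite [X in _ --> X]e0.
  have FF : Filter \oo by exact: eventually_filter.
  have h1 := @cvg_mulr_cst C _ _ FF _ _ (P i j) (cesaro_geo nz z1).
  have h2 := @cvg_mulr_cst C _ _ FF _ _ (Q i j) (cesaro_geo nw w1).
  exact: (cvg_addl_cst FF (cvgD h1 h2)).
apply: cvg_trans h; apply: near_eq_cvg; near=> L.
have L0 : (0 < L)%N by near: L; exact: nbhs_infty_gt.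
rewrite /cesaro_mean mxE summxE.
have -> : \sum_(1 <= N < L.+1) G N i j =
    \sum_(1 <= N < L.+1) (M i j + z ^+ N * P i j + w ^+ N * Q i j).
  by apply: eq_big_nat => N /andP[N1 _]; rewrite GE // !mxE.
rewrite !big_split /= !mulrDr cesaro_const // addrA; congr (_ + _ + _).
  by rewrite -mulr_suml mulrA.
by rewrite -mulr_suml mulrA.
Unshelve. all: by end_near. Qed.

End Cesaro.

(** * The Jacobi operator and its core equations *)

(* The eigenvalue equations of the Jacobi operator on the core, with the recursion
   along the cusps already solved by [z ^ n b + z ^- n b']. *)
Section CoreEquations.
Variables (C : fieldType) (d r : nat).
Variables (H : 'M[C]_d) (V : 'M[C]_(d, r)) (V' : 'M[C]_(r, d)) (a z : C).
Hypotheses (a0 : a != 0) (z0 : z != 0).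

Definition gF : 'M[C]_d := H - (a * (z + z^-1))%:M + (z^-1 / a) *: (V *m V').
Definition gS : 'M[C]_r := - 1%:M + ((z^-1 - z) / a) *: (V' *m invmx gF *m V).
Definition gU : 'M[C]_(d, r) := (z^-1 - z) *: (invmx gF *m V).

(** The cusp equation gives [b' = a^-1 *: (V' *m u) - b]. Substituted in the core equation, it adds
    [z^-1 / a] times [V *m V'] to the operator, which is where [F] comes from. *)
Lemma gF_eq m (u : 'M[C]_(d, m)) (b b' : 'M[C]_(r, m)) :
  V' *m u = a *: (b + b') ->
  H *m u + V *m (z *: b + z^-1 *: b') = (a * (z + z^-1)) *: u <->
  gF *m u = (z^-1 - z) *: (V *m b).
Proof.
move=> e; have eb : b' = a^-1 *: (V' *m u) - b.
  by rewrite e scalerA mulVf // scale1r addrC addKr.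
have -> : gF *m u = H *m u - (a * (z + z^-1)) *: u + z^-1 *: (V *m (a^-1 *: (V' *m u))).
  rewrite mulmxDl mulmxBl mul_scalar_mx -scalemxAl -scalemxAr scalerA.
  by rewrite mulmxA.
rewrite eb; set h := H *m u; set x := _ *: u; set k := V *m (a^-1 *: _).
have -> : V *m (z *: b + z^-1 *: (a^-1 *: (V' *m u) - b)) =
   z^-1 *: k - (z^-1 - z) *: (V *m b).
  by rewrite mulmxDr -!scalemxAr mulmxBr scalerBr scalerBl opprB addrCA addrC.
rewrite addrA [h - x + _]addrAC.
by split=> /eqP; rewrite subr_eq => /eqP ->; rewrite addrAC subrr add0r.
Qed.

Lemma gU_core : gF \in unitmx ->
  V' *m gU = a *: (1%:M + gS) /\
  H *m gU + V *m (z%:M + z^-1 *: gS) = (a * (z + z^-1)) *: gU.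
Proof.
move=> uF; have e : V' *m gU = a *: (1%:M + gS).
  rewrite /gS addrA subrr add0r scalerA mulrCA mulfV // mulr1.
  by rewrite /gU -scalemxAr mulmxA.
split=> //; have := (gF_eq e).2; rewrite scale_scalar_mx mulr1; apply.
by rewrite /gU -scalemxAr mulmxA mulmxV // mul1mx mulmx1.
Qed.

Lemma core_solve m (u : 'M[C]_(d, m)) (b b' : 'M[C]_(r, m)) : gF \in unitmx ->
  V' *m u = a *: (b + b') ->
  H *m u + V *m (z *: b + z^-1 *: b') = (a * (z + z^-1)) *: u ->
  u = gU *m b /\ b' = gS *m b.
Proof.
move=> uF e /(gF_eq e) h.
have uE : u = gU *m b by rewrite /gU -scalemxAl -mulmxA scalemxAr -h mulKmx.
split=> //; have [h1 _] := gU_core uF.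
have : a *: (b + b') = a *: (b + gS *m b).
  by rewrite -e uE mulmxA h1 -scalemxAl mulmxDl mul1mx.
by move/(can_inj (scalerK a0))/addrI.
Qed.

Lemma core_solution m (b : 'M[C]_(r, m)) : gF \in unitmx ->
  V' *m (gU *m b) = a *: (b + gS *m b) /\
  H *m (gU *m b) + V *m (z *: b + z^-1 *: (gS *m b)) = (a * (z + z^-1)) *: (gU *m b).
Proof.
move=> uF; have [h1 h2] := gU_core uF; split.
  by rewrite mulmxA h1 -scalemxAl mulmxDl mul1mx.
rewrite [RHS]scalemxAl -h2 [RHS]mulmxDl mulmxA; congr (_ + _).
by rewrite -[RHS]mulmxA (mulmxDl z%:M) mul_scalar_mx -scalemxAl.
Qed.

End CoreEquations.

Section Kernel.
Variables (R : realType) (F : finFieldType) (G : set (pgl F)) (d r : nat).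
Variable Y : cusped_quotient R G d r.
Hypothesis latG : is_lattice G.
Local Notation C := (Cplx R).
Local Notation q := (#|F|%:R : R).
Local Notation A := (adjacency G (lift Y)).
Local Notation lam := (lambda R G (lift Y)).
Local Notation ec := (edge_count G (lift Y)).

Let subG : subgroup G. Proof. by case: latG. Qed.
Let finG x : vertex x -> finite_set (stab G x). Proof. by case: latG => _ h _; exact: h. Qed.

Lemma adj_delta u v : A (delta R u) v = (ec v u)%:R.
Proof.
have h := adjacency_delta subG finG R (lift_vertex Y) (lift_surj Y) (@lift_inj _ _ _ _ _ Y) u v.
exact h.
Qed.

Lemma lam_gt0 v : 0 < lam v.
Proof.
by rewrite invr_gt0 ltr0n; apply: (grp_order_gt0 subG finG); exact: lift_vertex.
Qed.

Lemma lam_sym u v : lam v * (ec v u)%:R = lam u * (ec u v)%:R.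
Proof.
have h := edge_count_sym subG finG (lift_vertex Y) u v.
have gu : (grp_order (stab G (lift Y u)))%:R != 0 :> R.
  by rewrite pnatr_eq0 -lt0n; apply: (grp_order_gt0 subG finG); exact: lift_vertex.
have gv : (grp_order (stab G (lift Y v)))%:R != 0 :> R.
  by rewrite pnatr_eq0 -lt0n; apply: (grp_order_gt0 subG finG); exact: lift_vertex.
rewrite /lambda; apply: (mulfI gu); apply: (mulfI gv).
rewrite [in RHS]mulVKf // mulrCA mulVKf // -!natrM.
by rewrite h.
Qed.

Lemma adj_row (f : label d r -> C) v (s : seq (label d r)) : uniq s ->
  (forall u, u \notin s -> ec v u = 0%N) ->
  A f v = \sum_(u <- s) (ec v u)%:R * f u.
Proof.
move=> us hs; have AE := adjacency_sum subG finG (lift_vertex Y) (lift_surj Y) (@lift_inj _ _ _ _ _ Y).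
under [RHS]eq_bigr => u _ do rewrite -adj_delta AE mulr_suml.
rewrite AE exchange_big /= big_seq [RHS]big_seq; apply: eq_bigr => y yN.
set w := quotient_vertex _ _ _ _.
have ws : w \in s.
  have vv := lift_vertex Y v; have nf := neighbours_finite vv.
  move: yN; rewrite in_fset_set // => /set_mem ny.
  apply: contraT => /hs /cardfs0_eq /(congr1 (fun N => y \in N)).
  rewrite in_fset0 in_fset_set; last exact: finite_setIl.
  move=> /negbT /negP[]; apply/mem_set; split=> //.
  by apply: (quotient_vertexP (lift_surj Y)); case: ny.
rewrite (bigD1_seq w) //= {1}/delta eqxx mul1r big1 ?addr0 // => u.
by rewrite /delta eq_sym => /negbTE ->; rewrite mul0r.
Qed.

Lemma label_cases (u : label d r) :
  (exists j, u = core r j) \/ exists c n, (1 <= n)%N /\ u = cusp d c n.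
Proof.
by case: u => [j|[c n]]; [left; exists j|right; exists c, n.+1].
Qed.

Lemma core_inj : injective (@core d r).
Proof. by move=> i j []. Qed.

Lemma cusp_neq_core c n j : (cusp d c n == core r j) = false.
Proof. by []. Qed.

Lemma cusp_eq c c' n n' : (1 <= n)%N -> (1 <= n')%N ->
  (cusp d c n == cusp d c' n') = (c == c' :> 'I_r) && (n == n').
Proof. by case: n n' => [//|n] [//|n'] _ _. Qed.

(** Edge counts are values of the adjacency operator on delta functions, so the recursion along the
    cusp determines them. *)
Lemma ec_cusp_core c n j : (2 <= n)%N -> ec (cusp d c n) (core r j) = 0%N.
Proof.
move=> n2; apply/eqP; rewrite -(eqr_nat C) -adj_delta adjacency_cusp //.
by rewrite /delta !cusp_neq_core mulr0 addr0.
Qed.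

Lemma ec_eq0_sym u v : ec u v = 0%N -> ec v u = 0%N.
Proof.
move=> e; have := lam_sym u v; rewrite e mulr0 => /eqP; rewrite mulf_eq0.
by rewrite gt_eqF ?lam_gt0 //= pnatr_eq0 => /eqP.
Qed.

Lemma ec_cusp1 c c' n : (1 <= n)%N ->
  ec (cusp d c 1) (cusp d c' n) = (c' == c) && (n == 2%N).
Proof.
by move=> n1; apply/eqP; rewrite -(eqr_nat C) -adj_delta adjacency_cusp1.
Qed.

Definition cores : seq (label d r) := [seq core r j | j <- enum 'I_d].
Definition cusps1 : seq (label d r) := [seq cusp d c 1 | c <- enum 'I_r].

Lemma adj_core (f : label d r -> C) i :
  A f (core r i) = \sum_j (ec (core r i) (core r j))%:R * f (core r j) +
                   \sum_c (ec (core r i) (cusp d c 1))%:R * f (cusp d c 1).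
Proof.
rewrite (@adj_row f (core r i) (cores ++ cusps1)).
- by rewrite big_cat /=; congr (_ + _); rewrite big_map big_enum.
- rewrite cat_uniq; apply/and3P; split.
  + by rewrite map_inj_uniq ?enum_uniq //; exact: core_inj.
  + by apply/hasPn => _ /mapP[c _ ->]; apply/negP => /mapP[j _ /eqP].
  + rewrite map_inj_uniq ?enum_uniq // => c c' /eqP.
    by rewrite cusp_eq // => /andP[/eqP].
move=> u; rewrite mem_cat negb_or => /andP[u1 u2].
case: (label_cases u) => [[j uE]|[c [n [n1 uE]]]].
  by case/negP: u1; rewrite uE map_f // mem_enum.
have n2 : (2 <= n)%N.
  rewrite ltn_neqAle n1 andbT; apply: contraNneq u2 => n1'.
  by rewrite uE -n1'; apply/mapP; exists c; rewrite ?mem_enum.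
(* No edge leads from level [n >= 2] to the core, hence none from the core to that level. *)
by apply: ec_eq0_sym; rewrite uE ec_cusp_core.
Qed.

Lemma adj_cusp1 (f : label d r -> C) c :
  A f (cusp d c 1) = \sum_j (ec (cusp d c 1) (core r j))%:R * f (core r j) +
                     f (cusp d c 2).
Proof.
rewrite (@adj_row f (cusp d c 1) (rcons cores (cusp d c 2))).
- by rewrite -cats1 big_cat big_seq1 big_map big_enum ec_cusp1 // eqxx mul1r.
- rewrite rcons_uniq map_inj_uniq ?enum_uniq ?andbT; last exact: core_inj.
  by apply/negP => /mapP[j _ /eqP].
move=> u; rewrite mem_rcons in_cons negb_or => /andP[u1 u2].
case: (label_cases u) => [[j uE]|[c' [n [n1 uE]]]].
  by case/negP: u2; rewrite uE map_f // mem_enum.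
rewrite uE ec_cusp1 //; apply/eqP; rewrite eqb0.
by move: u1; rewrite uE cusp_eq.
Qed.

Local Notation sl v := (toC (Num.sqrt (lam v)) : C).

Lemma sl_neq0 v : sl v != 0.
Proof. by rewrite fmorph_eq0 lt0r_neq0 // sqrtr_gt0 lam_gt0. Qed.

Lemma sl_sqr v : sl v ^+ 2 = toC (lam v).
Proof. by rewrite -rmorphXn sqr_sqrtr // ltW // lam_gt0. Qed.

Lemma jacobi_delta u v : jacobi Y (delta R u) v = sl v / sl u * (ec v u)%:R.
Proof.
rewrite /jacobi -mulrA; congr (_ * _); rewrite -adj_delta.
have -> : (fun w => toC (Num.sqrt (lam w))^-1 * delta R u w) =
          (fun w => (sl u)^-1 * delta R u w).
  apply/funext => w; rewrite /delta; case: (eqVneq w u) => [->|_]; last by rewrite !mulr0.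
  by rewrite fmorphV.
by rewrite !(adjacency_sum subG finG (lift_vertex Y) (lift_surj Y) (@lift_inj _ _ _ _ _ Y)) mulr_sumr.
Qed.

Lemma jacobi_sym u v : jacobi Y (delta R u) v = jacobi Y (delta R v) u.
Proof.
rewrite !jacobi_delta; apply: (mulfI (sl_neq0 u)); apply: (mulfI (sl_neq0 v)).
have e1 x y k : sl x * (sl y * (sl x / sl y * k)) = toC (lam x) * k.
  by rewrite -sl_sqr; field; rewrite sl_neq0.
have e2 x y k : sl x * (sl y * (sl y / sl x * k)) = toC (lam y) * k.
  by rewrite -sl_sqr; field; rewrite sl_neq0.
rewrite e1 e2 -[(ec v u)%:R](rmorph_nat (@toC R)) -[(ec u v)%:R](rmorph_nat (@toC R)).
by rewrite -!rmorphM lam_sym.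
Qed.

Lemma jacobi_real u v : (jacobi Y (delta R u) v)^* = jacobi Y (delta R u) v.
Proof.
rewrite jacobi_delta -fmorphV -(rmorph_nat (@toC R)) -!rmorphM.
by apply: CplxP; rewrite /= ?oppr0.
Qed.

Local Notation Hm := (core_mx Y).
Local Notation Vm := (coupling_mx Y).

Lemma core_mx_sym : adjmx Hm = Hm.
Proof. by apply/matrixP => i j; rewrite !mxE jacobi_real jacobi_sym. Qed.

Lemma adj_couplingE c j : adjmx Vm c j = jacobi Y (delta R (core r j)) (cusp d c 1).
Proof. by rewrite !mxE jacobi_real jacobi_sym. Qed.

(** At [(c, n)] the factor [lambda^(1/2)] equals [qw c / a ^ n], so it turns a wave [(a z) ^ n b_c]
    into [z ^ n (qw c) b_c]. *)
Definition qw c : R := Num.sqrt (width Y c * (q + 1)).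
Local Notation ka c := (toC (qw c) : C).
Local Notation a := (sqrt_q R F).

Lemma q_gt1 : 1 < q.
Proof. by rewrite ltr1n card_finNzRing_gt1. Qed.

Lemma q_gt0 : 0 < q. Proof. exact: lt_trans q_gt1. Qed.

Lemma a_neq0 : a != 0.
Proof. by rewrite fmorph_eq0 lt0r_neq0 // sqrtr_gt0 q_gt0. Qed.

Lemma a_sqr : a ^+ 2 = toC q.
Proof. by rewrite -rmorphXn sqr_sqrtr // ltW // q_gt0. Qed.

Lemma qw_neq0 c : ka c != 0.
Proof.
rewrite fmorph_eq0 lt0r_neq0 // sqrtr_gt0 mulr_gt0 ?width_gt0 // ltr_wpDl // ltW // q_gt0.
Qed.

Lemma sl_cusp c n : (1 <= n)%N -> sl (cusp d c n) = ka c / a ^+ n.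
Proof.
move=> n1; have w0 : 0 <= width Y c * (q + 1).
  by rewrite mulr_ge0 ?addr_ge0 ?ler0n // ltW ?width_gt0.
rewrite lambda_cusp // sqrtrM // sqrtrV ?exprn_ge0 ?ler0n // rmorphM fmorphV -/(qw c); congr (_ / _).
have -> : Num.sqrt (q ^+ n) = Num.sqrt q ^+ n.
  elim: n {n1} => [|n IH]; first by rewrite !expr0 sqrtr1.
  by rewrite !exprS sqrtrM ?IH ?ler0n.
exact: rmorphXn.
Qed.

(* The values of a function with cusp expansion [P ^ n b + (q / P) ^ n b'], in the
   coordinates of the Jacobi operator. *)
Definition uvec (f : label d r -> C) : 'cV[C]_d := \col_i (sl (core r i) * f (core r i)).
Definition bvec (b : 'cV[C]_r) : 'cV[C]_r := \col_c (ka c * b c 0).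

(** From level 2 on, the waves solve the recursion identically, since [a ^ 2 = q]. Extending them to
    level 0, where they take the value [b + b'], turns the equation at level 1 into the cusp
    equation of the core system. *)
Lemma core_eq_iff (f : label d r -> C) (b b' : 'cV[C]_r) (z : C) : z != 0 ->
  (forall c n, (1 <= n)%N -> f (cusp d c n) = (a * z) ^+ n * b c 0 + (a / z) ^+ n * b' c 0) ->
  (forall v, A f v = (a * (z + z^-1)) * f v) <->
  adjmx Vm *m uvec f = a *: (bvec b + bvec b') /\
  Hm *m uvec f + Vm *m (z *: bvec b + z^-1 *: bvec b') = (a * (z + z^-1)) *: uvec f.
Proof.
move=> z0 hf; have a0 := a_neq0.
have rowi i : (sl (core r i) * A f (core r i) =
   (Hm *m uvec f + Vm *m (z *: bvec b + z^-1 *: bvec b')) i 0).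
  rewrite adj_core mulrDr !mxE !mulr_sumr; congr (_ + _); apply: eq_bigr => j _.
    rewrite !mxE jacobi_delta; field; exact: sl_neq0.
  rewrite !mxE jacobi_delta sl_cusp // hf // !expr1.
  by field; rewrite z0 a0 qw_neq0.
have rowc c : sl (cusp d c 1) * (A f (cusp d c 1) - (a * (z + z^-1)) * f (cusp d c 1)) =
   (adjmx Vm *m uvec f - a *: (bvec b + bvec b')) c 0.
  rewrite adj_cusp1 -addrA mulrDr [in RHS]mxE; congr (_ + _).
    rewrite mxE mulr_sumr; apply: eq_bigr => j _.
    rewrite adj_couplingE [in RHS]mxE jacobi_delta; field; exact: sl_neq0.
  rewrite sl_cusp // !hf // !mxE; field; by rewrite z0 a0.
split=> [h|[h1 h2] v].
  split; apply/matrixP => c j; rewrite ord1.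
    apply/eqP; rewrite -subr_eq0; have := rowc c; rewrite h subrr mulr0 => /esym/eqP.
    by rewrite mxE [X in _ + X]mxE.
  by rewrite -rowi h !mxE mulrCA.
case: (label_cases v) => [[i ->]|[c [n [n1 ->]]]].
  by apply: (mulfI (sl_neq0 (core r i))); rewrite rowi h2 !mxE mulrCA.
case: n n1 => [//|[_|n _]].
  apply/eqP; rewrite -subr_eq0; apply/eqP; apply: (mulfI (sl_neq0 (cusp d c 1))).
  by rewrite rowc h1 subrr mxE mulr0.
have qE : #|F|%:R = a ^+ 2 :> C by rewrite a_sqr rmorph_nat.
rewrite adjacency_cusp // !hf // qE /= !exprS.
by field.
Qed.

End Kernel.

(** * The Eisenstein family in closed form *)

Section Eisenstein.
Variables (R : realType) (F : finFieldType) (G : set (pgl F)) (d r : nat).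
Variable Y : cusped_quotient R G d r.
Hypothesis latG : is_lattice G.
Local Notation C := (Cplx R).
Local Notation q := (#|F|%:R : R).
Local Notation lam := (lambda R G (lift Y)).
Local Notation sl v := (toC (Num.sqrt (lam v)) : C).
Local Notation Hm := (core_mx Y).
Local Notation Vm := (coupling_mx Y).
Local Notation ka c := (toC (qw Y c) : C).
Local Notation a := (sqrt_q R F).
Local Notation qp := (qpow F (R := R)).
Local Notation zeta s := (qp (s - 2%:R^-1)).
Local Notation U z := (gU Hm Vm (adjmx Vm) a z).
Local Notation S z := (S_formula Y z).

Let a0 : a != 0 := a_neq0 R F.

Lemma zeta_neq0 (s : C) : zeta s != 0.
Proof. exact: cexp_neq0. Qed.

Lemma qpow_natM n (s : C) : qp (n%:R * s) = qp s ^+ n.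
Proof. by rewrite /qpow -mulrA cexpMn. Qed.

Lemma cexp_toC (x : R) : cexp (toC x) = toC (expR x).
Proof. by rewrite /cexp /= cos0 sin0 -[X in _ * X]/(1 : C) mulr1. Qed.

Lemma qpow1 : qp 1 = toC q.
Proof. by rewrite /qpow mul1r cexp_toC lnK // posrE q_gt0. Qed.

Lemma qpow_half : qp 2%:R^-1 = a.
Proof.
have -> : (2%:R^-1 : C) = toC 2^-1 by rewrite fmorphV rmorph_nat.
rewrite /qpow -rmorphM cexp_toC; congr toC.
have e : q = expR (2^-1 * ln q) ^+ 2.
  by rewrite -expRM_natl mulrA mulfV // mul1r lnK // posrE q_gt0.
by rewrite [in RHS]e sqrtr_sqr ger0_norm // expR_ge0.
Qed.

Lemma qpowE s : qp s = a * zeta s.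
Proof. by rewrite -qpow_half /qpow -cexpD -mulrDl addrC subrK. Qed.

Lemma qpow1BE s : qp (1 - s) = a / zeta s.
Proof.
rewrite -[qp (1 - s)]/(cexp ((1 - s) * toC (ln q))) mulrBl cexpB -/(qp 1) -/(qp s).
rewrite qpow1 qpowE -a_sqr; field; by rewrite a0 zeta_neq0.
Qed.

(** This is [W^(-1/2) S W^(1/2) b]: the factors [q + 1] inside [ka] cancel. *)
Definition sbvec (z : C) (b : 'cV[C]_r) : 'cV[C]_r :=
  \col_c ((ka c)^-1 * (S z *m bvec Y b) c 0).

Lemma bvec_sbvec z b : bvec Y (sbvec z b) = S z *m bvec Y b.
Proof.
by apply/matrixP => c j; rewrite ord1 !mxE mulVKf ?qw_neq0.
Qed.

(** The label [inr (c, n)] is the vertex [(c, n + 1)], whence the exponents. *)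
Definition eis_expl (z : C) (b : 'cV[C]_r) (v : label d r) : C :=
  match v with
  | inl i => (sl (core r i))^-1 * (U z *m bvec Y b) i 0
  | inr (c, n) => (a * z) ^+ n.+1 * b c 0 + (a / z) ^+ n.+1 * sbvec z b c 0
  end.

Lemma eis_expl_cusp z b c n : (1 <= n)%N ->
  eis_expl z b (cusp d c n) = (a * z) ^+ n * b c 0 + (a / z) ^+ n * sbvec z b c 0.
Proof. by case: n. Qed.

Lemma uvec_expl z b : uvec Y (eis_expl z b) = U z *m bvec Y b.
Proof. by apply/matrixP => i j; rewrite ord1 mxE /= mulVKf ?sl_neq0. Qed.

(** When [F] is invertible the core equations have exactly one solution, so the choice made in
    [eis_generic] returns this function. *)
Lemma is_eisensteinE s b f : F_mx Y (zeta s) \in unitmx ->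
  is_eisenstein Y s b f <-> f = eis_expl (zeta s) b.
Proof.
set z := zeta s => uF; have z0 : z != 0 := zeta_neq0 s.
have eig : qp s + qp (1 - s) = a * (z + z^-1) by rewrite qpowE qpow1BE -/z mulrDr.
split.
  move=> [hA [b' hf]].
  have hf' c n : (1 <= n)%N -> f (cusp d c n) = (a * z) ^+ n * b c 0 + (a / z) ^+ n * b' c 0.
    by move=> n1; rewrite hf // (qpow_natM n s) (qpow_natM n (1 - s)) (qpowE s) (qpow1BE s) -/z.
  rewrite eig in hA; have [h1 h2] := (core_eq_iff Y latG z0 hf').1 hA.
  have [uE bE] := core_solve a0 uF h1 h2.
  apply/funext => v; case: (label_cases v) => [[i ->]|[c [n [n1 ->]]]].
    rewrite /= -[_ *m _]/(U z *m bvec Y b) -uE mxE mulKf ?sl_neq0 //.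
  rewrite hf' // eis_expl_cusp //; congr (_ + _ * _).
  apply: (mulfI (qw_neq0 Y c)).
  have := congr1 (fun M : 'cV[C]_r => M c 0) bE; rewrite mxE => ->.
  by rewrite [in RHS]mxE mulVKf ?qw_neq0.
move=> ->; split.
  rewrite eig; apply/(core_eq_iff Y latG z0 (eis_expl_cusp z b)).
  rewrite uvec_expl bvec_sbvec.
  exact: (core_solution a0 (bvec Y b) (uF : gF Hm Vm (adjmx Vm) a z \in unitmx)).
exists (sbvec z b) => c n n1.
by rewrite eis_expl_cusp // (qpow_natM n s) (qpow_natM n (1 - s)) (qpowE s) (qpow1BE s) -/z.
Qed.

Lemma eis_genericE s b : F_mx Y (zeta s) \in unitmx ->
  eis_generic Y s b = eis_expl (zeta s) b.
Proof.
move=> uF; have h : is_eisenstein Y s b (eis_expl (zeta s) b).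
  exact: (is_eisensteinE b _ uF).2.
apply/(is_eisensteinE b _ uF).
exact: (xgetPex (fun=> 0) (ex_intro _ _ h)).
Qed.

Lemma S_aut_genericE s i j : F_mx Y (zeta s) \in unitmx ->
  S_aut_generic Y s i j = (ka i)^-1 * S (zeta s) i j * ka j.
Proof.
set z := zeta s => uF; have z0 : z != 0 := zeta_neq0 s.
pose M : 'M[C]_r := \matrix_(i, j) ((ka i)^-1 * S z i j * ka j).
have ME b : M *m b = sbvec z b.
  apply/matrixP => c k; rewrite ord1 !mxE mulr_sumr; apply: eq_bigr => l _.
  by rewrite !mxE !mulrA.
suff -> : S_aut_generic Y s = M by rewrite mxE.
have hM (b : 'cV[C]_r) c n : (1 <= n)%N -> eis_generic Y s b (cusp d c n) =
    qp (n%:R * s) * b c 0 + qp (n%:R * (1 - s)) * (M *m b) c 0.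
  move=> n1; rewrite eis_genericE // eis_expl_cusp // ME.
  by rewrite (qpow_natM n s) (qpow_natM n (1 - s)) (qpowE s) (qpow1BE s) -/z.
rewrite /S_aut_generic; case: xgetP => [N _ hN|hN]; last by case: (hN M).
apply/matrixP => k l; pose e : 'cV[C]_r := delta_mx l 0.
have colE (P : 'M[C]_r) : (P *m e) k 0 = P k l by rewrite -colE mxE.
(* At level 1 on a basis vector the terms in [b] cancel, and the matrix entries remain with a common
   nonzero factor. *)
have := hN e k 1%N isT; rewrite hM // => /addrI/(mulfI (cexp_neq0 _)).
by rewrite !colE.
Qed.

End Eisenstein.

(** * Isolated zeros and generic invertibility of [F] *)

Section PolyZeros.
Variables (C : numFieldType) (T : Type) (F : set_system T) (FF : Filter F) (t : T).
Variable d : T -> C.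
Hypothesis Ft : forall P : set T, F P -> P t.
Hypothesis d0 : d x @[x --> F] --> (0 : C).

Lemma cvg_horner (p : {poly C}) (f : T -> C) (l : C) :
  f u @[u --> F] --> l -> p.[f u] @[u --> F] --> p.[l].
Proof.
move=> cf; elim/poly_ind: p => [|p c IH].
  have -> : (fun u => (0 : {poly C}).[f u]) = (fun=> 0) by apply/funext => u; rewrite horner0.
  by rewrite horner0; exact: cvg_cst.
have -> : (fun u => (p * 'X + c%:P).[f u]) = (fun u => p.[f u] * f u + c).
  by apply/funext => u; rewrite hornerMXaddC.
rewrite hornerMXaddC; apply: cvgD; [exact: cvgM|exact: cvg_cst].
Qed.

(** Write [p] as a power of ['X - y t] times a factor that does not vanish at [y t]; the nonzero
    derivative moves [y u] away from that root. *)
Lemma near_poly_neq0 (p : {poly C}) (y : T -> C) c : p != 0 -> c != 0 ->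
  slope F t d y c -> \forall u \near F, d u != 0 -> p.[y u] != 0.
Proof.
move=> p0 c0 sy; have [m [r r0' pm]] := multiplicity_XsubC p (y t).
rewrite p0 /= in r0'; have cy := slope_cvg FF d0 sy.
have r0 : r.[y t] != 0 by rewrite -rootE.
have h1 := near_cvg_neq0 FF (@cvg_horner r y _ cy) r0.
have h2 := slope_neq FF sy c0.
apply: filterS2 h1 h2 => u h1 h2 /h2 yu.
by rewrite pm hornerM mulf_neq0 // horner_exp expf_neq0 // hornerXsubC subr_eq0.
Qed.

Lemma cvg_expn (f : T -> C) (l : C) n : f u @[u --> F] --> l -> f u ^+ n @[u --> F] --> l ^+ n.
Proof.
move=> h; elim: n => [|n IH].
  have -> : (fun u => f u ^+ 0) = (fun=> 1) by apply/funext => u; rewrite expr0.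
  by rewrite expr0; exact: cvg_cst.
have -> : (fun u => f u ^+ n.+1) = (fun u => f u * f u ^+ n).
  by apply/funext => u; rewrite exprS.
by rewrite exprS; exact: cvgM.
Qed.

Lemma cvg_invf (f : T -> C) (l : C) : l != 0 -> f u @[u --> F] --> l ->
  (f u)^-1 @[u --> F] --> l^-1.
Proof. by move=> l0 h; exact: cvgV. Qed.

Lemma cvg_add (f g : T -> C) (l k : C) : f u @[u --> F] --> l -> g u @[u --> F] --> k ->
  f u + g u @[u --> F] --> l + k.
Proof. exact: cvgD. Qed.

Lemma cvg_mull_cst (f : T -> C) (l k : C) : f u @[u --> F] --> l -> k * f u @[u --> F] --> k * l.
Proof. by move=> h; apply: cvgM => //; exact: cvg_cst. Qed.

Lemma cvg_sumr I (s : seq I) (f : I -> T -> C) (l : I -> C) :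
  (forall i, f i u @[u --> F] --> l i) ->
  \sum_(i <- s) f i u @[u --> F] --> \sum_(i <- s) l i.
Proof.
move=> h; elim: s => [|i s IH].
  have -> : (fun u => \sum_(j <- [::]) f j u) = (fun=> 0).
    by apply/funext => u; rewrite big_nil.
  by rewrite big_nil; exact: cvg_cst.
have -> : (fun u => \sum_(j <- i :: s) f j u) = (fun u => f i u + \sum_(j <- s) f j u).
  by apply/funext => u; rewrite big_cons.
by rewrite big_cons; exact: cvgD.
Qed.

End PolyZeros.

Lemma cslope_poly_neq0 (C : numFieldType) (p : {poly C}) (y : C -> C) (t c : C) :
  p != 0 -> c != 0 -> cslope y t c -> \forall u \near t^', p.[y u] != 0.
Proof.
move=> p0 c0 sy.
have h := near_poly_neq0 (nbhsF t) (@cvg_inc C t) p0 c0 sy.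
have h' : \forall u \near t^', u - t != 0 -> p.[y u] != 0 by exact: near_dnbhs.
by apply: filterS2 h' (@dnbhs_neq C t) => u hu ut; apply: hu; rewrite subr_eq0.
Qed.

Section MatrixLimits.
Variables (C : numFieldType) (T : Type) (F : set_system T) (FF : Filter F).

Definition mcvg m n (f : T -> 'M[C]_(m, n)) (l : 'M[C]_(m, n)) :=
  forall i j, f u i j @[u --> F] --> l i j.

Lemma mcvg_cst m n (l : 'M[C]_(m, n)) : mcvg (fun=> l) l.
Proof. by move=> i j; exact: cvg_cst. Qed.

Lemma mcvgD m n (f g : T -> 'M[C]_(m, n)) l k :
  mcvg f l -> mcvg g k -> mcvg (fun u => f u + g u) (l + k).
Proof.
move=> hf hg i j; rewrite mxE.
have -> : (fun u => (f u + g u) i j) = (fun u => f u i j + g u i j).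
  by apply/funext => u; rewrite mxE.
exact: cvgD.
Qed.

Lemma mcvgZ m n (x : T -> C) (f : T -> 'M[C]_(m, n)) (k : C) l :
  x u @[u --> F] --> k -> mcvg f l -> mcvg (fun u => x u *: f u) (k *: l).
Proof.
move=> hx hf i j; rewrite mxE.
have -> : (fun u => (x u *: f u) i j) = (fun u => x u * f u i j).
  by apply/funext => u; rewrite mxE.
exact: cvgM.
Qed.

Lemma mcvgM m n p (f : T -> 'M[C]_(m, n)) (g : T -> 'M[C]_(n, p)) l k :
  mcvg f l -> mcvg g k -> mcvg (fun u => f u *m g u) (l *m k).
Proof.
move=> hf hg i j; rewrite mxE.
have -> : (fun u => (f u *m g u) i j) = (fun u => \sum_s f u i s * g u s j).
  by apply/funext => u; rewrite mxE.
by apply: cvg_sumr => s; exact: cvgM.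
Qed.

Lemma mcvg_eq m n (f g : T -> 'M[C]_(m, n)) l : (\forall u \near F, f u = g u) ->
  mcvg f l -> mcvg g l.
Proof.
move=> e hf i j; apply: cvg_trans (hf i j); apply: near_eq_cvg.
by apply: filterS e => u ->.
Qed.

Lemma mcvg_uniq (PF : ProperFilter F) m n (f : T -> 'M[C]_(m, n)) l k :
  mcvg f l -> mcvg f k -> l = k.
Proof.
move=> hl hk; apply/matrixP => i j.
by apply: (cvg_unique _ (hl i j) (hk i j)); exact: norm_hausdorff.
Qed.

End MatrixLimits.

Section Generic.
Variables (R : realType) (F : finFieldType) (G : set (pgl F)) (d r : nat).
Variable Y : cusped_quotient R G d r.
Local Notation C := (Cplx R).
Local Notation Hm := (core_mx Y).
Local Notation Vm := (coupling_mx Y).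
Local Notation a := (sqrt_q R F).
Local Notation qp := (qpow F (R := R)).
Local Notation zeta s := (qp (s - 2%:R^-1)).
Let a0 : a != 0 := a_neq0 R F.

(* [a y F (1 / y)] is polynomial in [y] and equals [- a ^ 2] at [y = 0]. *)
Definition F_poly : {poly C} := \det (
  (a *: 'X) *: map_mx polyC Hm - (a ^+ 2 *: (1 + 'X^2))%:M
  + 'X^2 *: map_mx polyC (Vm *m adjmx Vm)).

Lemma F_polyE y : F_poly.[y] =
  \det ((a * y) *: Hm - (a ^+ 2 * (1 + y ^+ 2))%:M + y ^+ 2 *: (Vm *m adjmx Vm)).
Proof.
rewrite /F_poly -[_.[y]]/(horner_eval y _) -det_map_mx; congr (\det _).
apply/matrixP => i j; rewrite !mxE /= /horner_eval !(hornerD, hornerN, hornerM, hornerZ, hornerC, hornerX, hornerXn, hornerMn).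
by rewrite !expr2.
Qed.

Lemma F_poly_neq0 : F_poly != 0.
Proof.
apply/eqP => /(congr1 (fun p => p.[0])); rewrite F_polyE horner0 mulr0 scale0r expr0n /=.
rewrite scale0r addr0 add0r addr0 mulr1 -scaleN1r detZ det_scalar => /eqP.
by rewrite mulf_eq0 !expf_eq0 oppr_eq0 oner_eq0 (negbTE a0) !andbF.
Qed.

Lemma F_mx_unit z : z != 0 -> F_poly.[z^-1] != 0 -> F_mx Y z \in unitmx.
Proof.
move=> z0; rewrite F_polyE unitmxE unitfE; apply: contra => /eqP h.
have -> : (a * z^-1) *: Hm - (a ^+ 2 * (1 + z^-1 ^+ 2))%:M + z^-1 ^+ 2 *: (Vm *m adjmx Vm)
   = (a / z) *: F_mx Y z.
  rewrite /F_mx scalerDr scalerBr scale_scalar_mx scalerA.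
  by congr (_ *: _ - _%:M + _ *: _); field; rewrite ?a0 ?z0.
by rewrite detZ h mulr0.
Qed.

Lemma zeta_slope (s : C) : cslope (fun w => zeta w) s (zeta s * toC (ln #|F|%:R)).
Proof. exact: (cslope_cexp_comp (cslope_affine (- 2%:R^-1) (toC (ln #|F|%:R)) s)). Qed.

Lemma lnq_neq0 : toC (ln #|F|%:R : R) != 0.
Proof. by rewrite fmorph_eq0 lt0r_neq0 // ln_gt0 // q_gt1. Qed.

(** [F] may be singular at [s] itself, but [1 / zeta w] has nonzero derivative and so leaves the
    zero set of [F_poly] at once. *)
Lemma near_F_unit (s : C) : \forall w \near s^', F_mx Y (zeta w) \in unitmx.
Proof.
have z0 w : zeta w != 0 := zeta_neq0 F w.
have sV := @cslopeV C (fun w => zeta w) s _ (z0 s) (zeta_slope s).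
have c0 : - (zeta s * toC (ln #|F|%:R)) / zeta s ^+ 2 != 0.
  have zs := z0 s; have l0 := lnq_neq0.
  apply: mulf_neq0; first by rewrite oppr_eq0 mulf_neq0.
  by rewrite invr_eq0 expf_neq0.
have h := cslope_poly_neq0 F_poly_neq0 c0 sV.
by apply: filterS h => w; exact: F_mx_unit.
Qed.

Lemma near_F_unit_z (z : C) : z != 0 -> \forall w \near z^', F_mx Y w \in unitmx.
Proof.
move=> z0; have c0 : - 1 / z ^+ 2 != 0.
  by rewrite mulf_neq0 ?invr_eq0 ?expf_neq0 ?oppr_eq0 ?oner_eq0.
have h := cslope_poly_neq0 F_poly_neq0 c0 (cslope_inv z0).
have w0 : \forall w \near z^', w != 0.
  by apply: near_dnbhs; apply: (near_cvg_neq0 (nbhsF z) (@cvg_pt C z) z0).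
by apply: filterS2 h w0 => w hw w0'; exact: F_mx_unit.
Qed.

End Generic.

(** * Green's identity and unitarity *)

Section AdjMatrices.
Variable R : realType.
Local Notation C := (Cplx R).

Lemma adjmxM m n p (A : 'M[C]_(m, n)) (B : 'M[C]_(n, p)) :
  adjmx (A *m B) = adjmx B *m adjmx A.
Proof. by rewrite /adjmx map_mxM trmx_mul. Qed.

Lemma adjmxD m n (A B : 'M[C]_(m, n)) : adjmx (A + B) = adjmx A + adjmx B.
Proof. by rewrite /adjmx map_mxD raddfD. Qed.

Lemma adjmxZ m n k (A : 'M[C]_(m, n)) : adjmx (k *: A) = k^* *: adjmx A.
Proof. by apply/matrixP => i j; rewrite !mxE rmorphM. Qed.

Lemma adjmx_scalar n k : adjmx (k%:M : 'M[C]_n) = (k^*)%:M.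
Proof. by rewrite /adjmx map_scalar_mx tr_scalar_mx. Qed.

Lemma adjmx1 n : adjmx (1%:M : 'M[C]_n) = 1%:M.
Proof. by rewrite adjmx_scalar rmorph1. Qed.

Lemma adjmxK m n (A : 'M[C]_(m, n)) : adjmx (adjmx A) = A.
Proof. by apply/matrixP => i j; rewrite !mxE conjCK. Qed.

(** The product [adjmx U0 *m H *m U] is evaluated twice, by the equation for [U] and by the adjoint
    of the equation for [U0]; the coupling terms that remain form the Wronskian at the cusps. *)
Lemma green d r (H : 'M[C]_d) (V : 'M[C]_(d, r)) (a x0 x : C) (U0 U : 'M[C]_(d, r))
    (G0 G1 K0 K1 : 'M[C]_r) : adjmx H = H -> a^* = a -> x0^* = x0 ->
  adjmx V *m U0 = a *: G0 -> H *m U0 + V *m G1 = x0 *: U0 ->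
  adjmx V *m U = a *: K0 -> H *m U + V *m K1 = x *: U ->
  (x - x0) *: (adjmx U0 *m U) = a *: (adjmx G0 *m K1 - adjmx G1 *m K0).
Proof.
move=> hH ha hx e1 e2 e3 e4.
have f1 : adjmx U0 *m V = a *: adjmx G0.
  by rewrite -[V in LHS]adjmxK -adjmxM e1 adjmxZ ha.
have f2 : adjmx U0 *m H = x0 *: adjmx U0 - adjmx G1 *m adjmx V.
  apply/eqP; rewrite eq_sym subr_eq; apply/eqP.
  by rewrite -hx -adjmxZ -e2 adjmxD !adjmxM hH.
have : adjmx U0 *m (H *m U + V *m K1) = x *: (adjmx U0 *m U).
  by rewrite e4 scalemxAr.
rewrite mulmxDr !mulmxA f1 f2 mulmxBl -!scalemxAl -mulmxA e3 -scalemxAr => e5.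
by rewrite scalerBl -e5 scalerBr addrC !addrA addNr add0r addrC.
Qed.

(** The difference of the two sides expands to [(z - z^-1) (1 - adjmx S *m S)], all terms linear in
    [S] cancelling. *)
Lemma unitarity r (z : C) (S : 'M[C]_r) : z != 0 -> z != z^-1 -> z^* = z^-1 ->
  adjmx (1%:M + S) *m (z%:M + z^-1 *: S) = adjmx (z%:M + z^-1 *: S) *m (1%:M + S) ->
  adjmx S *m S = 1%:M.
Proof.
move=> z0 zV cz; have cz' : (z^-1)^* = z by rewrite -cz conjCK.
rewrite !adjmxD adjmx1 adjmx_scalar adjmxZ cz cz'.
rewrite !mulmxDl !mulmxDr !mul1mx !mulmx1 mul_mx_scalar mul_scalar_mx.
rewrite -!scalemxAr -!scalemxAl => e.
have zz : z - z^-1 != 0 by rewrite subr_eq0.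
move: e; move: (adjmx S *m S) => P; move: (adjmx S) => T e; apply/matrixP => i j.
have := congr1 (fun M : 'M[C]_r => M i j) e; rewrite !mxE => {}e.
apply: (mulfI zz); apply/eqP; rewrite -subr_eq0; apply/eqP.
move/eqP: e; rewrite -subr_eq0 => /eqP e; rewrite -[RHS]oppr0 -[X in _ = - X]e.
by ring.
Qed.

(* With [G0 = 1 + S] and [G1 = z + z^-1 S], the derivative at [t] of Green's identity. *)
Lemma green_derivative r (z : C) (S D P : 'M[C]_r) : z != 0 -> z != z^-1 ->
  z^* = z^-1 -> adjmx S *m S = 1%:M ->
  ('i * z - 'i * z^-1) *: P =
    adjmx (1%:M + S) *m (('i * z)%:M - ('i * z^-1) *: S + z^-1 *: D)
    - adjmx (z%:M + z^-1 *: S) *m D ->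
  P = 1%:M + 'i *: (adjmx S *m D) + (z - z^-1)^-1 *: (z *: adjmx S - z^-1 *: S).
Proof.
move=> z0 zV cz uS; have cz' : (z^-1)^* = z by rewrite -cz conjCK.
rewrite !adjmxD adjmx1 adjmx_scalar adjmxZ cz cz'.
rewrite !(mulmxDl, mulmxDr, mulmxN, mul1mx, mulmx1, mul_mx_scalar, mul_scalar_mx).
rewrite -?scalemxAr -?scalemxAl uS => e.
have i0 : 'i != 0 :> C by exact: neq0Ci.
have iE : 'i = - 'i^-1 :> C by rewrite invCi opprK.
rewrite [X in X *: (adjmx S *m D)]iE.
have zz : z - z^-1 != 0 by rewrite subr_eq0.
move: e; move: (adjmx S *m D) => Q; move: (adjmx S) => T e; apply/matrixP => i j.
have := congr1 (fun M : 'M[C]_r => M i j) e; rewrite !mxE => {}e.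
have iz : 'i * (z - z^-1) != 0 by rewrite mulf_neq0.
apply: (mulfI iz); apply/eqP; rewrite -subr_eq0; apply/eqP.
move/eqP: e; rewrite -subr_eq0 => /eqP e; rewrite -[RHS]e.
rewrite [X in _ - X = _]mulrDr [X in _ - (_ + X) = _]mulrA -['i * _ / _]mulrA mulfV // mulr1.
by field; rewrite ?z0 ?i0.
Qed.

End AdjMatrices.

Section Circle.
Variables (R : realType) (F : finFieldType).
Local Notation C := (Cplx R).
Local Notation q := (#|F|%:R : R).

Lemma circle_zeta (t : R) : qpow F (s_theta F t - 2%:R^-1) = circle t.
Proof.
rewrite /qpow /circle; congr cexp.
have -> : s_theta F t - 2%:R^-1 = Complex 0 (t / ln q) :> C.
  have -> : (2%:R^-1 : C) = toC 2^-1 by rewrite fmorphV rmorph_nat.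
  by apply: CplxP; rewrite /= ?subrr ?oppr0 ?addr0.
have l0 : ln q != 0 by rewrite lt0r_neq0 // ln_gt0 // q_gt1.
by apply: CplxP; rewrite /= ?mulr0 ?mul0r ?subr0 ?add0r ?addr0 ?oppr0 ?mulfVK.
Qed.

Lemma circle_neq0 (t : R) : circle t != 0.
Proof. exact: cexp_neq0. Qed.

Lemma circleE (t : R) : circle t = Complex (cos t) (sin t).
Proof. by rewrite /circle /cexp /= expR0 rmorph1 mul1r. Qed.

Lemma circle_conj (t : R) : (circle t)^* = (circle t)^-1.
Proof.
rewrite -[RHS]cexpN circleE /cexp /= oppr0 expR0 rmorph1 mul1r cosN sinN.
by apply: CplxP.
Qed.

Lemma norm_circle (t : R) : `|circle t| = 1.
Proof.
by rewrite circleE [LHS]normc_def /= cos2Dsin2 sqrtr1.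
Qed.

Lemma circle_neqV (t : R) : 0 < t < pi -> circle t != (circle t)^-1.
Proof.
move=> t0; rewrite -circle_conj circleE; apply/eqP => /(congr1 (@complex.Im R)) /= e.
have := sin_gt0_pi t0; lra.
Qed.

Lemma circle_slope (t : R) : rslope (@circle R) t (circle t * 'i%C).
Proof.
apply: rslope_cexp_comp; exists (fun=> 'i%C); split=> //; first exact: cvg_cst.
by apply: nearW => u; apply: CplxP; rewrite /= ?mulr0 ?mul0r ?subr0 ?add0r ?addr0 ?oppr0 ?mulr1.
Qed.

Lemma cvg_circle (t : R) : circle u @[u --> nbhs t] --> circle t.
Proof. exact: rslope_cvg (circle_slope t). Qed.

Lemma cvg_s_theta (t : R) : s_theta F u @[u --> t^'] --> (s_theta F t)^'.
Proof.
have h : s_theta F u @[u --> nbhs t] --> s_theta F t.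
  apply: cvg_ReIm => /=; first exact: cvg_cst.
  exact: (@cvg_mulr_cst R R _ (nbhsF t) id t (ln q)^-1 (@cvg_pt R t)).
have l0 : ln q != 0 by rewrite lt0r_neq0 // ln_gt0 // q_gt1.
move=> P hP; have hP' : \forall u \near nbhs t, s_theta F u != s_theta F t -> P (s_theta F u).
  exact: (h _ hP).
have : \forall u \near nbhs t, u != t -> P (s_theta F u).
  apply: filterS hP' => u hu ut; apply: hu; apply/eqP => -[] /(mulIf _) e.
  by move/eqP: ut; apply; apply: e; rewrite invr_eq0.
by [].
Qed.

Lemma cvg_circle_dnbhs (t : R) : circle u @[u --> t^'] --> (circle t)^'.
Proof.
have h := @cvg_circle t; move=> P hP.
have hP' : \forall u \near nbhs t, circle u != circle t -> P (circle u) by exact: (h _ hP).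
have n0 := slope_neq (nbhsF t) (circle_slope t) _.
have : \forall u \near nbhs t, u != t -> P (circle u).
  have ic : circle t * 'i%C != 0 by rewrite mulf_neq0 ?circle_neq0 // -normr_eq0 norm_i oner_eq0.
  have := n0 ic; apply: filterS2 hP' => u hu hn ut; apply: hu; apply: hn.
  by rewrite fmorph_eq0 subr_eq0.
by [].
Qed.

End Circle.

(** * The Gram matrix *)

Section MatrixSlope.
Variables (R : realType) (t : R).
Local Notation C := (Cplx R).

Definition mslope m n (f : R -> 'M[C]_(m, n)) (D : 'M[C]_(m, n)) :=
  forall i j, rslope (fun u => f u i j) t (D i j).

Lemma mslope_cst m n (A : 'M[C]_(m, n)) : mslope (fun=> A) 0.
Proof. by move=> i j; rewrite mxE; exact: rslope_cst. Qed.

Lemma mslopeD m n (f g : R -> 'M[C]_(m, n)) D E : mslope f D -> mslope g E ->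
  mslope (fun u => f u + g u) (D + E).
Proof.
move=> hf hg i j; have := rslopeD (hf i j) (hg i j); rewrite mxE.
by apply: rslope_near; apply: nearW => u; rewrite mxE.
Qed.

Lemma mslopeZ m n (x : R -> C) (f : R -> 'M[C]_(m, n)) c D : rslope x t c -> mslope f D ->
  mslope (fun u => x u *: f u) (c *: f t + x t *: D).
Proof.
move=> hx hf i j; have := rslopeM hx (hf i j); rewrite !mxE.
by apply: rslope_near; apply: nearW => u; rewrite mxE.
Qed.

Lemma mslope_mull m n p (A : 'M[C]_(p, m)) (f : R -> 'M[C]_(m, n)) D : mslope f D ->
  mslope (fun u => A *m f u) (A *m D).
Proof.
move=> hf i j; rewrite mxE.
have h k : rslope (fun u => A i k * f u k j) t (A i k * D k j).
  have := rslopeM (rslope_cst (A i k) t) (hf k j); rewrite mul0r add0r; exact.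
have := rslope_sum (index_enum 'I_m) h; apply: rslope_near.
by apply: nearW => u; rewrite mxE.
Qed.

(** L'Hopital's rule: [W] is known only off [t], as the quotient of [f u] by [x u - x t], and its
    limit is the quotient of the derivatives, here stated without division. *)
Lemma slope_quotient (f x W : R -> C) c k w : rslope f t c -> f t = 0 -> rslope x t k ->
  (\forall u \near t^', (x u - x t) * W u = f u) -> W u @[u --> t^'] --> w -> k * w = c.
Proof.
move=> [phi [p1 p2 p3]] ft0 [psi [s1 s2 s3]] e hW.
have h1 := cvg_dnbhs p1; have FF : Filter t^' by exact: _.
have h2 := cvg_mul FF (cvg_dnbhs s1) hW.
have p3' := near_dnbhs p3; have s3' := near_dnbhs s3.
have e' : \forall u \near t^', phi u = psi u * W u.
  apply: filterS2 (filterI p3' s3') (filterI e (@dnbhs_neq R t)) => u [pu su] [eu ut].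
  have tu0 : toC (u - t) != 0 :> C by rewrite fmorph_eq0 subr_eq0.
  by apply: (mulfI tu0); rewrite mulrA -pu -su eu ft0 subr0.
have h3 : phi u @[u --> t^'] --> k * w.
  by apply: cvg_trans h2; apply: near_eq_cvg; apply: filterS e' => u ->.
exact: (cvg_unique (@norm_hausdorff _ _) h3 h1).
Qed.

End MatrixSlope.

Lemma rslope_eq (R : realType) (f g : R -> Cplx R) t c c' :
  f = g -> c = c' -> rslope f t c -> rslope g t c'.
Proof. by move=> -> ->. Qed.

Lemma sum_range (V : nmodType) (T : choiceType) (I : finType) (h : I -> T) (f : T -> V) :
  injective h -> \sum_(v \in range h) f v = \sum_i f (h i).
Proof.
move=> hi; rewrite fsbig_image; last by move=> x y _ _; exact: hi.
rewrite (fsbigE (index_enum I)) ?index_enum_uniq //; last by move=> i _; rewrite mem_index_enum.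
by apply: eq_bigl => i; rewrite in_setT.
Qed.

Lemma sum_truncation (V : nmodType) d r (f : label d r -> V) N :
  \sum_(v \in truncation N) f v =
  \sum_(i < d) f (core r i) + \sum_(1 <= n < N.+1) \sum_(c < r) f (cusp d c n).
Proof.
have cinj n : injective (fun c : 'I_r => cusp d c n) by move=> x y [].
have : finite_set (@truncation d r N) /\ \sum_(v \in truncation N) f v =
    \sum_(i < d) f (core r i) + \sum_(1 <= n < N.+1) \sum_(c < r) f (cusp d c n); last by case.
elim: N => [|N [fin IH]].
  have -> : @truncation d r 0 = range (@core d r).
    apply/seteqP; split=> [v [[i ->]|[c [n []]]]|v [i _ <-]]; first by exists i.
    - by case: n.
    - by left; exists i.
  rewrite big_geq // addr0 sum_range; last by move=> x y [].
  by split=> //; apply: finite_image; exact: finite_finset.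
have -> : @truncation d r N.+1 = truncation N `|` range (fun c : 'I_r => cusp d c N.+1).
  apply/seteqP; split=> [v [[i ->]|[c [n [n1]]]]|v [[[i ->]|[c [n [n1 nN ->]]]]|[c _ <-]]].
  - by left; left; exists i.
  - rewrite leq_eqVlt ltnS => /orP[/eqP -> ->|nN ->]; first by right; exists c.
    by left; right; exists c, n.
  - by left; exists i.
  - by right; exists c, n; rewrite (leq_trans nN).
  - by right; exists c, N.+1.
have fin' : finite_set (range (fun c : 'I_r => cusp d c N.+1)).
  by apply: finite_image; exact: finite_finset.
split; first by rewrite finite_setU.
rewrite fsbigU0 //; last first.
  move=> v [[[i ->]|[c [[|n] [// n1 nN ->]]]] [c' _ []]] // _ e.
  by rewrite -e ltnn in nN.
by rewrite IH /= sum_range // [in RHS]big_nat_recr //= addrA.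
Qed.

(** The boundary term of the Maass-Selberg relation completes both geometric sums: [z / (z - z^-1)]
    plus the sum of [z^(2 n)] is [z^(2 N) z / (z - z^-1)]. So the constant part is exactly [2 N] and
    the rest oscillates. The number [e] stands for an entry of the identity matrix. *)
Lemma wave_sum (K : fieldType) (z : K) : z != 0 -> z - z^-1 != 0 -> forall N (e : nat) (x y : K),
  (z - z^-1)^-1 * (z * x - z^-1 * y) +
    \sum_(1 <= n < N.+1) (2%:R *+ e + (z ^+ n) ^+ 2 * x + (z^-1 ^+ n) ^+ 2 * y) =
  (2 * N)%:R *+ e + (z ^+ 2) ^+ N * ((z - z^-1)^-1 * z * x) +
    (z^-1 ^+ 2) ^+ N * (- (z - z^-1)^-1 * z^-1 * y).
Proof.
move=> z0 zz N e x y; elim: N => [|N IH].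
  by rewrite big_geq // !expr0; ring.
rewrite big_nat_recr //= addrA IH mulnS natrD.
have zN n : (z ^+ n) ^+ 2 = (z ^+ 2) ^+ n by rewrite -!exprM mulnC.
have zVN n : (z^-1 ^+ n) ^+ 2 = (z^-1 ^+ 2) ^+ n by rewrite -!exprM mulnC.
rewrite zN zVN !exprS; move: (_ ^+ N) (_ ^+ N) => u v.
have zz' : z * z - 1 != 0.
  by have := mulf_neq0 z0 zz; rewrite mulrBr mulfV.
by field; rewrite z0 zz'.
Qed.

Lemma toCV (R : realType) (x : R) : toC x^-1 = (toC x)^-1 :> Cplx R.
Proof. exact: fmorphV. Qed.

Lemma toCM (R : realType) (x y : R) : toC (x * y) = toC x * toC y :> Cplx R.
Proof. exact: rmorphM. Qed.

Lemma toCX (R : realType) (x : R) n : toC (x ^+ n) = toC x ^+ n :> Cplx R.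
Proof. exact: rmorphXn. Qed.

(** * The Maass-Selberg relation at a holomorphic point *)

Section Main.
Variables (R : realType) (F : finFieldType) (G : set (pgl F)) (d r : nat).
Variable Y : cusped_quotient R G d r.
Hypothesis latG : is_lattice G.
Variable t : R.
Hypothesis t0 : 0 < t < pi.
Hypothesis hol : holomorphic_point Y t.
Local Notation C := (Cplx R).
Local Notation q := (#|F|%:R : R).
Local Notation lam := (lambda R G (lift Y)).
Local Notation sl v := (toC (Num.sqrt (lam v)) : C).
Local Notation Hm := (core_mx Y).
Local Notation Vm := (coupling_mx Y).
Local Notation ka c := (toC (qw Y c) : C).
Local Notation a := (sqrt_q R F).
Local Notation qp := (qpow F (R := R)).
Local Notation U z := (gU Hm Vm (adjmx Vm) a z).
Local Notation z0 := (circle t).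
Local Notation s0 := (s_theta F t).
Local Notation St := (fun u => S_mx Y (circle u)).

Let a0 : a != 0 := a_neq0 R F.
Let FF : Filter t^' := _.
Let PF : ProperFilter t^' := _.

Definition S_deriv : 'M[C]_r := \matrix_(i, j) cderive (fun u => S_mx Y (circle u) i j) t.

Lemma S_cont i j : exists g : C -> C,
  [/\ \forall w \near nbhs z0, derivable g w 1,
      \forall w \near z0^', S_formula Y w i j = g w &
      \forall w \near nbhs z0, S_mx Y w i j = g w].
Proof.
have [_ h _] := hol; have := h i j; rewrite circle_zeta.
move=> /holomorphic_continuation[g [h1 h2 h3]]; exists g; split=> //.
by apply: filterS h3 => w <-; rewrite mxE.
Qed.

Lemma S_mslope : mslope t St S_deriv.
Proof.
move=> i j; have [g [dg _ e]] := S_cont i j.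
have sg := derivable_cslope (nbhs_singleton dg).
have h := rslope_comp sg (circle_slope t).
have e' : \forall u \near nbhs t, g (circle u) = S_mx Y (circle u) i j.
  have e1 : \forall u \near nbhs t, S_mx Y (circle u) i j = g (circle u).
    exact: (@cvg_circle R t _ e).
  by apply: filterS e1 => u ->.
have h' := rslope_near e' h.
by rewrite mxE (rslope_cderive h').2.
Qed.

Lemma S_cderivable i j : cderivable (fun u => S_mx Y (circle u) i j) t.
Proof. exact: (rslope_cderive (S_mslope i j)).1. Qed.

Lemma near_S_generic : \forall u \near t^',
  S_mx Y (circle u) = S_formula Y (circle u) /\ F_mx Y (circle u) \in unitmx.
Proof.
have h1 : \forall w \near z0^', forall i j, S_mx Y w i j = S_formula Y w i j.
  apply: filter_forall => i; apply: filter_forall => j.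
  have [g [_ e1 e2]] := S_cont i j.
  by apply: filterS2 e1 (near_dnbhs e2) => w -> ->.
have h2 := near_F_unit_z Y (circle_neq0 t).
have h1' : \forall u \near t^', forall i j, S_mx Y (circle u) i j = S_formula Y (circle u) i j.
  exact: (@cvg_circle_dnbhs R t _ h1).
have h2' : \forall u \near t^', F_mx Y (circle u) \in unitmx.
  exact: (@cvg_circle_dnbhs R t _ h2).
by apply: filterS2 h1' h2' => u e uF; split=> //; apply/matrixP.
Qed.

(** [F] is invertible at all other angles near [t], so the continued Eisenstein function is the
    limit of the explicit one along the unitary axis. *)
Lemma eis_limit b v : eis_expl Y (circle u) b v @[u --> t^'] --> eis Y s0 b v.
Proof.
have [h _ _] := hol; have [l hl] := h b v.
have -> : eis Y s0 b v = l by exact: continuationE.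
have c1 := continues_cvg hl.
have c2 : eis_generic Y (s_theta F u) b v @[u --> t^'] --> l.
  by apply: cvg_comp c1; exact: cvg_s_theta.
apply: cvg_trans c2; apply: near_eq_cvg.
by apply: filterS near_S_generic => u [_ uF]; rewrite eis_genericE ?circle_zeta.
Qed.

Lemma St_limit : mcvg t^' St (S_mx Y z0).
Proof. by move=> i j; apply: cvg_dnbhs; exact: rslope_cvg (S_mslope i j). Qed.

Lemma bvec_std c : bvec Y (std_basis R c) = ka c *: delta_mx c 0.
Proof.
apply/matrixP => k l; rewrite ord1 !mxE eqxx andbT.
by case: eqP => [->|] //=; rewrite ?mulr1 ?mulr0.
Qed.

Lemma mul_bvec_std m (M : 'M[C]_(m, r)) c k : (M *m bvec Y (std_basis R c)) k 0 = ka c * M k c.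
Proof. by rewrite bvec_std -scalemxAr -colE !mxE. Qed.

(** The limit of [U] at the angle [t], defined through the continued Eisenstein functions because
    [F] may be singular there. *)
Definition U0 : 'M[C]_(d, r) :=
  \matrix_(i, c) (sl (core r i) / ka c * eis Y s0 (std_basis R c) (core r i)).

Lemma U_limit : mcvg t^' (fun u => U (circle u)) U0.
Proof.
move=> i c; rewrite mxE; have h := @eis_limit (std_basis R c) (core r i).
have h' := @cvg_mull_cst C R _ FF _ _ (sl (core r i) / ka c) h.
apply: cvg_trans h'; apply: near_eq_cvg; apply: nearW => u /=.
rewrite -[_ *m _]/(U (circle u) *m bvec Y (std_basis R c)) mul_bvec_std.
have s1 := sl_neq0 Y latG (core r i); have k1 := qw_neq0 Y c.
by field; rewrite s1 k1.
Qed.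

Lemma eis_core c i : eis Y s0 (std_basis R c) (core r i) = ka c / sl (core r i) * U0 i c.
Proof.
have s1 := sl_neq0 Y latG (core r i); have k1 := qw_neq0 Y c.
by rewrite mxE; field; rewrite s1 k1.
Qed.

Lemma eis_cusp c k n : (1 <= n)%N -> eis Y s0 (std_basis R c) (cusp d k n) =
  a ^+ n * (ka c / ka k) * (z0 ^+ n * (k == c)%:R + z0^-1 ^+ n * S_mx Y z0 k c).
Proof.
move=> n1; have h := @eis_limit (std_basis R c) (cusp d k n).
have cz := cvg_dnbhs (@cvg_circle R t).
have czV := cvg_invf FF (circle_neq0 t) cz.
have h1 := cvg_mulr_cst FF (k := (k == c)%:R) (cvg_expn FF (n := n) cz).
have h2 := cvg_mul FF (cvg_expn FF (n := n) czV) (@St_limit k c).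
have h3 := cvg_mull_cst FF (k := a ^+ n * (ka c / ka k)) (cvg_add FF h1 h2).
apply: (cvg_unique (@norm_hausdorff _ _) h); apply: cvg_trans h3; apply: near_eq_cvg.
apply: filterS near_S_generic => u [e _].
have eS : sbvec Y (circle u) (std_basis R c) k 0 = (ka k)^-1 * (ka c * S_mx Y (circle u) k c).
  by rewrite mxE mul_bvec_std e.
have eB : std_basis R c k 0 = (k == c)%:R by rewrite mxE eqxx andbT.
rewrite eis_expl_cusp // eS eB.
have kc := qw_neq0 Y c; have kk := qw_neq0 Y k.
rewrite !exprMn; move: (a ^+ n) (circle u ^+ n) (_^-1 ^+ n) (S_mx Y _ k c) => x y w S'.
by case: (eqVneq k c) => [->|_] /=; field; rewrite ?kc ?kk.
Qed.

Let cz0 : z0 != 0 := circle_neq0 t.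
Let zV : z0 != z0^-1 := circle_neqV t0.
Let S0 := S_mx Y z0.

Lemma U_equations u : F_mx Y (circle u) \in unitmx ->
  adjmx Vm *m U (circle u) = a *: (1%:M + S_formula Y (circle u)) /\
  Hm *m U (circle u) + Vm *m ((circle u)%:M + (circle u)^-1 *: S_formula Y (circle u)) =
  (a * (circle u + (circle u)^-1)) *: U (circle u).
Proof. by move=> uF; exact: (gU_core a0 (uF : gF Hm Vm (adjmx Vm) a (circle u) \in unitmx)). Qed.

Lemma U0_eq1 : adjmx Vm *m U0 = a *: (1%:M + S0).
Proof.
have h1 := mcvgM FF (@mcvg_cst C R _ FF _ _ (adjmx Vm)) U_limit.
have ca : (fun=> a) u @[u --> t^'] --> a by exact: cvg_cst.
have h2 := mcvgZ FF ca (mcvgD FF (@mcvg_cst C R _ FF _ _ 1%:M) St_limit).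
apply: (mcvg_uniq PF h1); apply: (mcvg_eq FF _ h2).
by apply: filterS near_S_generic => u [e /U_equations[-> _]]; rewrite e.
Qed.

Lemma cz_limit : circle u @[u --> t^'] --> z0.
Proof. exact: (cvg_dnbhs (@cvg_circle R t)). Qed.

Lemma czV_limit : (circle u)^-1 @[u --> t^'] --> z0^-1.
Proof. exact: (cvg_invf FF cz0 cz_limit). Qed.

Lemma scalar_limit (f : R -> C) (l : C) : f u @[u --> t^'] --> l ->
  mcvg t^' (fun u => (f u)%:M : 'M[C]_r) l%:M.
Proof.
move=> h i j; rewrite mxE.
have -> : (fun u => ((f u)%:M : 'M[C]_r) i j) = (fun u => f u * (i == j)%:R).
  by apply/funext => u; rewrite mxE mulr_natr.
have := cvg_mulr_cst FF (k := (i == j)%:R) h.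
by rewrite (mulr_natr l).
Qed.

Lemma U0_eq2 : Hm *m U0 + Vm *m (z0%:M + z0^-1 *: S0) = (a * (z0 + z0^-1)) *: U0.
Proof.
have h1 := mcvgD FF (mcvgM FF (@mcvg_cst C R _ FF _ _ Hm) U_limit)
  (mcvgM FF (@mcvg_cst C R _ FF _ _ Vm) (mcvgD FF (scalar_limit cz_limit) (mcvgZ FF czV_limit St_limit))).
have h2 := mcvgZ FF (cvg_mull_cst FF (k := a) (cvg_add FF cz_limit czV_limit)) U_limit.
apply: (mcvg_uniq PF h1); apply: (mcvg_eq FF _ h2).
by apply: filterS near_S_generic => u [e /U_equations[_ <-]]; rewrite e.
Qed.

Lemma a_real : a^* = a.
Proof. by apply: CplxP; rewrite /= ?oppr0. Qed.

Lemma x0_real : (a * (z0 + z0^-1))^* = a * (z0 + z0^-1).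
Proof.
have e : (z0 + z0^-1)^* = z0 + z0^-1 by rewrite rmorphD /= -circle_conj conjCK addrC.
by rewrite -{2}a_real -{2}e -rmorphM.
Qed.

Lemma green0 : adjmx (1%:M + S0) *m (z0%:M + z0^-1 *: S0) =
  adjmx (z0%:M + z0^-1 *: S0) *m (1%:M + S0).
Proof.
have := green (core_mx_sym Y latG) a_real x0_real U0_eq1 U0_eq2 U0_eq1 U0_eq2.
rewrite subrr scale0r => /esym/eqP; rewrite scaler_eq0 (negbTE a0) /= subr_eq0.
by move=> /eqP.
Qed.

Lemma S_unitary : adjmx S0 *m S0 = 1%:M.
Proof. exact: unitarity cz0 zV (circle_conj t) green0. Qed.

(** The right side of Green's identity between the solutions at [t] and at [u]. It vanishes at
    [u = t] by [green0], and it involves [S] but not [U], so it can be differentiated. *)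
Definition greenR u : 'M[C]_r := a *: (adjmx (1%:M + S0) *m ((circle u)%:M +
  (circle u)^-1 *: S_mx Y (circle u)) - adjmx (z0%:M + z0^-1 *: S0) *m (1%:M + S_mx Y (circle u))).

Lemma circle_rslope : rslope (@circle R) t ('i * z0).
Proof. by have := circle_slope t; apply: rslope_eq => //; rewrite mulrC. Qed.

Lemma circle_inv_rslope : rslope (fun u => (circle u)^-1) t (- ('i * z0^-1)).
Proof.
have := rslope_comp (cslope_inv cz0) circle_rslope; apply: rslope_eq; first by [].
by move: cz0; set z := z0; set I := 'i => z_neq0; field.
Qed.

Lemma greenR_slope : mslope t greenR (a *: (adjmx (1%:M + S0) *m
   (('i * z0)%:M - ('i * z0^-1) *: S0 + z0^-1 *: S_deriv)
   - adjmx (z0%:M + z0^-1 *: S0) *m S_deriv)).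
Proof.
have sz := circle_rslope; have szV := circle_inv_rslope.
have sM : mslope t (fun u => (circle u)%:M : 'M[C]_r) (('i * z0)%:M).
  move=> i j; rewrite mxE.
  have := rslopeM sz (rslope_cst (i == j)%:R t); rewrite mulr0 addr0 mulr_natr.
  by apply: rslope_near; apply: nearW => u; rewrite mxE mulr_natr.
have h1 := mslope_mull (adjmx (1%:M + S0)) (mslopeD sM (mslopeZ szV S_mslope)).
have h2 := mslope_mull (- adjmx (z0%:M + z0^-1 *: S0)) (mslopeD (mslope_cst t 1%:M) S_mslope).
have h3 := mslopeZ (rslope_cst a t) (mslopeD h1 h2).
move=> i j; have := h3 i j.
rewrite scale0r !add0r scaleNr addrA !mulNmx.
by apply: rslope_near; apply: nearW => u; rewrite mulNmx.
Qed.

Lemma U0_gram : adjmx U0 *m U0 = 1%:M + 'i *: (adjmx S0 *m S_deriv) +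
  (z0 - z0^-1)^-1 *: (z0 *: adjmx S0 - z0^-1 *: S0).
Proof.
apply: (green_derivative cz0 zV (circle_conj t) S_unitary).
apply: (can_inj (scalerK a0)); apply/matrixP => i j.
rewrite scalerA [LHS]mxE.
have sx : rslope (fun u => a * (circle u + (circle u)^-1)) t (a * ('i * z0 - 'i * z0^-1)).
  have := rslopeM (rslope_cst a t) (rslopeD circle_rslope circle_inv_rslope).
  by apply: rslope_eq => //=; rewrite mul0r add0r.
have g0 : greenR t i j = 0 by rewrite /greenR green0 subrr scaler0 mxE.
(* [U] is only known to converge, which is enough once the difference of the eigenvalues is divided
   out. *)
apply: (slope_quotient (greenR_slope i j) g0 sx (W := fun u => (adjmx U0 *m U (circle u)) i j)).
  apply: filterS near_S_generic => u [e /U_equations[e1 e2]].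
  have := green (core_mx_sym Y latG) a_real x0_real U0_eq1 U0_eq2 e1 e2.
  by rewrite -e => /(congr1 (fun M : 'M[C]_r => M i j)); rewrite mxE => ->.
exact: (mcvgM FF (@mcvg_cst C R _ FF _ _ (adjmx U0)) U_limit).
Qed.

Lemma conj_toC (x : R) : (toC x : C)^* = toC x.
Proof. by apply: CplxP; rewrite /= ?oppr0. Qed.

Lemma conj_scale (x : R) (u : C) : (toC x * u)^* = toC x * u^*.
Proof.
have e (v w : C) : (v * w)^* = v^* * w^* by exact: rmorphM.
by rewrite e conj_toC.
Qed.

Definition cusp_wave n : 'M[C]_r := (z0 ^+ n)%:M + z0^-1 ^+ n *: S0.

(** The weight [lambda] cancels the growth [a ^ n] of the Eisenstein functions; what is left of the
    scaling are the constants of the two cusps [c] and [c']. *)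
Lemma gramE N c c' : gram Y N s0 c c' = ka c * ka c' *
  (adjmx U0 *m U0 + \sum_(1 <= n < N.+1) adjmx (cusp_wave n) *m cusp_wave n) c c'.
Proof.
rewrite !mxE summxE sum_truncation mulrDr; congr (_ + _).
  rewrite mulr_sumr; apply: eq_bigr => i _; rewrite !eis_core.
  rewrite [adjmx U0 c i]mxE [map_mx _ _ _ _]mxE -(sl_sqr Y latG).
  have s1 := sl_neq0 Y latG (core r i).
  rewrite -!toCV -!toCM conj_scale !toCM !toCV; move: (U0 i c) (U0 i c') => u u'.
  by field.
rewrite mulr_sumr; apply: eq_big_nat => n /andP[n1 _]; rewrite mxE mulr_sumr.
apply: eq_bigr => k _; rewrite !eis_cusp // -(sl_sqr Y latG) sl_cusp //.
have eE j : z0 ^+ n * (k == j)%:R + z0^-1 ^+ n * S_mx Y z0 k j = cusp_wave n k j.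
  by rewrite [RHS]mxE !mxE mulr_natr.
rewrite !eE [adjmx _ c k]mxE [map_mx _ _ _ _]mxE.
have kk := qw_neq0 Y k; have an : a ^+ n != 0 by rewrite expf_neq0.
have -> : a ^+ n * (ka c / ka k) = toC (Num.sqrt q ^+ n * (qw Y c / qw Y k)).
  by rewrite !toCM toCX toCV.
rewrite conj_scale !toCM toCX toCV -/a.
move: (cusp_wave n k c) (cusp_wave n k c') (a ^+ n) an => u u' x an.
by field; rewrite kk an.
Qed.

(** [ka c] is the square root of [(q + 1) * width c], so the normalization removes exactly the
    factor [ka c * ka c']. *)
Lemma normalized_gramE N : normalized_gram Y N t =
  adjmx U0 *m U0 + \sum_(1 <= n < N.+1) adjmx (cusp_wave n) *m cusp_wave n.
Proof.
apply/matrixP => c c'; rewrite /normalized_gram /W_invsqrt mul_mx_diag mul_diag_mx.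
move: (gram _ _ _ _) (gramE N c c') => /= H e.
rewrite mxE [_ c c']mxE [_ c c']mxE gramE; move: (adjmx U0 *m U0 + _) => M; rewrite !mxE.
have q1 : 0 < q + 1 by rewrite ltr_wpDr ?q_gt0.
have wE k : ka k = toC (Num.sqrt (width Y k)) * toC (Num.sqrt (q + 1)).
  by rewrite -rmorphM -sqrtrM // ltW // width_gt0.
have qE : toC (q + 1) = toC (Num.sqrt (q + 1)) * toC (Num.sqrt (q + 1)) :> C.
  by rewrite -rmorphM -expr2 sqr_sqrtr // ltW.
have w0 k : toC (Num.sqrt (width Y k)) != 0 :> C.
  by rewrite fmorph_eq0 lt0r_neq0 // sqrtr_gt0 width_gt0.
have s1 : toC (Num.sqrt (q + 1)) != 0 :> C by rewrite fmorph_eq0 lt0r_neq0 // sqrtr_gt0.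
rewrite !toCV !wE qE; move: (w0 c) (w0 c') s1.
by move: (toC _) (toC _) (toC _) => w w' s h1 h2 h3; field; rewrite h1 h2.
Qed.

Lemma cusp_wave_gram n : adjmx (cusp_wave n) *m cusp_wave n =
  2%:R%:M + (z0 ^+ n) ^+ 2 *: adjmx S0 + (z0^-1 ^+ n) ^+ 2 *: S0.
Proof.
have c1 : (z0 ^+ n)^* = z0^-1 ^+ n by rewrite rmorphXn /= circle_conj.
have c2 : (z0^-1 ^+ n)^* = z0 ^+ n by rewrite -c1 conjCK.
rewrite adjmxD adjmx_scalar adjmxZ c1 c2 !(mulmxDl, mulmxDr).
rewrite -?scalemxAl -?scalemxAr !mul_mx_scalar !mul_scalar_mx S_unitary.
have e : z0 ^+ n * z0^-1 ^+ n = 1 by rewrite -exprMn mulfV // expr1n.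
move: e; move: (z0 ^+ n) (z0^-1 ^+ n) => x y e.
rewrite !scalerA -!expr2 !scale_scalar_mx mulr1 e.
have -> : 2%:R%:M = 1%:M + 1%:M :> 'M[C]_r by rewrite -raddfD.
by rewrite [_ *: adjmx _ + _]addrC addrACA [_ *: S0 + _]addrC addrA.
Qed.

Let kappa : C := (z0 - z0^-1)^-1.

Lemma renormalized_gramE N : renormalized_gram Y N t = time_delay Y t +
  (z0 ^+ 2) ^+ N *: ((kappa * z0) *: adjmx S0) + (z0^-1 ^+ 2) ^+ N *: ((- kappa * z0^-1) *: S0).
Proof.
have zz : z0 - z0^-1 != 0 by rewrite subr_eq0.
rewrite /renormalized_gram normalized_gramE U0_gram.
under eq_bigr do rewrite cusp_wave_gram.
apply/matrixP => i j; rewrite -/(time_delay Y t).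
move: (time_delay Y t) S0 (adjmx S0) cz0 zz => D S T; rewrite /kappa; move: z0 => z z_n0 zz.
rewrite !mxE summxE; under eq_bigr do rewrite !mxE.
have := wave_sum z_n0 zz N (i == j) (T i j) (S i j).
have -> : (2 * N + 1)%:R *+ (i == j) = (2 * N)%:R *+ (i == j) + (i == j)%:R :> C.
  by rewrite natrD mulrnDl.
set x := \sum_(1 <= _ < _) _; set y := (2 * N)%:R *+ (i == j).
move: x y ((i == j)%:R) => x y o.
set w1 := (z - z^-1)^-1 * _; set w2 := _ ^+ N * _; set w3 := _ ^+ N * _ => e.
have -> : x = y + w2 + w3 - w1 by rewrite -e addrC addKr.
by ring.
Qed.

Lemma circle_sqr : [/\ z0 ^+ 2 != 1, z0^-1 ^+ 2 != 1, `|z0 ^+ 2| = 1 & `|z0^-1 ^+ 2| = 1].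
Proof.
have z1 : z0 ^+ 2 != 1.
  apply/eqP => e; move/eqP: zV; apply; apply: (mulfI cz0).
  by rewrite -expr2 e mulfV.
split=> //; first by rewrite exprVn invr_eq1.
- by rewrite normrX norm_circle expr1n.
- by rewrite normrX normfV norm_circle invr1 expr1n.
Qed.

Lemma cesaro_renormalized_gram :
  cesaro_mean (fun N => renormalized_gram Y N t) @ \oo --> time_delay Y t.
Proof.
have [z1 w1 n1 n2] := circle_sqr.
apply: (cesaro_oscillating n1 z1 n2 w1) => N _; exact: renormalized_gramE.
Qed.

End Main.

(** * Traceless parts, determinants and their logarithms *)

Section Traceless.
Variables (R : realType) (r : nat).
Local Notation C := (Cplx R).

Lemma tracelessD (A B : 'M[C]_r) : traceless (A + B) = traceless A + traceless B.
Proof. by rewrite /traceless raddfD mulrDr raddfD opprD addrACA. Qed.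

Lemma tracelessZ k (A : 'M[C]_r) : traceless (k *: A) = k *: traceless A.
Proof.
rewrite /traceless scalerBr scale_scalar_mx; congr (_ - _%:M).
by rewrite linearZ /= mulrCA.
Qed.

Lemma traceless_scalar k : traceless (k%:M : 'M[C]_r) = 0.
Proof.
rewrite /traceless; case: (eqVneq r 0%N) => [r0|r0].
  by apply/matrixP => i; have := ltn_ord i; rewrite {2}r0.
apply/eqP; rewrite subr_eq0 mxtrace_scalar; apply/eqP; congr _%:M.
by rewrite -[k *+ r]mulr_natl mulKf // pnatr_eq0.
Qed.

Lemma traceless_comb x y (A B D : 'M[C]_r) :
  traceless (A + x *: B + y *: D) = traceless A + x *: traceless B + y *: traceless D.
Proof. by rewrite !tracelessD !tracelessZ. Qed.

End Traceless.

Section AutScattering.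
Variables (R : realType) (F : finFieldType) (G : set (pgl F)) (d r : nat).
Variable Y : cusped_quotient R G d r.
Hypothesis latG : is_lattice G.
Local Notation C := (Cplx R).
Local Notation qp := (qpow F (R := R)).
Local Notation zeta s := (qp (s - 2%:R^-1)).
Local Notation ka c := (toC (qw Y c) : C).

(** [S_aut] is continued in [s] and [S_mx] in [z]; the continuation in [z] is pulled back along
    [zeta], whose derivative never vanishes. *)
Lemma S_aut_S (s z : C) i j : zeta s = z -> holomorphic_at (fun w => S_formula Y w i j) z ->
  S_aut Y s i j = (ka i)^-1 * S_mx Y z i j * ka j.
Proof.
move=> <- {z} [l hl]; rewrite !mxE (continuationE hl); apply: continuationE.
have [g [dg eg gl]] := hl.
have c0 : zeta s * toC (ln #|F|%:R) != 0 by apply: mulf_neq0; [exact: zeta_neq0|exact: lnq_neq0].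
have [h1 h2] := comp_near (ka i)^-1 (ka j) (zeta_slope F) c0 dg eg.
exists (fun w => (ka i)^-1 * g (zeta w) * ka j); split; [exact: h1| |by rewrite gl].
have hF := near_F_unit Y s.
by apply: filterS2 hF h2 => w uF e; rewrite -e; exact: S_aut_genericE.
Qed.

End AutScattering.

Section Determinants.
Variables (R : realType) (F : finFieldType) (G : set (pgl F)) (d r : nat).
Variable Y : cusped_quotient R G d r.
Hypothesis latG : is_lattice G.
Variable t : R.
Hypothesis t0 : 0 < t < pi.
Hypothesis hol : holomorphic_point Y t.
Local Notation C := (Cplx R).
Local Notation z0 := (circle t).
Local Notation S0 := (S_mx Y z0).
Local Notation St := (fun u => S_mx Y (circle u)).

Lemma traceless_normalized N :
  traceless (normalized_gram Y N t) = traceless (renormalized_gram Y N t).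
Proof.
rewrite /renormalized_gram tracelessD.
have -> M : traceless (- M%:M : 'M[C]_r) = 0.
  by rewrite -scaleN1r tracelessZ traceless_scalar scaler0.
by rewrite addr0.
Qed.

Lemma det_S0_neq0 : \det S0 != 0.
Proof.
have /(congr1 determinant) := S_unitary latG t0 hol.
rewrite det_mulmx det1 => e; apply/eqP => e0.
by move: e; rewrite e0 mulr0 => /esym/eqP; rewrite oner_eq0.
Qed.

Lemma det_slope : rslope (fun u => \det (St u)) t (\tr (\adj S0 *m S_deriv Y t)).
Proof. exact: rslope_det (S_mslope hol). Qed.

(** By unitarity [adjmx S0] is the inverse of [S0], that is [\adj S0] divided by [\det S0]; the
    trace is then the logarithmic derivative of Jacobi's formula. *)
Lemma trace_time_delay :
  \tr (time_delay Y t) = 'i * (\tr (\adj S0 *m S_deriv Y t) / \det S0).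
Proof.
have uS := S_unitary latG t0 hol; have d0 := det_S0_neq0.
have e : adjmx S0 = (\det S0)^-1 *: \adj S0.
  rewrite -[LHS]mulmx1 -(@mulmxV _ _ S0) ?unitmxE ?unitfE // mulmxA uS mul1mx.
  by rewrite /invmx unitmxE unitfE d0.
rewrite /time_delay -/(S_deriv Y t) e -scalemxAl !linearZ /=.
by rewrite [_^-1 * _]mulrC.
Qed.

Lemma log_slope (f : R -> C) : (\forall u \near nbhs t, \det (St u) = f u) ->
  forall l, local_log f l t -> cderivable l t /\ \tr (time_delay Y t) = 'i * cderive l t.
Proof.
move=> e l hl; have sf := rslope_near e det_slope.
have ft : f t = \det S0 by rewrite -(nbhs_singleton e).
have f0 : f t != 0 by rewrite ft det_S0_neq0.
have [dl el] := rslope_cderive (local_log_slope sf f0 hl).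
by split=> //; rewrite el trace_time_delay ft.
Qed.

Lemma near_holomorphic : \forall u \near nbhs t, forall i j,
  holomorphic_at (fun w => S_formula Y w i j) (circle u).
Proof.
have h : \forall w \near nbhs z0, forall i j, holomorphic_at (fun w => S_formula Y w i j) w.
  apply: filter_forall => i; apply: filter_forall => j.
  by have [_ hS _] := hol; have := hS i j; rewrite circle_zeta; exact: holomorphic_near.
exact: (@cvg_circle R t _ h).
Qed.

(** [local_log] asks for continuity at all angles near [t], so the differentiability of [S] is used
    on a neighbourhood. *)
Lemma near_det_cvg : \forall u \near nbhs t, \det (St x) @[x --> nbhs u] --> \det (St u).
Proof.
have h : \forall w \near nbhs z0, forall i j, derivable (fun w => S_mx Y w i j) w 1.
  apply: filter_forall => i; apply: filter_forall => j.
  have [g [dg _ e]] := S_cont hol i j.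
  have h1 := near_join e; move: dg h1; apply: filterS2 => w dg ew.
  apply: cslope_derivable; apply: (cslope_near _ (derivable_cslope dg)).
  by apply: filterS ew => x ->.
have h' : \forall u \near nbhs t, forall i j, derivable (fun w => S_mx Y w i j) (circle u) 1.
  exact: (@cvg_circle R t _ h).
apply: filterS h' => u du.
have sl i j : rslope (fun x => S_mx Y (circle x) i j) u
    ((\matrix_(i, j) cderive (fun x => S_mx Y (circle x) i j) u) i j).
  have s1 := rslope_comp (derivable_cslope (du i j)) (circle_slope u).
  by rewrite mxE (rslope_cderive s1).2.
exact: rslope_cvg (rslope_det sl).
Qed.

Lemma det_log_exists (f : R -> C) : (\forall u \near nbhs t, \det (St u) = f u) ->
  exists l, local_log f l t.
Proof.
move=> e; apply: local_log_exists; first by rewrite -(nbhs_singleton e) det_S0_neq0.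
have h1 := near_join e; move: near_det_cvg h1; apply: filterS2 => u cu eu.
rewrite -(nbhs_singleton eu); apply: cvg_trans cu; apply: near_eq_cvg.
by apply: filterS eu => x ->.
Qed.

(** At each nearby angle the two matrices are conjugate by a diagonal matrix of square roots of
    widths. *)
Lemma near_det_S_aut : \forall u \near nbhs t, \det (St u) = \det (S_aut Y (s_theta F u)).
Proof.
apply: filterS near_holomorphic => u hu.
pose k := diag_mx (\row_c (toC (qw Y c) : C)).
pose k' := diag_mx (\row_c (toC (qw Y c)^-1 : C)).
have -> : S_aut Y (s_theta F u) = k' *m S_mx Y (circle u) *m k.
  apply/matrixP => i j; rewrite (S_aut_S latG (circle_zeta F u) (hu i j)).
  rewrite mul_mx_diag mul_diag_mx; move: (S_mx Y (circle u)) => M.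
by rewrite !mxE toCV.
have kk : k' *m k = 1%:M.
  apply/matrixP => i j; rewrite mul_diag_mx !mxE.
  by rewrite toCV; case: eqP => [->|_]; rewrite ?mulr0n ?mulr0 // !mulr1n mulVf // qw_neq0.
by rewrite !det_mulmx mulrAC -det_mulmx kk det1 mul1r.
Qed.

Lemma cusped_quotient_scattering :
     [/\ (forall i j, cderivable (fun u => S_mx Y (circle u) i j) t) /\
         cesaro_mean (fun N => renormalized_gram Y N t) @ \oo
           --> time_delay Y t,
         (exists l, local_log (fun u => \det (S_mx Y (circle u))) l t) /\
         (forall l, local_log (fun u => \det (S_mx Y (circle u))) l t ->
            cderivable l t /\
            \tr (time_delay Y t) = 'i * cderive l t),
         (exists l, local_log (fun u => \det (S_aut Y (s_theta F u))) l t) /\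
         (forall l, local_log (fun u => \det (S_aut Y (s_theta F u))) l t ->
            cderivable l t /\
            \tr (time_delay Y t) = 'i * cderive l t) &
         cesaro_mean (fun N => traceless (normalized_gram Y N t)) @ \oo
           --> traceless (time_delay Y t)].
Proof.
have e1 : \forall u \near nbhs t, \det (St u) = \det (St u) by exact: nearW.
split.
- by split; [move=> i j; exact: S_cderivable|exact: cesaro_renormalized_gram].
- by split; [exact: det_log_exists|exact: log_slope].
- by split; [exact: (det_log_exists near_det_S_aut)|exact: (log_slope near_det_S_aut)].
have [z1 w1 n1 n2] := circle_sqr t0.
apply: (cesaro_oscillating n1 z1 n2 w1) => N _.
rewrite traceless_normalized (renormalized_gramE latG t0 hol).
exact: traceless_comb.
Qed.

End Determinants.

(** * A congruence subgroup over the field of two elements *)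

Section Valuation.
Variables (F : finFieldType) (K : fieldType) (V : dvfield F K).
Local Notation X := (vX V).
Local Notation O := (vO V).
Local Notation KC := (vC V).
Implicit Types (x y c : K) (p : {poly F}) (n : int).

Let X0 : X != 0 := vX_neq0 V.

Definition unitO x := [/\ x != 0, O x & O x^-1].

Lemma unitOM x y : unitO x -> unitO y -> unitO (x * y).
Proof.
by move=> [x0 hx hx'] [y0 hy hy']; split; rewrite ?mulf_neq0 ?invfM //; exact: vOM.
Qed.

Lemma unitOV x : unitO x -> unitO x^-1.
Proof. by move=> [x0 hx hx']; split; rewrite ?invr_eq0 ?invrK. Qed.

Lemma unitO_X x : unitO x -> ~ O (X^-1 * x).
Proof.
move=> [x0 hx hx'] h; apply: (@vXinvN _ _ V).
by rewrite -[X^-1](mulfK x0); exact: vOM.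
Qed.

Lemma unitO_add x y : unitO x -> O y -> unitO (x + X * y).
Proof.
move=> ux hy; have [x0 hx hx'] := ux.
have hs : O (x + X * y) by apply: vOD => //; apply: vOM => //; exact: vOX.
case: (vO_unit_or hs) => [[s0 hs']|[z hz e]]; first by split.
have xE : X^-1 * x = z - y by rewrite -[x](addrK (X * y)) e -mulrBr mulKf.
by case: (unitO_X ux); rewrite xE; exact: vOB.
Qed.

Lemma unitO_C (c : F) : c != 0 -> unitO (KC c).
Proof. by move=> c0; split; [rewrite fmorph_eq0|exact: vOC|exact: KC_unit]. Qed.

Lemma X_unitO n x : unitO x -> O (X ^ n * x) <-> 0 <= n.
Proof.
move=> ux; have [x0 hx hx'] := ux; split=> [h|/vO_Xz h]; last exact: vOM.
by apply/(vO_Xz V); rewrite -[X ^ n](mulfK x0); exact: vOM.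
Qed.

Lemma unitO_repr x : x != 0 -> exists n u, unitO u /\ x = X ^ n * u.
Proof.
move=> x0; have [n [u [hu hu' e]]] := v_repr V x0; exists n, u; split=> //; split=> //.
by apply: contraNneq x0 => u0; rewrite e u0 mulr0.
Qed.

(** In the second case [x^-1] lies in the maximal ideal [X O], which is sharper than the usual
    alternative for valuation rings. *)
Lemma O_total x : O x \/ x != 0 /\ O (X^-1 * x^-1).
Proof.
have [->|x0] := eqVneq x 0; first by left; exact: vO0.
have [n [u [uu ->]]] := unitO_repr x0.
case: (leP 0 n) => hn; first by left; apply/X_unitO.
right; split=> //.
rewrite invfM invr_expz mulrA.
have -> : X^-1 * X ^ (- n) = X ^ (- n - 1) by rewrite expfzDr // mulrC.
by apply/(X_unitO _ (unitOV uu)); lia.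
Qed.

Lemma O_large x : exists N : nat, O (X ^+ N * x).
Proof.
have [->|x0] := eqVneq x 0; first by exists 0%N; rewrite mulr0; exact: vO0.
have [n [u [uu ->]]] := unitO_repr x0; exists `|n|%N.
by rewrite exprnP mulrA -expfzDr //; apply/(X_unitO _ uu); lia.
Qed.

Lemma O_sqr x : O (x ^+ 2) -> O x.
Proof.
case: (O_total x) => // -[x0 h] h2.
case: (@vXinvN _ _ V); have -> : X^-1 = x ^+ 2 * (X^-1 * x^-1) * (X * (X^-1 * x^-1)).
  by field; rewrite X0 x0.
by apply: vOM; apply: vOM => //; exact: vOX.
Qed.

(* [K] contains [F[t]], with [t = X^-1]. *)
Definition ev p : K := (map_poly KC p).[X^-1].

Lemma ev_is_additive : {morph ev : p q / p - q}.
Proof. by move=> p q; rewrite /ev rmorphB hornerD hornerN. Qed.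
HB.instance Definition _ := GRing.isAdditive.Build {poly F} K ev ev_is_additive.
Lemma ev_is_multiplicative : multiplicative ev.
Proof.
by split=> [p q|]; rewrite /ev ?rmorphM ?rmorph1 ?hornerM ?hornerC.
Qed.
HB.instance Definition _ := GRing.isMultiplicative.Build {poly F} K ev ev_is_multiplicative.

Lemma evC (c : F) : ev c%:P = KC c.
Proof. by rewrite /ev map_polyC hornerC. Qed.

Lemma evX : ev 'X = X^-1.
Proof. by rewrite /ev map_polyX hornerX. Qed.

(** The valuation of a polynomial in [t = X^-1] is minus its degree. Integrality of matrix entries
    thereby becomes a bound on degrees. *)
Lemma ev_unit p : p != 0 -> unitO (X ^+ (size p).-1 * ev p).
Proof.
elim/poly_ind: p => [|p c IH]; first by rewrite eqxx.
rewrite size_MXaddC rmorphD rmorphM /= evX evC; case: (eqVneq p 0) => [->|p0] /=.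
  rewrite size_poly0 rmorph0 !mul0r !add0r polyC_eq0.
  by case: eqVneq => // c0 _; rewrite expr0 mul1r; exact: unitO_C.
move=> _; have h := IH p0.
have sp : (size p).-1.+1 = size p by rewrite prednK // size_poly_gt0.
have -> : X ^+ size p * (ev p / X + KC c) = X ^+ (size p).-1 * ev p + X * (X ^+ (size p).-1 * KC c).
  by rewrite -sp exprS /=; field.
apply: unitO_add => //; apply: vOM; last exact: vOC.
by apply: vOXn; exact: vOX.
Qed.

Lemma ev_eq0 p : (ev p == 0) = (p == 0).
Proof.
apply/eqP/eqP => [e|->]; last by rewrite rmorph0.
apply/eqP/negPn/negP => p0; case: (ev_unit p0).
by rewrite e mulr0 eqxx.
Qed.

Lemma ev_inj : injective ev.
Proof. by move=> p q e; apply/eqP; rewrite -subr_eq0 -ev_eq0 rmorphB /= e subrr. Qed.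

Lemma ev_O n p : O (X ^ n * ev p) <-> p = 0 \/ ((size p)%:Z <= n + 1).
Proof.
have [->|p0] := eqVneq p 0.
  by rewrite rmorph0 mulr0; split; [left|move=> _; exact: vO0].
have u := ev_unit p0; have s0 : (0 < size p)%N by rewrite size_poly_gt0.
have -> : X ^ n * ev p = X ^ (n - (size p).-1%:Z) * (X ^+ (size p).-1 * ev p).
  by rewrite mulrA [X ^+ _]exprnP -expfzDr // subrK.
split=> [/X_unitO h|[/eqP|h]]; last by apply/(X_unitO _ u); lia.
  by right; have := h u; lia.
by rewrite (negbTE p0).
Qed.

Lemma ev_O0 p : O (ev p) <-> p = (p`_0)%:P.
Proof.
rewrite -[ev p]mul1r -[1](expr0z X) ev_O; split=> [[->|]|->].
- by rewrite coef0.
- by rewrite add0r => h; apply: size1_polyC.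
- by right; rewrite add0r lez_nat size_polyC; case: (_ != 0).
Qed.

End Valuation.

Section Vertices.
Variables (F : finFieldType) (K : fieldType) (V : dvfield F K).
Local Notation X := (vX V).
Local Notation O := (vO V).
Local Notation ev := (ev V).
Local Notation MO := (MO V).
Local Notation cls := (cls V).
Implicit Types (B N : 'M[K]_2) (n m : int) (g : 'M[{poly F}]_2).

Let X0 : X != 0 := vX_neq0 V.

(** Equal determinants make the square of the homothety factor integral, hence the factor itself,
    and it can be absorbed. Conversely an integral matrix of determinant 1 has an integral
    inverse. *)
Lemma cls_eq_det B B' : B \in unitmx -> \det B = \det B' ->
  cls B = cls B' <-> MO (invmx B *m B').
Proof.
move=> uB dB; have uB' : B' \in unitmx by rewrite unitmxE -dB -unitmxE.
have d0 : \det B' != 0 by rewrite -unitfE -unitmxE.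
split=> [/cls_eq[c c0 /lat_eq[]]|h].
- by rewrite unitmxZr.
- by [].
- move=> h1 h2; have Oc : O c.
    apply: O_sqr; have -> : c ^+ 2 = \det (invmx B' *m (c *: B)).
      by rewrite -scalemxAr detZ det_mulmx det_inv dB mulVf ?mulr1.
    by rewrite [_ *m _]mx2_eta det_mx2; apply: vOB; apply: vOM; exact: h2.
  have -> : invmx B *m B' = c *: (invmx (c *: B) *m B').
    by rewrite invmxZ ?unitmxZr // -scalemxAl scalerA mulfV // scale1r.
  exact: MOZ.
apply: cls_lat; apply/lat_eq => //; split=> //.
have u : invmx B *m B' \in unitmx by rewrite unitmx_mul unitmx_inv uB.
have -> : invmx B' *m B = invmx (invmx B *m B').
  by apply: (can_inj (mulKmx u)); rewrite mulmxV // -mulmxA mulKVmx // mulVmx.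
by apply: MO_invmx => //; rewrite det_mulmx det_inv dB mulVf // invr1; exact: vO1.
Qed.

Lemma cls_mulr B P : B \in unitmx -> P \in unitmx -> MO P -> MO (invmx P) -> cls (B *m P) = cls B.
Proof.
move=> uB uP h h'; apply/esym/cls_lat/lat_eq; rewrite ?unitmx_mul ?uB //.
split; first by rewrite mulKmx.
have -> : invmx (B *m P) = invmx P *m invmx B.
  have u : B *m P \in unitmx by rewrite unitmx_mul uB.
  by apply: (can_inj (mulKmx u)); rewrite mulmxV // -mulmxA mulKVmx // mulmxV.
by rewrite -mulmxA mulVmx // mulmx1.
Qed.

Lemma nbr_inj B : B \in unitmx -> injective (fun p => cls (B *m nbr_mx V p)).
Proof.
move=> uB p p' e.
have u1 s : B *m nbr_mx V s \in unitmx by rewrite unitmx_mul uB nbr_mx_unit.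
move: e => /cls_eq_det; rewrite !det_mulmx !det_nbr_mx => /(_ (u1 p) erefl).
have -> : invmx (B *m nbr_mx V p) *m (B *m nbr_mx V p') =
    X^-1 *: ((X *: invmx (nbr_mx V p)) *m nbr_mx V p').
  rewrite -scalemxAl scalerA mulVf // scale1r; apply: (can_inj (mulKmx (u1 p))).
  by rewrite mulKVmx // -mulmxA mulKVmx // nbr_mx_unit.
rewrite Xinv_nbr; case: p p' => [c|] [c'|] //=; rewrite mulmx2 scalemx2 => /MO2P[].
- rewrite !(mul1r, mulr1) => _ + _ _; rewrite -rmorphB => h; congr Some; apply/eqP; rewrite eq_sym -subr_eq0.
  apply/negPn/negP => c0; apply: (unitO_X (unitO_C V c0)).
  exact: h.
- by rewrite mul1r mulr0 addr0 mulr1 => /vXinvN.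
- by rewrite !(mul0r, mulr0, add0r, addr0, mulr1) => _ _ _ /vXinvN.
Qed.

Definition apt n : 'M[K]_2 := mx2 1 0 0 (X ^ n).

Lemma apt_unit n : apt n \in unitmx.
Proof. by rewrite unitmxE det_mx2 mul1r mulr0 subr0 unitfE expfz_neq0. Qed.

Lemma invmx_apt n : invmx (apt n) = mx2 1 0 0 (X ^ (- n)).
Proof.
apply: (can_inj (mulKmx (apt_unit n))); rewrite mulmxV ?apt_unit // mulmx2 mx2_scalar.
by congr mx2; rewrite !(mulr0, mul0r, addr0, add0r, mulr1) // -expfzDr // subrr.
Qed.

Lemma apt_nbr_None n : cls (apt n *m nbr_mx V None) = cls (apt (n + 1)).
Proof.
congr cls; rewrite mulmx2; congr mx2; rewrite !(mulr0, mul0r, addr0, add0r, mulr1) //.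
by rewrite expfzDr.
Qed.

Lemma apt_nbr_0 n : cls (apt n *m nbr_mx V (Some 0)) = cls (apt (n - 1)).
Proof.
rewrite -(cls_scale V (apt (n - 1)) X0); congr cls; rewrite mulmx2 scalemx2.
congr mx2; rewrite !(mulr0, mul0r, addr0, add0r, mulr1, mul1r) ?rmorph0 //.
by rewrite expfzDr // mulrCA mulfV ?mulr1.
Qed.

(** The left matrix is [X] times the upper unipotent with entry [c t^n] times [apt (n - 1)]. So for
    [n >= 0] unipotents fold the [q] neighbours [Some c] onto one vertex. *)
Lemma apt_nbr_pos n (c : F) : (0 <= n)%R -> cls (apt n *m nbr_mx V (Some c)) =
  cls (mx2 1 (ev (c *: 'X^`|n|)) 0 1 *m apt (n - 1)).
Proof.
move=> n0; rewrite -[in RHS](cls_scale V _ X0); congr cls.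
have XnK : X * X ^ (n - 1) = X ^ n by rewrite expfzDr // mulrCA mulfV ?mulr1.
rewrite !mulmx2 !scalemx2; congr mx2; rewrite !(mulr0, mul0r, addr0, add0r, mulr1, mul1r) //.
rewrite mulrCA XnK -mul_polyC rmorphM rmorphXn /= evX evC exprVn -mulrA.
by rewrite -{2}(gez0_abs n0) mulVf ?mulr1 // expf_neq0.
Qed.

(** As [n < 0], the entry [c^-1 t^|n|] is divisible by [t], so the lower unipotent lies in the
    congruence subgroup; such matrices fold the neighbours with [c != 0] onto [apt (n + 1)]. *)
Lemma apt_nbr_neg n (c : F) : n < 0 -> c != 0 -> cls (apt n *m nbr_mx V (Some c)) =
  cls (mx2 1 0 (ev (c^-1 *: 'X^`|n|)) 1 *m apt (n + 1)).
Proof.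
move=> n0 c0; have u := apt_unit n.
have uB : apt n *m nbr_mx V (Some c) \in unitmx by rewrite unitmx_mul u nbr_mx_unit.
have KC0 : vC V c != 0 by rewrite fmorph_eq0.
have XnE : ev (c^-1 *: 'X^`|n|) = (vC V c)^-1 * X ^ n.
  rewrite -mul_polyC rmorphM rmorphXn /= evX evC exprVn fmorphV exprnN.
  by congr (_ * _ ^ _); lia.
apply/cls_eq_det => //.
  by rewrite !det_mulmx !det_mx2 expfzDr // expr1z; ring.
(* The last factor on the right is integral of determinant 1, so it does not change the class. *)
have -> : mx2 1 0 (ev (c^-1 *: 'X^`|n|)) 1 *m apt (n + 1) =
    (apt n *m nbr_mx V (Some c)) *m mx2 0 (- vC V c) (vC V c)^-1 X.
  by rewrite XnE !mulmx2 expfzDr // expr1z; congr mx2; field.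
rewrite mulKmx //; apply/MO2P; split; [exact: vO0|apply: vON; exact: vOC| |exact: vOX].
exact: KC_unit.
Qed.

Definition evM g : 'M[K]_2 := map_mx ev g.

Lemma evM_mx2 a b c d : evM (mx2 a b c d) = mx2 (ev a) (ev b) (ev c) (ev d).
Proof. by rewrite [LHS]mx2_eta !mxE. Qed.

Lemma MO_conj_apt (a b c d : K) m n : MO (invmx (apt n) *m (mx2 a b c d *m apt m)) <->
  [/\ O a, O (X ^ m * b), O (X ^ (- n) * c) & O (X ^ (m - n) * d)].
Proof.
rewrite invmx_apt !mulmx2 !(mulr0, mul0r, addr0, add0r, mulr1, mul1r) MO2P.
by rewrite [b * _]mulrC [d * _]mulrC mulrA -expfzDr // [- n + m]addrC.
Qed.

(* Otherwise a diagonal entry vanishes, and the lower left entry is a unit. *)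
Lemma apt_inequiv (a b c d : {poly F}) m n : a * d - b * c = 1 -> c`_0 = 0 ->
  cls (evM (mx2 a b c d) *m apt m) = cls (apt n) -> m = n.
Proof.
move=> det1 c0; rewrite evM_mx2; set g := mx2 _ _ _ _ => e.
have dg : \det g = 1.
  by rewrite det_mx2 -!rmorphM -rmorphB det1 rmorph1.
have ug : g *m apt m \in unitmx by rewrite unitmx_mul apt_unit unitmxE dg unitr1.
have nbc : ~ (a = 0 \/ d = 0).
  move=> ad; have bc : - (b * c) = 1.
    by rewrite -det1; case: ad => ->; rewrite ?mul0r ?mulr0 sub0r.
  move: (congr1 (fun p : {poly F} => p`_0) bc).
  by rewrite coefN coef0M c0 mulr0 oppr0 coef1 => /esym/eqP; rewrite oner_eq0.
have MO_det (M : 'M[K]_2) : MO M -> O (\det M).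
  by move=> h; rewrite [M]mx2_eta det_mx2; apply: vOB; apply: vOM; exact: h.
move: e => /esym/cls_eq[k k0 /lat_eq[]] //; first by rewrite unitmxZr // apt_unit.
move=> h1 h2; have := MO_det _ h2; have := MO_det _ h1; move: h1 {h2}.
rewrite !det_mulmx !det_inv !detZ det_mulmx dg mul1r !det_mx2 !mul1r !mulr0 !subr0 invmxZ;
  last by rewrite unitmxZr // apt_unit.
rewrite -scalemxAl /g => h1.
have k'0 : k^-1 != 0 by rewrite invr_eq0.
(* Let [j] be the valuation of [k^-1]. The determinants give [2 j = n - m], and the degrees of [a]
   and [d] are at most [j] and [- j]; as neither polynomial vanishes, [j = 0]. *)
have [j [u [uu kE]]] := unitO_repr V k'0.
have u2 : unitO V (u ^+ 2) by rewrite expr2; exact: unitOM.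
have u0 : u != 0 by case: uu.
have -> : (k ^+ 2 * X ^ n)^-1 * X ^ m = X ^ (2 * j + m - n) * u ^+ 2.
  rewrite -[k]invrK kE mulrC mul2z !expfzDr // -invr_expz.
  by field; rewrite ?u0 ?expfz_neq0.
have -> : (X ^ m)^-1 * (k ^+ 2 * X ^ n) = X ^ (n - m - 2 * j) * (u ^+ 2)^-1.
  rewrite -[k]invrK kE mulrC mul2z opprD !expfzDr // -!invr_expz.
  by field; rewrite ?u0 ?expfz_neq0.
move=> /(X_unitO _ u2) hd /(X_unitO _ (unitOV u2)) hd'.
move: h1; rewrite invmx_apt !mulmx2 !(mulr0, mul0r, addr0, add0r, mulr1, mul1r) scalemx2.
rewrite kE => /MO2P[ha _ _ hd2].
have size_gt0 (p : {poly F}) : p <> 0 -> (0 < size p)%N by move/eqP; rewrite size_poly_gt0.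
have ha' : O (X ^ j * ev a).
  have -> : X ^ j * ev a = X ^ j * u * ev a * u^-1 by field.
  by apply: vOM => //; case: uu.
have hd3 : O (X ^ (- j) * ev d).
  have -> : X ^ (- j) = X ^ j * X ^ (m - n) by rewrite -expfzDr //; congr (_ ^ _); lia.
  have -> : X ^ j * X ^ (m - n) * ev d = X ^ j * u * (X ^ (- n) * (ev d * X ^ m)) * u^-1.
    by rewrite expfzDr //; field.
  by apply: vOM => //; case: uu.
move: ha' hd3 => /ev_O[a0|ha'] /ev_O[d0|hd3]; try by case: nbc; auto.
have sa : (0 < size a)%N by apply: size_gt0 => e; apply: nbc; left.
have sd : (0 < size d)%N by apply: size_gt0 => e; apply: nbc; right.
lia.
Qed.

Definition Gamma0 : set 'M[{poly F}]_2 := [set g : 'M[{poly F}]_2 | \det g = 1 /\ (g 1 0 : {poly F})`_0 = 0].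

Lemma Gamma0_mx2 a b c d : Gamma0 (mx2 a b c d) <-> a * d - b * c = 1 /\ c`_0 = 0.
Proof. by rewrite /Gamma0 /= det_mx2 mx2E. Qed.

Lemma Gamma0_1 : Gamma0 1%:M.
Proof. by rewrite mx2_scalar; apply/Gamma0_mx2; rewrite !mul0r mulr1 subr0 coef0. Qed.

Lemma Gamma0M g h : Gamma0 g -> Gamma0 h -> Gamma0 (g *m h).
Proof.
rewrite [g]mx2_eta [h]mx2_eta.
move: (g 0 0) (g 0 1) (g 1 0) (g 1 1) (h 0 0) (h 0 1) (h 1 0) (h 1 1) => a b c d a' b' c' d'.
move=> /Gamma0_mx2[e c0] /Gamma0_mx2[e' c0']; rewrite mulmx2; apply/Gamma0_mx2; split.
  by rewrite -[RHS]mulr1 -{1}e -e'; ring.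
by rewrite coefD !coef0M c0 c0' mul0r mulr0 addr0.
Qed.

Lemma Gamma0V g : Gamma0 g -> Gamma0 (invmx g).
Proof.
rewrite [g]mx2_eta; move: (g 0 0) (g 0 1) (g 1 0) (g 1 1) => a b c d.
move=> /Gamma0_mx2[e c0]; rewrite invmx2 ?e ?unitr1 // invr1 scale1r.
apply/Gamma0_mx2; rewrite coefN c0 oppr0; split=> //.
by rewrite -e; ring.
Qed.

Lemma Gamma0_unit g : Gamma0 g -> g \in unitmx.
Proof. by move=> [e _]; rewrite unitmxE e unitr1. Qed.

Lemma evMM g h : evM (g *m h) = evM g *m evM h.
Proof. exact: map_mxM. Qed.

Lemma evM1 : evM 1%:M = 1%:M.
Proof. exact: map_mx1. Qed.

Lemma evM_unit g : g \in unitmx -> evM g \in unitmx.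
Proof. by rewrite !unitmxE det_map_mx; exact: rmorph_unit. Qed.

Lemma evM_inv g : g \in unitmx -> evM (invmx g) = invmx (evM g).
Proof.
move=> ug; have u := evM_unit ug; apply: (can_inj (mulKmx u)).
by rewrite -evMM !mulmxV // evM1.
Qed.

Lemma cls_mull (h B B' : 'M[K]_2) : cls B = cls B' -> cls (h *m B) = cls (h *m B').
Proof. by move=> e; rewrite -!(act_cls V) e. Qed.

Definition in_apt_orbit B := exists g n, Gamma0 g /\ cls B = cls (evM g *m apt n).

Lemma apt_nbr_orbit n p : in_apt_orbit (apt n *m nbr_mx V p).
Proof.
case: p => [c|]; last first.
  by exists 1%:M, (n + 1); split; [exact: Gamma0_1|rewrite evM1 mul1mx apt_nbr_None].
have [->|c0] := eqVneq c 0.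
  by exists 1%:M, (n - 1); split; [exact: Gamma0_1|rewrite evM1 mul1mx apt_nbr_0].
case: (leP 0 n) => n0.
  exists (mx2 1 (c *: 'X^`|n|) 0 1), (n - 1); split.
    by apply/Gamma0_mx2; rewrite mulr0 mulr1 subr0 coef0.
  by rewrite evM_mx2 !rmorph1 rmorph0 apt_nbr_pos.
exists (mx2 1 0 (c^-1 *: 'X^`|n|) 1), (n + 1); split.
  apply/Gamma0_mx2; rewrite mul0r mulr1 subr0 coefZ coefXn; split=> //.
  by have -> : (0 == `|n|)%N = false; [lia|rewrite mulr0].
by rewrite evM_mx2 !rmorph1 rmorph0 apt_nbr_neg.
Qed.

(** The neighbours of a translate of [apt n] are the translates of its neighbours, so the union of
    these orbits is closed under adjacency. *)
Lemma nbr_orbit B p : B \in unitmx -> in_apt_orbit B -> in_apt_orbit (B *m nbr_mx V p).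
Proof.
move=> uB [g [n [Gg e]]].
have uD : evM g *m apt n \in unitmx by rewrite unitmx_mul apt_unit evM_unit // Gamma0_unit.
have : [set cls (B *m nbr_mx V p) | p in [set: option F]] (cls (B *m nbr_mx V p)) by exists p.
rewrite -adj_clsP // e adj_clsP // => -[p' _ ep].
have [g' [n' [Gg' e']]] := apt_nbr_orbit n p'.
exists (g *m g'), n'; split; first exact: Gamma0M.
by rewrite -ep -mulmxA evMM -mulmxA; exact: cls_mull.
Qed.

(** For a very negative exponent a column operation over [O] removes [x], and the class lies on the
    apartment. Raising the exponent by one is a step to the neighbour [Some 0], so the property
    travels along the line up to [m]. *)
Lemma line_orbit m x : in_apt_orbit (mx2 (X ^ m) x 0 1).
Proof.
have [N hN] := O_large V x.
(* Adding [|m|] puts the starting exponent [- M] below [m]. *)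
have : O (X ^+ (N + `|m|) * x).
  by rewrite addnC exprD -mulrA; apply: vOM => //; apply: vOXn; exact: vOX.
set M := (N + `|m|)%N => hM; pose m0 : int := - M%:Z.
have [k ->] : exists k : nat, m = m0 + k.
  by exists `|(m - m0)%R|%N; rewrite /m0 /M; lia.
have u n : mx2 (X ^ n) x 0 1 \in unitmx by rewrite unitmxE det_mx2 mulr1 mulr0 subr0 unitfE expfz_neq0.
elim: k => [|k IH].
  exists 1%:M, M%:Z; split; first exact: Gamma0_1.
  rewrite evM1 mul1mx addr0 -(cls_scale V (apt M) (expfz_neq0 m0 X0)) scalemx2.
  have -> : mx2 (X ^ m0) x 0 1 = mx2 (X ^ m0) 0 0 1 *m mx2 1 (X ^+ M * x) 0 1.
    rewrite mulmx2; congr mx2; rewrite ?(mulr0, mul0r, addr0, add0r, mulr1) //.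
    by rewrite /m0 mulrA exprnP -expfzDr // addNr mul1r.
  have uP : mx2 1 (X ^+ M * x) 0 1 \in unitmx by rewrite unitmxE det_mx2 mulr1 mulr0 subr0 unitr1.
  have MP : MO (mx2 1 (X ^+ M * x) 0 1) by apply/MO2P; split=> //; [exact: vO1|exact: vO0|exact: vO1].
  rewrite cls_mulr //; last first.
  - by apply: MO_invmx => //; rewrite det_mx2 mulr1 mulr0 subr0 invr1; exact: vO1.
  - by rewrite unitmxE det_mx2 mulr1 mulr0 subr0 unitfE expfz_neq0.
  by congr cls; congr mx2; rewrite ?mulr0 ?mulr1 // -expfzDr // addNr.
have -> : mx2 (X ^ (m0 + k.+1)) x 0 1 = mx2 (X ^ (m0 + k)) x 0 1 *m nbr_mx V (Some 0).
  rewrite mulmx2; congr mx2; rewrite ?(mulr0, mul0r, addr0, add0r, mulr1, mul1r) //.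
    by rewrite -[k.+1]addn1 PoszD addrA [in LHS]expfzDr.
  by rewrite rmorph0 mulr0 add0r.
exact: nbr_orbit.
Qed.

(** Column operations over [O]: the lower row is cleared against its entry of smaller valuation,
    after exchanging the columns if necessary, and the class is rescaled to make that entry 1. *)
Lemma iwasawa B : B \in unitmx -> exists m x, cls B = cls (mx2 (X ^ m) x 0 1).
Proof.
suff key (a b c d : K) : a * d - b * c != 0 -> d != 0 -> O (d^-1 * c) ->
    exists m x, cls (mx2 a b c d) = cls (mx2 (X ^ m) x 0 1).
  rewrite [B]mx2_eta; move: (B 0 0) (B 0 1) (B 1 0) (B 1 1) => a b c d.
  rewrite unitmxE det_mx2 unitfE => D.
  have swap : cls (mx2 a b c d) = cls (mx2 b a d c).
    have -> : mx2 b a d c = mx2 a b c d *m mx2 0 1 1 0.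
      by rewrite mulmx2; congr mx2; ring.
    have MP : MO (mx2 0 1 1 0) by apply/MO2P; split; (exact: vO0 || exact: vO1).
    have uP : mx2 0 1 1 0 \in @unitmx K _.
      by rewrite unitmxE det_mx2 mul0r mul1r sub0r unitfE oppr_eq0 oner_eq0.
    have uM : mx2 a b c d \in unitmx by rewrite unitmxE det_mx2 unitfE.
    rewrite cls_mulr //.
    apply: MO_invmx => //; rewrite det_mx2 mul0r mul1r sub0r invrN invr1.
    by apply: vON; exact: vO1.
  have D' : b * c - a * d != 0 by rewrite -oppr_eq0 opprB.
  have [d0|d0] := eqVneq d 0.
    rewrite swap; apply: key => //; last by rewrite d0 mulr0; exact: vO0.
    by apply: contraNneq D => ->; rewrite d0 !mulr0 subrr.
  case: (O_total V (d^-1 * c)) => [h|[h0 h]]; first exact: key.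
  rewrite swap; apply: key => //; first by move: h0; rewrite mulf_eq0 negb_or => /andP[].
  have -> : c^-1 * d = X * (X^-1 * (d^-1 * c)^-1) by rewrite mulVKf // invfM invrK mulrC.
  by apply: vOM => //; exact: vOX.
move=> D d0 h.
have a'0 : a - b * (d^-1 * c) != 0.
  apply: contraNneq D => e; have -> : a * d - b * c = (a - b * (d^-1 * c)) * d by field.
  by rewrite e mul0r.
have [m [u [uu e]]] := unitO_repr V (mulf_neq0 (invr_neq0 d0) a'0).
have [u0 hu hu'] := uu.
exists m, (d^-1 * b).
have uC : mx2 a b c d \in unitmx by rewrite unitmxE det_mx2 unitfE.
rewrite -(@cls_mulr _ (mx2 u^-1 0 (- (d^-1 * c) * u^-1) 1)) //.
- rewrite -(cls_scale V _ (invr_neq0 d0)) mulmx2 scalemx2; congr cls; congr mx2.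
  + have -> : X ^ m = X ^ m * u / u by rewrite mulfK.
    by rewrite -e; ring.
  + by ring.
  + by field; rewrite ?d0 ?u0.
  + by field.
- by rewrite unitmxE det_mx2 mul0r subr0 mulr1 unitfE invr_eq0.
- apply/MO2P; split=> //; [exact: vO0| |exact: vO1].
  by apply: vOM => //; exact: vON.
apply: MO_invmx; rewrite ?unitmxE ?det_mx2 ?mul0r ?subr0 ?mulr1 ?invrK ?unitfE ?invr_eq0 //.
apply/MO2P; split=> //; [exact: vO0| |exact: vO1].
by apply: vOM => //; exact: vON.
Qed.

Lemma apt_orbits B : B \in unitmx -> in_apt_orbit B.
Proof.
move=> /iwasawa[m [x e]]; have [g [n [Gg e']]] := line_orbit m x.
by exists g, n; rewrite e.
Qed.

End Vertices.

(** * Stabilizers along the apartment *)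

Section Stabilizers.
Variables (F : finFieldType) (K : fieldType) (V : dvfield F K).
Hypothesis F2 : forall c : F, c = 0 \/ c = 1.
Local Notation X := (vX V).
Local Notation O := (vO V).
Local Notation ev := (ev V).
Local Notation evM := (evM V).
Local Notation apt := (apt V).
Local Notation cls := (cls V).
Implicit Types (n m : int) (g : 'M[{poly F}]_2).

(** The largest degree of the free polynomial in the stabilizer of [apt n]. On the negative side it
    is [|n| - 1], because the entry is [t] times that polynomial and has degree at most [|n|]. *)
Definition apt_index n : nat := match n with Posz k => k | Negz k => k end.

Definition stab_mx n (v : 'rV[F]_(apt_index n).+1) : 'M[{poly F}]_2 :=
  if 0 <= n then mx2 1 (rVpoly v) 0 1 else mx2 1 0 ('X * rVpoly v) 1.

Lemma stab_mx_inj n : injective (@stab_mx n).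
Proof.
move=> v w; rewrite /stab_mx; case: ifP => _ /mx2_inj[_ e1 e2 _].
  by apply: (can_inj rVpolyK).
apply: (can_inj rVpolyK); apply: (@mulfI _ 'X); [rewrite polyX_eq0 //|exact: e2].
Qed.

Lemma apt_index_ge0 n : 0 <= n -> apt_index n = n :> int.
Proof. by case: n. Qed.

Lemma apt_index_lt0 n : (0 <= n) = false -> (apt_index n).+1 = - n :> int.
Proof. by case: n => // k _; rewrite NegzE opprK. Qed.

Lemma X_factor (p : {poly F}) : p`_0 = 0 -> exists s, p = 'X * s.
Proof.
elim/poly_ind: p => [|p c _]; first by exists 0; rewrite mulr0.
rewrite coefD coefMX coefC /= add0r => ->; exists p.
by rewrite polyC0 addr0 mulrC.
Qed.

Lemma Gamma0_stab_mx n (v : 'rV[F]_(apt_index n).+1) : Gamma0 (stab_mx v).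
Proof.
rewrite /stab_mx; case: ifP => _; apply/Gamma0_mx2.
  by rewrite mulr0 mulr1 subr0 coef0.
by rewrite mul0r mulr1 subr0 coefXM.
Qed.

Lemma rVpoly_exists k (p : {poly F}) : (size p <= k)%N -> exists v : 'rV[F]_k, p = rVpoly v.
Proof. by move=> h; exists (poly_rV p); rewrite poly_rV_K. Qed.

Lemma size_rVpoly k (v : 'rV[F]_k) : (size (rVpoly v) <= k)%N.
Proof. exact: size_poly. Qed.

Lemma apt_fixE a b c d n : a * d - b * c = 1 ->
  cls (evM (mx2 a b c d) *m apt n) = cls (apt n) <->
  [/\ O (ev a), O (X ^ n * ev b), O (X ^ (- n) * ev c) & O (ev d)].
Proof.
move=> e; have dg : \det (evM (mx2 a b c d)) = 1.
  by rewrite det_map_mx det_mx2 e rmorph1.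
have -> : (cls (evM (mx2 a b c d) *m apt n) = cls (apt n)) <->
    (cls (apt n) = cls (evM (mx2 a b c d) *m apt n)) by split.
rewrite (cls_eq_det V (apt_unit V n)); last by rewrite det_mulmx dg mul1r.
by rewrite evM_mx2 MO_conj_apt subrr expr0z mul1r.
Qed.

(** Fixing [apt n] means that [a] and [d] are constant and that [b] and [c] have degrees at most [n]
    and [- n]. Over two elements the diagonal entries are 1. One of [b] and [c] vanishes by its
    degree, except at [n = 0], where [c] is a constant divisible by [t]. *)
Lemma stab_aptP n g : Gamma0 g ->
  cls (evM g *m apt n) = cls (apt n) <-> exists v, g = @stab_mx n v.
Proof.
move=> Gg; split=> [|[v ->]]; last first.
  rewrite /stab_mx; case: ifP => n0; apply/apt_fixE.
  - by rewrite mulr0 mulr1 subr0.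
  - rewrite rmorph1 rmorph0 mulr0; split; [exact: vO1| |exact: vO0|exact: vO1].
    apply/ev_O; right; have := size_rVpoly v.
    by have := apt_index_ge0 n0; lia.
  - by rewrite mul0r mulr1 subr0.
  rewrite rmorph1 rmorph0 mulr0; split; [exact: vO1|exact: vO0| |exact: vO1].
  apply/ev_O; have [->|p0] := eqVneq (rVpoly v) 0; first by left; rewrite mulr0.
  right; rewrite mulrC size_mulX //; have := size_rVpoly v.
  by have := apt_index_lt0 n0; lia.
move: Gg; rewrite [g]mx2_eta; move: (g 0 0) (g 0 1) (g 1 0) (g 1 1) => a b c d.
move=> /Gamma0_mx2[e c0] /(apt_fixE n e)[/ev_O0 ha /ev_O hb /ev_O hc /ev_O0 hd].
have one : a * d = 1 -> a = 1 /\ d = 1.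
  rewrite ha hd; case: (F2 a`_0) => ->; first by rewrite mul0r => /esym/eqP; rewrite oner_eq0.
  case: (F2 d`_0) => -> //; first by rewrite mulr0 => /esym/eqP; rewrite oner_eq0.
case n0: (0 <= n).
  have cE : c = 0.
    case: hc => // h; have sc : (size c <= 1)%N by lia.
    by rewrite (size1_polyC sc) c0.
  move: e; rewrite cE mulr0 subr0 => /one[-> ->].
  have [|v ->] := @rVpoly_exists (apt_index n).+1 b; last by exists v; rewrite /stab_mx n0.
  by case: hb => [->|hb]; [rewrite size_poly0|have := apt_index_ge0 n0; lia].
have bE : b = 0.
  by case: hb => // h; apply/eqP; rewrite -size_poly_eq0; lia.
move: e; rewrite bE mul0r subr0 => /one[-> ->].
have [p cE] := X_factor c0.
have [|v e] := @rVpoly_exists (apt_index n).+1 p; last by exists v; rewrite /stab_mx n0 cE e.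
have [->|p0] := eqVneq p 0; first by rewrite size_poly0.
case: hc => [/eqP|]; first by rewrite cE mulf_eq0 polyX_eq0 (negbTE p0).
by rewrite cE mulrC size_mulX //; have := apt_index_lt0 n0; lia.
Qed.

Definition GammaK : set (set 'M[K]_2) := [set pclassK (evM g) | g in @Gamma0 F].

Lemma GammaK_PGL a : GammaK a -> classPGL a.
Proof. by move=> [g Gg <-]; exists (evM g) => //; apply: evM_unit; exact: Gamma0_unit. Qed.

Lemma GammaK1 : GammaK (pclassK 1%:M).
Proof. by exists 1%:M; [exact: Gamma0_1|rewrite evM1]. Qed.

Lemma GammaK_div a b : GammaK a -> GammaK b -> GammaK (cmul a (cinv b)).
Proof.
move=> [g Gg <-] [h Gh <-]; have uh := Gamma0_unit Gh.
rewrite /cinv pgl_invE ?evM_unit // /cmul pgl_mulE -evM_inv // -evMM.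
by exists (g *m invmx h) => //; apply: Gamma0M => //; exact: Gamma0V.
Qed.

Lemma GammaK_surj Y : classVertex V Y -> exists n a, GammaK a /\ cact a (cls (apt n)) = Y.
Proof.
move=> [B uB ->]; have [g [n [Gg e]]] := apt_orbits V uB.
by exists n, (pclassK (evM g)); split; [exists g|rewrite /cact act_cls -e].
Qed.

Lemma GammaK_inj a m n : GammaK a -> cact a (cls (apt m)) = cls (apt n) -> m = n.
Proof.
move=> [g Gg <-]; rewrite /cact act_cls; move: Gg.
rewrite [g]mx2_eta => /Gamma0_mx2[e c0]; exact: apt_inequiv.
Qed.

Definition stab_elt n (v : 'rV[F]_(apt_index n).+1) := pclassK (evM (stab_mx v)).

Lemma stab_elt_inj n : injective (@stab_elt n).
Proof.
move=> v w /pclass_eq[c c0 e]; apply: stab_mx_inj.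
have c1 : c = 1.
  move: e; rewrite /stab_mx; case: ifP => _; rewrite !evM_mx2 scalemx2 => /mx2_inj[];
  by rewrite rmorph1 mulr1.
move: e; rewrite c1 scale1r => /esym e; apply/matrixP => i j.
by apply: (@ev_inj _ _ V); have := congr1 (fun M : 'M[K]_2 => M i j) e; rewrite !mxE.
Qed.

Lemma stab_GammaK n : [set a | GammaK a /\ cact a (cls (apt n)) = cls (apt n)] =
  range (@stab_elt n).
Proof.
apply/seteqP; split=> a /=.
  move=> [[g Gg <-]]; rewrite /cact act_cls => /stab_aptP[] // v ->.
  by exists v.
move=> [v _ <-]; have Gv := Gamma0_stab_mx v; split; first by exists (stab_mx v).
by rewrite /cact act_cls; apply/stab_aptP => //; exists v.
Qed.

(* The position in the apartment of a vertex equivalent to the neighbour [p] of [apt n]. *)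
Definition nbr_pos n (p : option F) : int :=
  if 0 <= n then if p is None then n + 1 else n - 1
  else if p is Some c then if c == 0 then n - 1 else n + 1 else n + 1.

Lemma apt_nbr_equiv n p : exists2 a, GammaK a &
  cact a (cls (apt (nbr_pos n p))) = cls (apt n *m nbr_mx V p).
Proof.
have id1 Z B : B \in unitmx -> Z = cls B -> exists2 a, GammaK a & cact a (cls B) = Z.
  move=> uB ->; exists (pclassK 1%:M); first exact: GammaK1.
  by rewrite /cact act_cls mul1mx.
have u m := apt_unit V m.
rewrite /nbr_pos; case: ifP => n0; case: p => [c|]; try by apply: id1; rewrite // apt_nbr_None.
  rewrite apt_nbr_pos //; set g := mx2 _ _ _ _.
  exists (pclassK g); last by rewrite /cact act_cls.
  exists (mx2 1 (c *: 'X^`|n|) 0 1); last by rewrite evM_mx2 !rmorph1 rmorph0.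
  by apply/Gamma0_mx2; rewrite mulr0 mulr1 subr0 coef0.
case: (eqVneq c 0) => [->|c0]; first by apply: id1; rewrite // apt_nbr_0.
have n0' : n < 0 by lia.
rewrite apt_nbr_neg //; set g := mx2 _ _ _ _.
exists (pclassK g); last by rewrite /cact act_cls.
exists (mx2 1 0 (c^-1 *: 'X^`|n|) 1); last by rewrite evM_mx2 !rmorph1 rmorph0.
apply/Gamma0_mx2; rewrite mul0r mulr1 subr0 coefZ coefXn; split=> //.
by have -> : (0 == `|n|)%N = false; [lia|rewrite mulr0].
Qed.

End Stabilizers.

(** * Arithmeticity *)

Lemma finite_factor (T : choiceType) (U : Type) (I : finType) (x0 : T) (A : set T) (k : T -> I) (f : T -> U) :
  (forall x y, A x -> A y -> k x = k y -> f x = f y) -> finite_set (f @` A).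
Proof.
move=> h; pose g i := f (xget x0 [set x | A x /\ k x = i]).
have fin : finite_set (range g) by apply: finite_image; exact: finite_finset.
apply: sub_finite_set fin => _ [x Ax <-]; exists (k x) => //.
have [Ay ky] := xgetPex x0 (ex_intro (fun y => A y /\ k y = k x) x (conj Ax erefl)).
exact: h.
Qed.

Section Irreducible.
Variable F : fieldType.
Implicit Types p q s : {poly F}.

Lemma irreducible_factor q : (1 < size q)%N -> exists2 s, irreducible_poly s & s %| q.
Proof.
move: {2}(size q) (leqnn (size q)) => n; elim: n q => [|n IH] q le_qn q1.
  by lia.
case: (pselect (irreducible_poly q)) => [irr|nirr]; first by exists q.
have [d [d1 dq ndq]] : exists d : {poly F}, [/\ size d != 1%N, d %| q & ~~ (d %= q)].
  apply: contrapT => h; apply: nirr; split=> // d d1 dq.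
  by apply: contrapT => /negP ndq; apply: h; exists d.
have q0 : q != 0 by rewrite -size_poly_gt0; lia.
have d0 : d != 0 by apply: contraTneq dq => ->; rewrite dvd0p.
have lt_dq : (size d < size q)%N.
  by rewrite ltn_neqAle dvdp_leq // andbT dvdp_size_eqp.
have [||s irr sd] := IH d; [lia| |by exists s => //; exact: dvdp_trans sd dq].
by have := size_poly_gt0 d; rewrite d0; lia.
Qed.

Lemma irreducible_prime s p q : irreducible_poly s -> s %| p * q -> (s %| p) || (s %| q).
Proof.
move=> irr; case: (boolP (s %| p)) => //= np.
by rewrite Gauss_dvdpr // irreducible_poly_coprime.
Qed.

Lemma size_cofactor p s : p != 0 -> (1 < size s)%N -> (size p < size (p * s)%R)%N.
Proof.
move=> p0 s1; have s0 : s != 0 by rewrite -size_poly_gt0; lia.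
have p1 : (0 < size p)%N by rewrite size_poly_gt0.
by rewrite size_mul //; move: s1 p1; move: (size p) (size s) => m n; lia.
Qed.

End Irreducible.

Section FunctionField.
Variables (F : finFieldType) (K : fieldType) (V : dvfield F K).
Local Notation X := (vX V).
Local Notation O := (vO V).
Local Notation KC := (vC V).
Local Notation ev := (ev V).
Implicit Types (x y : K) (p q s : {poly F}).

Let X0 : X != 0 := vX_neq0 V.

Definition subringK (A : set K) : Prop :=
  [/\ A 1, forall x y, A x -> A y -> A (x - y) & forall x y, A x -> A y -> A (x * y)].

Definition subfieldK (k : set K) : Prop := subringK k /\ forall x, k x -> k x^-1.

Definition placeK (k B : set K) : Prop :=
  [/\ subringK B, B `<=` k, B <> k & forall x, k x -> B x \/ B x^-1].

Definition ratfun : set K := [set x | exists p q, q != 0 /\ x = ev p / ev q].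

Lemma ev_neq0 q : q != 0 -> ev q != 0.
Proof. by rewrite ev_eq0. Qed.

Lemma ratfun_ev p : ratfun (ev p).
Proof. by exists p, 1; rewrite oner_neq0 rmorph1 divr1. Qed.

Lemma ratfun_subfield : subfieldK ratfun.
Proof.
split; [split|].
- by have := ratfun_ev 1; rewrite rmorph1.
- move=> _ _ [p [q [q0 ->]]] [p' [q' [q'0 ->]]]; exists (p * q' - p' * q), (q * q').
  split; first by rewrite mulf_neq0.
  by rewrite rmorphB !rmorphM /=; field; rewrite !ev_neq0.
- move=> _ _ [p [q [q0 ->]]] [p' [q' [q'0 ->]]]; exists (p * p'), (q * q').
  split; first by rewrite mulf_neq0.
  by rewrite !rmorphM /=; field; rewrite !ev_neq0.
move=> _ [p [q [q0 ->]]]; have [->|p0] := eqVneq p 0.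
  by exists 0, 1; rewrite oner_neq0 !rmorph0 !mul0r invr0.
by exists q, p; rewrite invfM invrK mulrC.
Qed.

Lemma ratfunM x y : ratfun x -> ratfun y -> ratfun (x * y).
Proof. by case: ratfun_subfield.1 => _ _; exact. Qed.

Lemma ratfunV x : ratfun x -> ratfun x^-1.
Proof. exact: ratfun_subfield.2. Qed.

Lemma ratfun_T : ratfun X^-1.
Proof. by rewrite -(evX V); exact: ratfun_ev. Qed.

Lemma ratfun_X : ratfun X.
Proof. by rewrite -[X]invrK; apply: ratfun_subfield.2; exact: ratfun_T. Qed.

Lemma subring0 (A : set K) : subringK A -> A 0.
Proof. by move=> [A1 AB _]; rewrite -(subrr 1); exact: AB. Qed.

Lemma subringN (A : set K) x : subringK A -> A x -> A (- x).
Proof. by move=> sA Ax; rewrite -sub0r; case: (sA) => _ AB _; apply: AB => //; exact: subring0. Qed.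

Lemma subringD (A : set K) x y : subringK A -> A x -> A y -> A (x + y).
Proof.
move=> sA Ax Ay; rewrite -[y]opprK; case: (sA) => _ AB _; apply: AB => //.
exact: subringN.
Qed.

Lemma subringX (A : set K) x n : subringK A -> A x -> A (x ^+ n).
Proof.
by move=> [A1 _ AM] Ax; elim: n => [|n IH]; rewrite ?expr0 ?exprS //; exact: AM.
Qed.

Lemma subring_ev (A : set K) p : subringK A -> (forall c, A (KC c)) -> A X^-1 -> A (ev p).
Proof.
move=> sA AC AT; elim/poly_ind: p => [|p c IH]; first by rewrite rmorph0; exact: subring0.
rewrite rmorphD rmorphM /= evX evC; apply: subringD => //.
by case: sA => _ _; exact.
Qed.

(** For large [N] the element [X ^ N * x] is integral, and its expansion in [X] is cut after [N + n]
    digits. *)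
Lemma ratfun_dense x (n : nat) : exists y z, [/\ ratfun y, O z & x - y = X ^+ n * z].
Proof.
have [N hN] := O_large V x; have sk := ratfun_subfield.1.
have approx M w : O w -> exists y z, [/\ ratfun y, O z & w = y + X ^+ M * z].
  elim: M w => [|M IH] w Ow.
    by exists 0, w; rewrite add0r expr0 mul1r; split=> //; exact: subring0.
  have [c [w' [Ow' ->]]] := vO_split Ow; have [y [z [ky Oz ->]]] := IH _ Ow'.
  exists (KC c + X * y), z; split=> //; last by rewrite exprS; ring.
  apply: subringD => //; first by rewrite -evC; exact: ratfun_ev.
  by case: sk => _ _; apply=> //; exact: ratfun_X.
have [y [z [ky Oz e]]] := approx (N + n)%N _ hN.
exists (X^-1 ^+ N * y), z; split=> //.
  by case: (sk) => _ _; apply=> //; apply: subringX => //; exact: ratfun_T.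
have -> : x = X^-1 ^+ N * (X ^+ N * x) by rewrite exprVn mulKf // expf_neq0.
by rewrite e mulrDr addrAC subrr add0r mulrA exprD mulrA exprVn mulVf ?mul1r // expf_neq0.
Qed.

Lemma ratfun_transcendental (P : {poly K}) : P != 0 -> (forall i, exists c, P`_i = KC c) ->
  P.[X^-1] != 0.
Proof.
move=> P0 h; have [f hf] := choice h.
have -> : P = map_poly KC (\poly_(i < size P) f i).
  apply/polyP => i; rewrite coef_map coef_poly; case: ltnP => [_|/(nth_default 0) ->]; first exact: hf.
  exact/esym/rmorph0.
rewrite -[_.[_]]/(ev _) ev_eq0; apply: contraNneq P0 => e.
apply/eqP/polyP => i; rewrite coef0 hf; case: (ltnP i (size P)) => hi.
  by have := congr1 (fun p : {poly F} => p`_i) e; rewrite coef_poly hi coef0 => ->; rewrite rmorph0.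
by rewrite -hf nth_default.
Qed.

Lemma constants_subfield : subfieldK [set x | exists c, x = KC c].
Proof.
split; [split|].
- by exists 1; rewrite rmorph1.
- by move=> _ _ [c ->] [c' ->]; exists (c - c'); rewrite rmorphB.
- by move=> _ _ [c ->] [c' ->]; exists (c * c'); rewrite rmorphM.
by move=> _ [c ->]; exists c^-1; rewrite fmorphV.
Qed.

(** The reversed polynomial, whose constant term is the leading coefficient of [p]. In contrast to
    [ev_unit] the remainder is kept in a given subring, which need not be [O]. *)
Lemma ev_leading (A : set K) p : subringK A -> (forall c, A (KC c)) -> A X -> p != 0 ->
  exists c b, [/\ c != 0, A b & X ^+ (size p).-1 * ev p = KC c + X * b].
Proof.
move=> sA AC AX; elim/poly_ind: p => [|p c IH]; first by rewrite eqxx.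
rewrite size_MXaddC rmorphD rmorphM /= evX evC; case: (eqVneq p 0) => [->|p0] /=.
  rewrite size_poly0 rmorph0 !mul0r !add0r polyC_eq0.
  case: eqVneq => // c0 _; exists c, 0; rewrite expr0 mul1r mulr0 addr0.
  by split=> //; exact: subring0.
move=> _; have [c' [b [c'0 Ab e]]] := IH p0.
have sp : (size p).-1.+1 = size p by rewrite prednK // size_poly_gt0.
exists c', (b + X ^+ (size p).-1 * KC c); split=> //.
  by apply: subringD => //; case: (sA) => _ _; apply=> //; exact: subringX.
have -> : X ^+ size p * (ev p / X + KC c) =
    X ^+ (size p).-1 * ev p + X * (X ^+ (size p).-1 * KC c).
  by rewrite -{1}sp exprS; field.
by rewrite e; ring.
Qed.

(** A valuation ring [B] without [t] contains [X], and each [1 + X b] is a unit of [B], since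
    otherwise [X^-1] would lie in [B]. Hence [B] contains all quotients with [deg p <= deg q], which
    are the integral ones; an element of [B] outside [O] would again produce [X^-1]. *)
Lemma place_at_infinity B : placeK ratfun B -> (forall c, B (KC c)) -> ~ B X^-1 -> B = ratfun `&` O.
Proof.
move=> [sB Bk Bnk Btot] BC nT; have [B1 BB BM] := sB.
have BX : B X by case: (Btot _ ratfun_X).
have unitB b : B b -> B (1 + X * b)^-1.
  move=> Bb; have [->|b0] := eqVneq b 0; first by rewrite mulr0 addr0 invr1.
  have By : B (1 + X * b) by apply: subringD => //; exact: BM.
  have y0 : 1 + X * b != 0.
    apply/eqP => y0; apply: nT; have -> : X^-1 = - b.
      apply: (mulfI X0); rewrite mulfV // mulrN -[RHS]add0r -y0; ring.
    exact: subringN.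
  have kw : ratfun (X * b / (1 + X * b)).
    by apply: ratfunM; [apply: Bk; exact: BM|apply: ratfunV; exact: Bk].
  case: (Btot _ kw) => hw.
    have -> : (1 + X * b)^-1 = 1 - X * b / (1 + X * b) by field.
    exact: BB.
  case: nT; have -> : X^-1 = b * ((X * b / (1 + X * b))^-1 - 1).
    by field; rewrite X0 b0 y0.
  by apply: BM => //; exact: BB.
have OB x : ratfun x -> O x -> B x.
  move=> [p [q [q0 ->]]] Ox; have [->|p0] := eqVneq p 0.
    by rewrite rmorph0 mul0r; exact: subring0.
  have [c [b [c0 Bb e]]] := ev_leading sB BC BX q0.
  have [c' [b' [c'0 Bb' e']]] := ev_leading sB BC BX p0.
  have [u0 Ou _] := ev_unit V q0; set n := (size q).-1 in e u0 Ou *.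
  have KC0 : KC c != 0 by rewrite fmorph_eq0.
  have Xn0 : X ^+ n != 0 by rewrite expf_neq0.
  have xE : ev p / ev q = (X ^+ n * ev p) * (X ^+ n * ev q)^-1.
    by field; rewrite Xn0 ev_neq0.
  have : O (X ^ n%:Z * ev p).
    have -> : X ^ n%:Z * ev p = (ev p / ev q) * (X ^+ n * ev q).
      by rewrite -exprnP; field; rewrite ev_neq0.
    exact: vOM.
  move=> /ev_O[/eqP|le_pq]; first by rewrite (negbTE p0).
  have sp : (size p > 0)%N by rewrite size_poly_gt0.
  have nE : n = (n - (size p).-1 + (size p).-1)%N by lia.
  rewrite xE; apply: (BM _ _).
    rewrite nE exprD -mulrA e'; apply: (BM _ _); first exact: subringX.
    by apply: subringD => //; exact: BM.
  rewrite e.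
  have -> : KC c + X * b = KC c * (1 + X * (KC c^-1 * b)) by rewrite fmorphV; field.
  rewrite invfM -fmorphV; apply: (BM _ _) => //; apply: unitB; exact: (BM _ _).
apply/seteqP; split=> x.
  move=> Bx; split; first exact: Bk.
  case: (O_total V x) => // -[x0 h]; case: nT.
  have -> : X^-1 = x * (X^-1 * x^-1) by field; rewrite X0 x0.
  apply: BM => //; apply: OB => //.
  apply: ratfunM; first exact: ratfun_T.
  by apply: ratfunV; exact: Bk.
by move=> [kx Ox]; exact: OB.
Qed.

Definition local_ring s : set K := [set x | exists p q, ~~ (s %| q) /\ x = ev p / ev q].

Lemma local_ring_place s : irreducible_poly s -> placeK ratfun (local_ring s).
Proof.
move=> irr; have [s1 _] := irr; have s0 : s != 0 := irredp_neq0 irr.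
have n1 : ~~ (s %| 1) by rewrite dvdp1; lia.
have nM q q' : ~~ (s %| q) -> ~~ (s %| q') -> ~~ (s %| q * q').
  by move=> h h'; apply/negP => /(irreducible_prime irr); rewrite (negbTE h) (negbTE h').
have neq0 q : ~~ (s %| q) -> ev q != 0.
  by move=> h; apply: ev_neq0; apply: contraNneq h => ->; rewrite dvdp0.
split.
- split.
  + by exists 1, 1; rewrite divff // rmorph1 oner_neq0.
  + move=> _ _ [p [q [q0 ->]]] [p' [q' [q'0 ->]]]; exists (p * q' - p' * q), (q * q').
    split; first exact: nM.
    by rewrite rmorphB !rmorphM /=; field; rewrite !neq0.
  + move=> _ _ [p [q [q0 ->]]] [p' [q' [q'0 ->]]]; exists (p * p'), (q * q').
    split; first exact: nM.
    by rewrite !rmorphM /=; field; rewrite !neq0.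
- by move=> _ [p [q [nq ->]]]; exists p, q; split=> //; rewrite -(ev_eq0 V) neq0.
- move=> e; have : ratfun (ev s)^-1 by apply: ratfunV; exact: ratfun_ev.
  rewrite -e => -[p [q [nq e']]]; apply: (negP nq); apply/dvdpP; exists p.
  apply: (@ev_inj _ _ V); rewrite rmorphM /=; have h := ev_neq0 s0; have h' := neq0 _ nq.
  by rewrite -[ev q](mulfK h) -[_ / ev s]mulrC e'; field.
move=> _ [p [q [q0 ->]]].
(* The factor [s] is cancelled until numerator or denominator is prime to it; each time the
   denominator becomes shorter. *)
move: {2}(size q) (leqnn (size q)) => n; elim: n p q q0 => [|n IH] p q q0 le_q.
  by move: q0; rewrite -size_poly_eq0; lia.
case: (boolP (s %| q)) => nq; last by left; exists p, q.
case: (boolP (s %| p)) => np; last by right; exists q, p; rewrite invf_div.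
have [p' pE] := dvdpP _ _ np; have [q' qE] := dvdpP _ _ nq.
have q'0 : q' != 0 by apply: contraNneq q0 => h; rewrite qE h mul0r.
have sq : (size q' < size q)%N.
  by rewrite qE; exact: size_cofactor.
have -> : ev p / ev q = ev p' / ev q'.
  by rewrite pE qE !rmorphM /=; field; rewrite !ev_neq0.
by apply: IH => //; rewrite -ltnS; exact: leq_trans sq le_q.
Qed.

(** Regularity at the local ring of an irreducible factor of the denominator forces this factor to
    divide the numerator too; cancelling it repeatedly leaves a constant denominator. Conversely, a
    place where [t] is not regular is the one at infinity. *)
Lemma regular_ratfun x : (forall c : F, c = 0 \/ c = 1) ->
  (ratfun x /\ forall B, placeK ratfun B -> B <> ratfun `&` O -> B x) <-> exists p, x = ev p.
Proof.
move=> F2; split; last first.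
  move=> [p ->]; split=> [|B pB nB]; first exact: ratfun_ev.
  have [sB _ _ _] := pB; have [B1 _ _] := sB.
  have BC c : B (KC c) by case: (F2 c) => ->; rewrite ?rmorph0 ?rmorph1 //; exact: subring0.
  apply: subring_ev => //; apply: contrapT => nT; apply: nB; exact: place_at_infinity.
move=> [[p [q [q0 ->]]]].
move: {2}(size q) (leqnn (size q)) => n; elim: n p q q0 => [|n IH] p q q0 le_q reg.
  by move: q0; rewrite -size_poly_eq0; lia.
have [sq|sq] := leqP (size q) 1.
  have qE := size1_polyC sq; have c0 : q`_0 != 0 by rewrite -polyC_eq0 -qE.
  exists ((q`_0)^-1 *: p); rewrite -mul_polyC rmorphM /= [in LHS]qE !evC fmorphV mulrC //.
have [s irr sq'] := irreducible_factor sq.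
have s0 := irredp_neq0 irr; have [s1 _] := irr.
have [p' [q' [nq' e]]] : local_ring s (ev p / ev q).
  apply: reg; first exact: local_ring_place.
  (* This place is not the one at infinity, as it contains [t]. *)
  move=> e; have : local_ring s X^-1.
    exists 'X, 1; rewrite rmorph1 divr1 evX; split=> //.
    by rewrite dvdp1 neq_ltn s1 orbT.
  by rewrite e => -[_]; exact: vXinvN.
have evq' : ev q' != 0 by apply: ev_neq0; apply: contraNneq nq' => ->; rewrite dvdp0.
have e2 : p * q' = p' * q.
  apply: (@ev_inj _ _ V); rewrite !rmorphM /=.
  have -> : ev p * ev q' = ev p / ev q * ev q * ev q' by rewrite divfK // ev_neq0.
  by rewrite e; field.
have sp : s %| p.
  have : s %| p * q' by rewrite e2 dvdp_mull.
  by move=> /(irreducible_prime irr); rewrite (negbTE nq') orbF.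
have [p2 pE] := dvdpP _ _ sp; have [q2 qE] := dvdpP _ _ sq'.
have q20 : q2 != 0 by apply: contraNneq q0 => h; rewrite qE h mul0r.
have xE : ev p / ev q = ev p2 / ev q2.
  by rewrite pE qE !rmorphM /=; field; rewrite !ev_neq0.
rewrite xE; apply: IH => //; last by rewrite -xE.
by rewrite -ltnS; apply: leq_trans le_q; rewrite qE; exact: size_cofactor.
Qed.

Section Congruence.
Hypothesis F2 : forall c : F, c = 0 \/ c = 1.
Local Notation evM := (evM V).
Local Notation GammaK := (GammaK V).
Local Notation SL2 := [set g : 'M[{poly F}]_2 | \det g = 1].

Definition SLK : set (set 'M[K]_2) := [set pclassK (evM g) | g in SL2].

Lemma Gamma_SLK : GammaK `<=` SLK.
Proof. by move=> _ [g [Gg _] <-]; exists g. Qed.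

Lemma evM_inj : injective (fun g : 'M[{poly F}]_2 => evM g).
Proof.
move=> g h e; apply/matrixP => i j; apply: (@ev_inj _ _ V).
by have := congr1 (fun M : 'M[K]_2 => M i j) e; rewrite !mxE.
Qed.

Lemma evM_exists (M : 'M[K]_2) : (forall i j, exists p, M i j = ev p) -> exists g, M = evM g.
Proof.
move=> h; have h' (ij : 'I_2 * 'I_2) : exists p, M ij.1 ij.2 = ev p by exact: h.
have [f hf] := choice h'; exists (\matrix_(i, j) f (i, j)).
by apply/matrixP => i j; rewrite !mxE -hf.
Qed.

(** The determinant is a unit of [F[t]], so a nonzero constant, and over two elements the only one
    is 1. *)
Lemma PGL2_polyE : [set pclassK g | g in [set g : 'M[K]_2 |
    [/\ g \in unitmx, forall i j, exists p, g i j = ev p &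
        forall i j, exists p, invmx g i j = ev p]]] = SLK.
Proof.
apply/seteqP; split=> a; last first.
  move=> [g dg <-]; have ug : g \in unitmx by rewrite unitmxE dg unitr1.
  exists (evM g) => //; split; first exact: evM_unit.
    by move=> i j; exists (g i j); rewrite mxE.
  by move=> i j; exists (invmx g i j); rewrite -evM_inv // mxE.
move=> [M [uM /evM_exists[g gE] /evM_exists[h hE]] <-]; exists g; last by rewrite gE.
have gh : g *m h = 1%:M by apply: evM_inj; rewrite evMM -gE -hE mulmxV // evM1.
have /(congr1 determinant) := gh; rewrite det_mulmx det1 => e.
have : \det g \is a GRing.unit by apply/unitrPr; exists (\det h).
rewrite poly_unitE => /andP[/eqP s1]; rewrite unitfE.
rewrite /= [\det g]size1_polyC ?s1 // coefC /=.
by case: (F2 (\det g)`_0) => -> //; rewrite eqxx.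
Qed.

Definition cosetsK (G H : set (set 'M[K]_2)) : set (set (set 'M[K]_2)) :=
  [set [set cmul a h | h in H] | a in G].

Lemma cosets_Gamma : finite_set (cosetsK GammaK (GammaK `&` SLK)).
Proof.
rewrite (setIidl Gamma_SLK); apply: (sub_finite_set (B := [set GammaK])) => //.
move=> _ [a [g Gg <-] <-]; apply/seteqP; split=> b.
  move=> [_ [h Gh <-] <-]; rewrite /cmul pgl_mulE -evMM.
  by exists (g *m h) => //; exact: Gamma0M.
move=> [h Gh <-]; exists (pclassK (evM (invmx g *m h))).
  by exists (invmx g *m h) => //; apply: Gamma0M => //; exact: Gamma0V.
by rewrite /cmul pgl_mulE -evMM mulKVmx // Gamma0_unit.
Qed.

(** The lower left entry of [invmx h *m g] involves only the first columns of [g] and [h]. So the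
    first column modulo [t] determines the coset, and it takes finitely many values. *)
Lemma cosets_SL : finite_set (cosetsK SLK (GammaK `&` SLK)).
Proof.
rewrite (setIidl Gamma_SLK).
pose k (g : 'M[{poly F}]_2) := ((g 0 0 : {poly F})`_0, (g 1 0 : {poly F})`_0).
pose f (g : 'M[{poly F}]_2) := [set cmul (pclassK (evM g)) h | h in GammaK].
have -> : cosetsK SLK GammaK = f @` SL2.
  apply/seteqP; split=> C.
    by move=> [_ [g dg <-] <-]; exists g.
  by move=> [g dg <-]; exists (pclassK (evM g)) => //; exists g.
have key g h : SL2 g -> SL2 h -> k g = k h -> f g `<=` f h.
  move=> dg dh e _ [_ [w Gw <-] <-]; rewrite /cmul pgl_mulE -evMM.
  have uh : h \in unitmx by rewrite unitmxE dh unitr1.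
  exists (pclassK (evM (invmx h *m (g *m w)))); last first.
    by rewrite /cmul pgl_mulE -evMM mulKVmx.
  exists (invmx h *m (g *m w)) => //; rewrite mulmxA; apply: Gamma0M => //.
  move: dg dh e uh; rewrite /k {w Gw}.
  rewrite [g]mx2_eta [h]mx2_eta; move: (g 0 0) (g 0 1) (g 1 0) (g 1 1) => a b c d.
  move: (h 0 0) (h 0 1) (h 1 0) (h 1 1) => a' b' c' d'; rewrite !mx2E /= !det_mx2 => e e' [h1 h2] _.
  rewrite invmx2 ?e' ?unitr1 // invr1 scale1r mulmx2; apply/Gamma0_mx2; split.
    by rewrite -[RHS]mulr1 -{1}e -e'; ring.
  by rewrite coefD mulNr coefN !coef0M h1 h2 mulrC addNr.
apply: (finite_factor (k := k) 0) => g h dg dh e.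
by apply/seteqP; split; apply: key.
Qed.

Lemma subfield_ratfun (k : set K) : subfieldK k -> k X^-1 -> ratfun `<=` k.
Proof.
move=> [sk kV] kT _ [p [q [q0 ->]]].
have kC c : k (KC c) by case: (F2 c) => ->; rewrite ?rmorph0 ?rmorph1; [exact: subring0|case: sk].
have kev s : k (ev s) by exact: subring_ev.
by case: (sk) => _ _; apply=> //; apply: kV.
Qed.

End Congruence.

End FunctionField.

Lemma sum_range_fset (V : nmodType) (T : choiceType) (I : finType) (h : I -> T) (f : T -> V) :
  injective h -> \sum_(y <- fset_set (range h)) f y = \sum_i f (h i).
Proof.
move=> hi; rewrite -fsbig_finite; last by apply: finite_image; exact: finite_finset.
exact: sum_range.
Qed.

Lemma card_range (T : choiceType) (I : finType) (h : I -> T) :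
  injective h -> #|` fset_set (range h)| = #|I|.
Proof.
by move=> hi; rewrite card_fset_sum1 (sum_range_fset (fun=> 1%N)) // sum1_card.
Qed.

(** * Covolume and arithmeticity of the congruence subgroup *)

Section Lattice.
Variable F : finFieldType.
Hypothesis F2 : forall c : F, c = 0 \/ c = 1.
Local Notation V := (laurent_dv F).

Lemma card_F2 : #|F| = 2%N.
Proof.
rewrite cardE; have /perm_size -> // : perm_eq (enum F) [:: 0; 1].
apply: uniq_perm; rewrite ?enum_uniq //= ?inE ?andbT; first by rewrite eq_sym oner_eq0.
by move=> c; rewrite mem_enum !inE; case: (F2 c) => ->; rewrite eqxx ?orbT.
Qed.

Definition Glat : set (pgl F) := GammaK V.
Definition Dn (n : int) : hclass F := cls V (apt V n).

Lemma Dn_vertex n : vertex (Dn n).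
Proof. by apply/vertexE; exists (apt V n) => //; exact: apt_unit. Qed.

Lemma Glat_subgroup : subgroup Glat.
Proof. by split; [exact: GammaK_PGL|exact: GammaK1|exact: GammaK_div]. Qed.

Lemma Dn_surj X : vertex X -> exists n, orbit_equiv Glat (Dn n) X.
Proof. by move=> /vertexE/GammaK_surj[n [a [Ga e]]]; exists n, a. Qed.

Lemma Dn_inj m n : orbit_equiv Glat (Dn m) (Dn n) -> m = n.
Proof. by move=> [a Ga e]; exact: (GammaK_inj Ga e). Qed.

Lemma stab_Dn n : stab Glat (Dn n) = range (@stab_elt _ _ V n).
Proof. exact: stab_GammaK. Qed.

Lemma stab_Dn_finite n : finite_set (stab Glat (Dn n)).
Proof. by rewrite stab_Dn; apply: finite_image; exact: finite_finset. Qed.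

Lemma order_Dn n : grp_order (stab Glat (Dn n)) = (2 ^ (apt_index n).+1)%N.
Proof.
rewrite /grp_order stab_Dn card_range; last exact: stab_elt_inj.
by rewrite card_mx card_F2 mul1n.
Qed.

Lemma stab_finite X : vertex X -> finite_set (stab Glat X).
Proof.
move=> /Dn_surj[n e].
by have [] := grp_order_equiv Glat_subgroup (Dn_vertex n) (stab_Dn_finite n) e.
Qed.

Lemma order_orbit n X : orbit_equiv Glat (Dn n) X ->
  grp_order (stab Glat X) = (2 ^ (apt_index n).+1)%N.
Proof.
move=> e; have [_ ->] := grp_order_equiv Glat_subgroup (Dn_vertex n) (stab_Dn_finite n) e.
exact: order_Dn.
Qed.

Lemma sum_pow2_uniq (s : seq nat) : uniq s -> \sum_(k <- s) (2 ^ k.+1)%:R^-1 <= 1 :> rat.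
Proof.
move=> us; pose N := (\max_(k <- s) k).+1.
have geo M : \sum_(k < M) (2 ^ k.+1)%:R^-1 = 1 - (2 ^ M)%:R^-1 :> rat.
  elim: M => [|M IH]; first by rewrite big_ord0 expn0 invr1 subrr.
  rewrite big_ord_recr /= IH expnS natrM; field.
  by rewrite pnatr_eq0 expn_eq0.
have sN k : k \in s -> (k < N)%N.
  by move=> ks; rewrite ltnS; apply: leq_bigmax_seq.
have -> : \sum_(k <- s) (2 ^ k.+1)%:R^-1 = \sum_(k < N | (k : nat) \in s) (2 ^ k.+1)%:R^-1 :> rat.
  rewrite -(big_mkord (fun k => k \in s) (fun k => (2 ^ k.+1)%:R^-1)) -big_filter.
  apply: perm_big; apply: uniq_perm => //; first by rewrite filter_uniq // iota_uniq.
  move=> k; rewrite mem_filter mem_index_iota; by case: (boolP (k \in s)) => //= /sN ->.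
apply: le_trans (_ : \sum_(k < N) (2 ^ k.+1)%:R^-1 <= 1).
  rewrite [leRHS](bigID (fun k : 'I_N => (k : nat) \in s)) /= lerDl.
  by apply: sumr_ge0 => k _; rewrite invr_ge0 ler0n.
by rewrite geo gerBl invr_ge0 ler0n.
Qed.

Lemma Glat_covolume : finite_covolume Glat.
Proof.
(* Each half of the apartment contributes at most the geometric series 1/2 + 1/4 + ... = 1. *)
exists 2 => s us sv sinj.
have h X : exists n, X \in s -> orbit_equiv Glat (Dn n) X.
  case: (boolP (X \in s)) => [/sv/Dn_surj[n e]|_]; by [exists n|exists 0].
have [p hp] := choice h.
have pinj : {in s &, injective p}.
  move=> X X' Xs X's e; apply: sinj => //.
  apply: (orbit_equiv_trans Glat_subgroup); [exact: sv| |exact: hp X's].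
  by rewrite -e; apply: (orbit_equiv_sym Glat_subgroup); [exact: Dn_vertex|exact: hp].
have -> : \sum_(X <- s) (grp_order (stab Glat X))%:R^-1 =
    \sum_(n <- map p s) (2 ^ (apt_index n).+1)%:R^-1 :> rat.
  rewrite big_map; apply: eq_big_seq => X Xs.
  by rewrite (order_orbit (hp _ Xs)).
have ut : uniq (map p s) by rewrite map_inj_in_uniq.
move: (map p s) ut => t ut; rewrite (bigID (fun n : int => 0 <= n)) /=.
have -> : (2 : rat) = 1 + 1 by [].
have half (P : pred int) : {in P &, injective apt_index} ->
    \sum_(n <- t | P n) (2 ^ (apt_index n).+1)%:R^-1 <= 1 :> rat.
  move=> Pinj; rewrite -big_filter.
  have := @sum_pow2_uniq (map apt_index [seq x <- t | P x]); rewrite big_map; apply.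
  rewrite map_inj_in_uniq ?filter_uniq // => m n.
  by rewrite !mem_filter => /andP[Pm _] /andP[Pn _]; exact: Pinj.
by apply: lerD; apply: half => -[m|m] [n|n] //= _ _ ->.
Qed.

Lemma Glat_is_lattice : is_lattice Glat.
Proof. by split; [exact: Glat_subgroup|exact: stab_finite|exact: Glat_covolume]. Qed.

Lemma Glat_nonuniform : nonuniform Glat.
Proof.
move=> [s hs]; have h (i : 'I_(size s).+1) : exists X, X \in s /\ orbit_equiv Glat (Dn i%:Z) X.
  by have [X Xs e] := hs _ (Dn_vertex i%:Z); exists X.
have [f hf] := choice h.
have finj : injective f.
  move=> i j e; have [_ ei] := hf i; have [_ ej] := hf j; rewrite -e in ej.
  have : (i : nat)%:Z = (j : nat)%:Z.
    apply: Dn_inj; apply: (orbit_equiv_trans Glat_subgroup); [exact: Dn_vertex|exact: ei|].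
    by apply: (orbit_equiv_sym Glat_subgroup) => //; exact: Dn_vertex.
  by move=> [] /val_inj.
have : (size (map f (enum 'I_(size s).+1)) <= size s)%N.
  apply: uniq_leq_size; first by rewrite map_inj_uniq ?enum_uniq.
  by move=> X /mapP[i _ ->]; case: (hf i).
by rewrite size_map size_enum_ord ltnn.
Qed.

Lemma regular_ringE : regular_ring (ratfun V) = [set x | exists p, x = ev V p].
Proof. by apply/seteqP; split=> x; have [h1 h2] := regular_ratfun V x F2; [exact: h1|exact: h2]. Qed.

Lemma Glat_arithmetic : arithmetic_subgroup Glat.
Proof.
(* The function field is [F(t)] with [t] the inverse of the uniformizer, and the conjugating class
   is trivial. Since [T = t] generates the field, the spanning family is the single element 1. *)
exists (ratfun V), (pclass 1%:M); split.
- split; first exact: (ratfun_subfield V).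
  exists (unif F)^-1; first split; first exact: (ratfun_T V).
    move=> P P0 hP; apply: (ratfun_transcendental (V := V)) => // i.
    exact: (hP i _ (constants_subfield V) (@sub0set _ _)).
  exists 1%N, (fun=> 1); split=> [_|x kx]; first by case: (ratfun_subfield V) => -[].
  exists (fun=> x); last by rewrite big_ord1 mulr1.
  by move=> _ k sk kT; exact: (@subfield_ratfun _ _ V F2 k sk (kT _ erefl) x kx).
- exact: (ratfun_dense V).
- by exists 1%:M => //=; exact: unitmx1.
have -> : [set pgl_mul (pgl_mul (pclass 1%:M) g) (pgl_inv (pclass 1%:M))
      | g in PGL2_over (regular_ring (ratfun V))] = SLK V.
  rewrite -(PGL2_polyE V F2) /PGL2_over regular_ringE.
  have i1 : pgl_inv (pclass (1%:M : 'M[laurent F]_2)) = pclass 1%:M.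
    by have := @pgl_invE (laurent F) 1%:M (unitmx1 _ _); rewrite invmx1.
  have id_conj (g : 'M[laurent F]_2) :
      pgl_mul (pgl_mul (pclass 1%:M) (pclass g)) (pgl_inv (pclass 1%:M)) = pclass g.
    have m1 (x y : 'M[laurent F]_2) : pgl_mul (pclass x) (pclass y) = pclass (x *m y) := pgl_mulE x y.
    by rewrite i1 !m1 mul1mx mulmx1.
  apply/seteqP; split=> a.
    by move=> [_ [g hg <-] <-]; exists g => //; rewrite id_conj.
  move=> [g hg <-]; exists (pclass g); last by rewrite id_conj.
  by exists g.
by split; [exact: (cosets_Gamma V)|exact: (cosets_SL V)].
Qed.

Lemma Glat_nonuniform_arithmetic : nonuniform_arithmetic_lattice Glat.
Proof. by split; [exact: Glat_is_lattice|exact: Glat_nonuniform|exact: Glat_arithmetic]. Qed.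

End Lattice.

(** * Scattering for the two labellings of the cusps *)

Section Labelling.
Variables (R : realType) (F : finFieldType).
Hypothesis F2 : forall c : F, c = 0 \/ c = 1.
Local Notation V := (laurent_dv F).
Local Notation G := (@Glat F).
Local Notation C := (Cplx R).
(* The end [n -> +oo] of the apartment is the cusp 0 if [b] is false, the cusp 1 otherwise. *)
Variable b : bool.

Definition positive_cusp (c : 'I_2) : bool := (c == 0) (+) b.

Definition pos (v : label 1 2) : int :=
  match v with
  | inl _ => 0
  | inr (c, m) => if positive_cusp c then Posz m.+1 else Negz m
  end.

Definition cusp_side (s : bool) : 'I_2 := if s (+) b then 0 else 1.

Definition unpos (n : int) : label 1 2 :=
  match n with
  | Posz 0 => core 2 ord0
  | Posz m.+1 => inr (cusp_side true, m)
  | Negz m => inr (cusp_side false, m)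
  end.

Lemma posK : cancel pos unpos.
Proof.
rewrite /pos /unpos /positive_cusp /cusp_side.
case=> [i|[c m]]; first by rewrite (ord1 i).
by case: (ord2P c) => ->; case: b.
Qed.

Lemma unposK : cancel unpos pos.
Proof. by rewrite /pos /unpos /positive_cusp /cusp_side; case=> [[|m]|m] //=; case: b. Qed.

Definition aptlift (v : label 1 2) : hclass F := @Dn F (pos v).

Lemma aptlift_vertex v : vertex (aptlift v).
Proof. exact: Dn_vertex. Qed.

Lemma aptlift_surj X : vertex X -> exists v, orbit_equiv G (aptlift v) X.
Proof. by move=> /Dn_surj[n e]; exists (unpos n); rewrite /aptlift unposK. Qed.

Lemma aptlift_inj u v : orbit_equiv G (aptlift u) (aptlift v) -> u = v.
Proof. by move=> /Dn_inj/(can_inj posK). Qed.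

Lemma apt_adjacency (f : label 1 2 -> C) v : adjacency G aptlift f v =
  \sum_(p : option F) f (unpos (nbr_pos (pos v) p)).
Proof.
rewrite (adjacency_sum (@Glat_subgroup F) (stab_finite F2) aptlift_vertex aptlift_surj aptlift_inj).
have nE : neighbours (aptlift v) = range (fun p => cls V (apt V (pos v) *m nbr_mx V p)).
  by rewrite neighboursE [LHS](adj_clsP V (apt_unit V (pos v))).
rewrite nE sum_range_fset; last exact: nbr_inj (apt_unit V (pos v)).
apply: eq_bigr => p _; congr f.
apply: (quotient_vertexE (@Glat_subgroup F) aptlift_vertex aptlift_surj aptlift_inj).
rewrite /aptlift unposK; exact: apt_nbr_equiv.
Qed.

Lemma sum_option_F2 (f : option F -> C) :
  \sum_p f p = f None + f (Some 0) + f (Some 1).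
Proof.
rewrite (bigD1 None) //= (bigD1 (Some 0)) //= (bigD1 (Some 1)) /=; last first.
  by rewrite (inj_eq Some_inj) oner_eq0.
rewrite big1 ?addr0 ?addrA // => -[c|] //=.
by rewrite !(inj_eq Some_inj); case: (F2 c) => ->; rewrite eqxx ?andbF.
Qed.

Lemma apt_adjacencyE (f : label 1 2 -> C) v : adjacency G aptlift f v =
  if 0 <= pos v then f (unpos (pos v + 1)) + 2%:R * f (unpos (pos v - 1))
  else 2%:R * f (unpos (pos v + 1)) + f (unpos (pos v - 1)).
Proof.
rewrite apt_adjacency sum_option_F2 /nbr_pos eqxx oner_eq0.
by case: ifP => _; ring.
Qed.

Lemma pos_cusp c n : (1 <= n)%N ->
  pos (cusp 1 c n) = if positive_cusp c then n%:Z else - n%:Z.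
Proof. by case: n => // n _ /=; case: ifP => // _; rewrite NegzE. Qed.

Lemma unpos_cusp c n : (1 <= n)%N ->
  unpos (if positive_cusp c then n%:Z else - n%:Z) = cusp 1 c n.
Proof. by move=> n1; rewrite -pos_cusp // posK. Qed.

(** At level [n] the stabilizers have order [2^(n + 1)] at the end of positive positions and [2^n]
    at the other; equating their inverses with [3 w / 2^n] gives the widths. *)
Definition apt_width (c : 'I_2) : R := if positive_cusp c then 6^-1 else 3^-1.

Lemma apt_width_gt0 c : 0 < apt_width c.
Proof. by rewrite /apt_width; case: ifP => _; rewrite invr_gt0 ltr0n. Qed.

Lemma apt_lambda v : lambda R G aptlift v = (2 ^ (apt_index (pos v)).+1)%:R^-1.
Proof. by rewrite /lambda order_Dn. Qed.

Lemma apt_lambda_cusp c n : (1 <= n)%N ->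
  lambda R G aptlift (cusp 1 c n) = apt_width c * (#|F|%:R + 1) / #|F|%:R ^+ n.
Proof.
case: n => // n _; rewrite apt_lambda card_F2 // -natrX /= /apt_width.
have h : 2%:R ^+ n != 0 :> R by rewrite expf_neq0 // pnatr_eq0.
by case: ifP => _ /=; rewrite !expnS !natrM natrX; field.
Qed.

(** Both ends obey one formula; at [n = 1] the inner neighbour is position 0, the core vertex, for
    either sign. *)
Lemma adjacency_side (f : label 1 2 -> C) c n : (1 <= n)%N ->
  adjacency G aptlift f (cusp 1 c n) =
  2%:R * f (unpos (if positive_cusp c then n.-1%:Z else - n.-1%:Z)) + f (cusp 1 c n.+1).
Proof.
move=> n1; rewrite apt_adjacencyE pos_cusp // -(@unpos_cusp c n.+1) //.
have e1 : n%:Z - 1 = n.-1%:Z by lia.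
have e2 : n%:Z + 1 = n.+1%:Z by lia.
have e3 : - n%:Z - 1 = - n.+1%:Z by lia.
have e4 : - n%:Z + 1 = - n.-1%:Z by lia.
case: (positive_cusp c); first by rewrite e1 e2 addrC.
by have -> : (0 <= - n%:Z) = false; [lia|rewrite e3 e4].
Qed.

Lemma apt_adjacency_cusp (f : label 1 2 -> C) c n : (2 <= n)%N ->
  adjacency G aptlift f (cusp 1 c n) = #|F|%:R * f (cusp 1 c n.-1) + f (cusp 1 c n.+1).
Proof.
move=> n2; rewrite adjacency_side; last exact: ltnW.
by rewrite unpos_cusp ?card_F2 //; lia.
Qed.

Lemma apt_adjacency_cusp1 (c c' : 'I_2) n : (1 <= n)%N ->
  adjacency G aptlift (delta R (cusp 1 c' n)) (cusp 1 c 1) = ((c' == c) && (n == 2%N))%:R.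
Proof.
move=> n1; rewrite adjacency_side //= oppr0 if_same /delta.
case: n n1 => // n _; rewrite mulr0 add0r; congr ((nat_of_bool _)%:R).
by apply/idP/andP => [/eqP[-> <-]|[/eqP -> /eqP[->]]].
Qed.

Definition apt_quotient : cusped_quotient R G 1 2 :=
  @CuspedQuotient R F (@Glat F) 1 2 aptlift apt_width isT aptlift_vertex aptlift_surj aptlift_inj
    apt_width_gt0 apt_lambda_cusp apt_adjacency_cusp apt_adjacency_cusp1.

End Labelling.

(** * The scattering matrix of the example *)

Section Factor.
Variable C : numFieldType.
Implicit Type z : C.

(** In the example [F = (2 / a) (2 / z - z)], and [S = -1 + scat_factor(z) v v^T] with [v] the
    coupling vector [vb]. *)
Definition scat_factor (z : C) : C := (z^-1 - z) * (2%:R * (2%:R * z^-1 - z))^-1.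

Lemma near_good (z0 : C) : z0 != 0 -> 2%:R - z0 * z0 != 0 ->
  \forall z \near nbhs z0, z != 0 /\ 2%:R - z * z != 0.
Proof.
move=> h1 h2; have c1 := @cvg_pt C z0.
have n1 := near_cvg_neq0 (nbhsF z0) c1 h1.
have s2 := cslopeD (cslope_cst 2%:R z0) (cslopeM (cslope_cst (-1) z0) (cslopeM (cslope_id z0) (cslope_id z0))).
have c2 := cslope_cvg s2; rewrite mulN1r in c2.
have n2 := near_cvg_neq0 (nbhsF z0) c2 h2.
by apply: filterS2 n1 n2 => z z1; rewrite mulN1r; split.
Qed.

Lemma scat_factorE z : z != 0 -> 2%:R - z * z != 0 -> scat_factor z = 2%:R^-1 * (1 - (2%:R - z * z)^-1).
Proof.
move=> z0 zz; have e : 2%:R * z^-1 - z != 0.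
  have -> : 2%:R * z^-1 - z = (2%:R - z * z) / z by field.
  by rewrite mulf_neq0 // invr_eq0.
by rewrite /scat_factor; field; rewrite zz z0.
Qed.

Lemma scat_factor_slope (z : C) : z != 0 -> 2%:R - z * z != 0 ->
  cslope scat_factor z (- (z / (2%:R - z * z) ^+ 2)).
Proof.
move=> z0 zz.
have s1 := cslopeM (cslope_id z) (cslope_id z).
have s2 := cslopeD (cslope_cst 2%:R z) (cslopeM (cslope_cst (-1) z) s1).
have zz' : 2%:R + -1 * (z * z) != 0 by rewrite mulN1r.
have s3 := @cslopeV C (fun x => 2%:R + -1 * (x * x)) z _ zz' s2.
have s4 := cslopeM (cslope_cst 2%:R^-1 z) (cslopeD (cslope_cst 1 z) (cslopeM (cslope_cst (-1) z) s3)).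
have := cslope_near _ s4; move=> /(_ scat_factor).
have e : \forall u \near nbhs z, 2%:R^-1 * (1 + -1 * (2%:R + -1 * (u * u))^-1) = scat_factor u.
  apply: filterS (near_good z0 zz) => u [u0 uu].
  by rewrite scat_factorE // !mulN1r.
move=> /(_ e); congr (cslope _ _ _).
by field; rewrite ?zz' ?zz.
Qed.

Definition cdiff (f : C -> C) z := exists c, cslope f z c.

Lemma cdiff_cst k z : cdiff (fun=> k) z.
Proof. by exists 0; exact: cslope_cst. Qed.

Lemma cdiffD f g z : cdiff f z -> cdiff g z -> cdiff (fun x => f x + g x) z.
Proof. by move=> [c hf] [c' hg]; eexists; exact: cslopeD hf hg. Qed.

Lemma cdiffM f g z : cdiff f z -> cdiff g z -> cdiff (fun x => f x * g x) z.
Proof. by move=> [c hf] [c' hg]; eexists; exact: cslopeM hf hg. Qed.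

Lemma cdiffX f n z : cdiff f z -> cdiff (fun x => f x ^+ n) z.
Proof.
move=> hf; elim: n => [|n IH].
  by have -> : (fun x => f x ^+ 0) = (fun=> 1) by []; exact: cdiff_cst.
have -> : (fun x => f x ^+ n.+1) = (fun x => f x * f x ^+ n).
  by apply/funext => x; rewrite exprS.
exact: cdiffM.
Qed.

Lemma cdiff_sum n (f : 'I_n -> C -> C) z : (forall i, cdiff (f i) z) ->
  cdiff (fun x => \sum_i f i x) z.
Proof.
elim: n f => [|n IH] f h.
  have -> : (fun x => \sum_(i < 0) f i x) = (fun=> 0).
    by apply/funext => x; rewrite big_ord0.
  exact: cdiff_cst.
have -> : (fun x => \sum_(i < n.+1) f i x) =
    (fun x => f ord0 x + \sum_(i < n) f (fintype.lift ord0 i) x).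
  by apply/funext => x; rewrite big_ord_recl.
by apply: cdiffD => //; apply: IH => i.
Qed.

Lemma cdiff_id z : cdiff id z.
Proof. by exists 1; exact: cslope_id. Qed.

Lemma cdiff_inv z : z != 0 -> cdiff (fun x => x^-1) z.
Proof. by move=> z0; eexists; exact: cslope_inv. Qed.

Lemma cdiff_ext f g z : f = g -> cdiff f z -> cdiff g z. Proof. by move=> ->. Qed.

End Factor.

Section Example.
Variables (R : realType) (F : finFieldType).
Hypothesis F2 : forall c : F, c = 0 \/ c = 1.
Local Notation C := (Cplx R).
Local Notation G := (@Glat F).
Local Notation a := (sqrt_q R F).
Variable b : bool.
Local Notation Y := (apt_quotient R F2 b).
Local Notation lam := (lambda R G (lift Y)).

Lemma sqrt_qE : a ^+ 2 = 2%:R.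
Proof. by rewrite a_sqr card_F2 // rmorph_nat. Qed.

(** The weights are 1/2 at the core and 1/4, 1/2 at the positions 1, -1; the adjacency coefficients
    at the core are 1 and 2. Symmetrization turns them into [sqrt 2] and 2. *)
Definition vb (c : 'I_2) : C := if positive_cusp b c then a else 2%:R.

Lemma apt_jacobi_core (f : label 1 2 -> C) i : jacobi Y f (core 2 i) =
  a * f (unpos b 1) + 2%:R * f (unpos b (- 1)).
Proof.
have lE v : lam v = (2 ^ (apt_index (pos b v)).+1)%:R^-1 by exact: (apt_lambda R F2).
have p0 : pos b (core 2 i) = 0 by [].
rewrite /jacobi (apt_adjacencyE F2) p0 lexx add0r sub0r !lE p0 !unposK.
have s4 : Num.sqrt ((2 ^ 2)%:R^-1) = 2%:R^-1 :> R.
  by rewrite natrX -exprVn sqrtr_sqr ger0_norm // invr_ge0 ler0n.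
have s2 : Num.sqrt ((2 ^ 1)%:R^-1) = (Num.sqrt 2%:R)^-1 :> R by rewrite expn1 sqrtrV.
have h2 : Num.sqrt 2%:R ^+ 2 = 2%:R :> R by rewrite sqr_sqrtr.
have h0 : Num.sqrt 2%:R != 0 :> R by rewrite sqrtr_eq0 -ltNge ltr0n.
have -> : a = toC (Num.sqrt 2%:R) by rewrite /sqrt_q card_F2.
rewrite -[apt_index 1]/1%N -[apt_index (-1)]/0%N s4 s2 !invrK.
have e1 : toC (Num.sqrt 2%:R) = toC (Num.sqrt 2%:R)^-1 * toC 2%:R :> C.
  by rewrite -toCM; congr toC; rewrite -{3}h2 expr2 mulKf.
have e2 : toC (Num.sqrt 2%:R)^-1 * toC (Num.sqrt 2%:R) = 1 :> C.
  by rewrite -toCM mulVf ?rmorph1.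
rewrite [in RHS]e1 mulrDr mulrA; congr (_ + _).
by rewrite mulrCA [X in _ * X]mulrA e2 mul1r.
Qed.

Lemma unpos_neq_core n i : n != 0 -> (unpos b n == core 2 i) = false.
Proof. by case: n => [[|n]|n]. Qed.

Lemma apt_core_mx : core_mx Y = 0.
Proof.
apply/matrixP => i j; rewrite !mxE apt_jacobi_core /delta !unpos_neq_core //.
by rewrite !mulr0 addr0.
Qed.

Lemma apt_coupling i c : coupling_mx Y i c = vb c.
Proof.
rewrite mxE apt_jacobi_core /delta /vb.
have e1 : (unpos b 1 == cusp 1 c 1) = positive_cusp b c.
  by rewrite /unpos /cusp /cusp_side /positive_cusp; case: (ord2P c) => ->; case: (b).
have e2 : (unpos b (- 1) == cusp 1 c 1) = ~~ positive_cusp b c.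
  by rewrite /unpos /cusp /cusp_side /positive_cusp; case: (ord2P c) => ->; case: (b).
by rewrite e1 e2; case: ifP => _ /=; rewrite ?mulr0 ?mulr1 ?addr0 ?add0r.
Qed.

Lemma vb_conj c : (vb c)^* = vb c.
Proof. by rewrite /vb; case: ifP => _; [exact: conj_toC|exact: rmorph_nat]. Qed.

(** The sum is independent of [b]; it is all that the determinant sees of the coupling vector. *)
Lemma vb_sum : \sum_c vb c ^+ 2 = 6%:R.
Proof.
rewrite big_ord_recl big_ord1 /vb /positive_cusp.
have -> : (fintype.lift ord0 ord0 : 'I_2) = 1 by apply: val_inj.
by case: (b); rewrite /= !sqrt_qE; ring.
Qed.

Lemma adj_coupling c i : adjmx (coupling_mx Y) c i = vb c.
Proof. by rewrite /adjmx mxE mxE apt_coupling vb_conj. Qed.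

Lemma apt_F_mx z : F_mx Y z = (2%:R / a * (2%:R * z^-1 - z))%:M.
Proof.
have a0 := a_neq0 R F; rewrite /F_mx apt_core_mx.
have -> : coupling_mx Y *m adjmx (coupling_mx Y) = (6%:R)%:M.
  apply/matrixP => i j; rewrite !mxE -vb_sum (ord1 i) (ord1 j) eqxx mulr1n.
  by apply: eq_bigr => c _; rewrite adj_coupling apt_coupling expr2.
rewrite add0r scale_scalar_mx -raddfN -raddfD; congr _%:M.
apply: (mulfI a0); move: (z^-1) => w.
have -> : a * (2%:R / a * (2%:R * w - z)) = 2%:R * (2%:R * w - z) by field.
have -> : a * (- (a * (z + w)) + w / a * 6%:R) = - (a ^+ 2 * (z + w)) + 6%:R * w by field.
by rewrite sqrt_qE; ring.
Qed.

Lemma apt_core_inv z c : (z^-1 - z) * (invmx (F_mx Y z) *m coupling_mx Y) ord0 c = a * scat_factor z * vb c.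
Proof.
have a0 := a_neq0 R F.
rewrite apt_F_mx invmx_scalar mul_scalar_mx mxE apt_coupling /scat_factor !invfM invrK; ring.
Qed.

Lemma apt_S_formula z i j : S_formula Y z i j = - (i == j)%:R + scat_factor z * (vb i * vb j).
Proof.
have a0 := a_neq0 R F; rewrite /S_formula -mulmxA.
rewrite mxE [X in X + _]mxE [X in _ + X]mxE [X in _ + _ * X]mxE big_ord1.
rewrite adj_coupling; congr (_ + _).
  by rewrite !mxE.
have h := apt_core_inv z j; move: h; move: ((invmx _ *m _) ord0 j) => x h.
have -> : (z^-1 - z) / a * (vb i * x) = vb i / a * ((z^-1 - z) * x) by ring.
by rewrite h; move: a0; move: (a) => u u0; field.
Qed.

Lemma apt_det_S z : \det (S_formula Y z) = 1 - 6%:R * scat_factor z.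
Proof.
have e := vb_sum; rewrite big_ord_recl big_ord1 in e.
have l1 : (fintype.lift ord0 ord0 : 'I_2) = 1 by apply: val_inj.
rewrite l1 in e.
rewrite [S_formula Y z]mx2_eta det_mx2 !apt_S_formula !eqxx /= -e -[ord0]/(0 : 'I_2).
by ring.
Qed.

Local Notation ka c := (toC (qw Y c) : C).
Local Notation zeta s := (qpow F (s - 2%:R^-1)).
Local Notation good z := (z != 0 /\ 2%:R - z * z != 0).

Lemma scat_factor_cdiff (z : C) : good z -> cdiff (@scat_factor C) z.
Proof. by move=> [z0 zz]; eexists; exact: scat_factor_slope. Qed.

Lemma S_cdiff z i j : good z -> cdiff (fun w => S_formula Y w i j) z.
Proof.
move=> gz; apply: (@cdiff_ext C (fun w => - (i == j)%:R + scat_factor w * (vb i * vb j))).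
  by apply/funext => w; rewrite apt_S_formula.
exact: (cdiffD (cdiff_cst _ z) (cdiffM (scat_factor_cdiff gz) (cdiff_cst _ z))).
Qed.

Lemma eis_cdiff z (v : 'cV[C]_2) u : good z -> cdiff (fun w => eis_expl Y w v u) z.
Proof.
move=> gz; have [z0 _] := gz; case: u => [i|[c n]].
  apply: (@cdiff_ext C (fun w => (toC (Num.sqrt (lam (core 2 i))))^-1 *
      \sum_c (a * scat_factor w * vb c) * bvec Y v c 0)).
    apply/funext => w /=; congr (_ * _); rewrite mxE; apply: eq_bigr => c _.
    by rewrite -apt_core_inv (ord1 i) [in RHS]mxE.
  apply: cdiffM; first exact: cdiff_cst.
  apply: cdiff_sum => c; apply: cdiffM; last exact: cdiff_cst.
  apply: cdiffM; last exact: cdiff_cst.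
  by apply: cdiffM; [exact: cdiff_cst|exact: scat_factor_cdiff].
apply: (@cdiff_ext C (fun w => (a * w) ^+ n.+1 * v c 0 + (a * w^-1) ^+ n.+1 *
    ((ka c)^-1 * \sum_j S_formula Y w c j * bvec Y v j 0))).
  by apply/funext => w /=; congr (_ + _ * _); rewrite [RHS]mxE [in RHS]mxE.
apply: cdiffD.
  apply: cdiffM; last exact: cdiff_cst.
  by apply: cdiffX; apply: cdiffM; [exact: cdiff_cst|exact: cdiff_id].
apply: cdiffM.
  by apply: cdiffX; apply: cdiffM; [exact: cdiff_cst|exact: cdiff_inv].
apply: cdiffM; first exact: cdiff_cst.
by apply: cdiff_sum => j; apply: cdiffM; [exact: S_cdiff|exact: cdiff_cst].
Qed.

Lemma cdiff_derivable (f : C -> C) z : cdiff f z -> derivable f z 1.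
Proof. by move=> [c]; exact: cslope_derivable. Qed.

Lemma cdiff_holomorphic (f g : C -> C) s : (forall z, good z -> cdiff g z) -> good (zeta s) ->
  (\forall w \near s^', f w = g (zeta w)) -> holomorphic_at f s.
Proof.
move=> dg [g1 g2] e.
have dg' : \forall z \near nbhs (zeta s), derivable g z 1.
  by apply: filterS (near_good g1 g2) => z gz; apply: cdiff_derivable; exact: dg.
have c0 : zeta s * toC (ln #|F|%:R) != 0 by apply: mulf_neq0 => //; exact: lnq_neq0.
have eg : \forall z \near (zeta s)^', g z = g z by exact: nearW.
have [h1 _] := comp_near 1 1 (zeta_slope F) c0 dg' eg.
exists (1 * g (zeta s) * 1), (fun w => 1 * g (zeta w) * 1); split=> //.
by apply: filterS e => w ->; rewrite mul1r mulr1.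
Qed.

Lemma apt_holomorphic_point (t : R) : good (circle t) -> holomorphic_point Y t.
Proof.
move=> gz; have latG := Glat_is_lattice F2; split.
- move=> v u; apply: (@cdiff_holomorphic _ (fun z => eis_expl Y z v u)).
  + by move=> z; exact: eis_cdiff.
  + by rewrite circle_zeta.
  by apply: filterS (near_F_unit Y (s_theta F t)) => w uF; rewrite (eis_genericE latG).
- move=> i j; rewrite circle_zeta; exists (S_formula Y (circle t) i j).
  apply: derivable_continues; case: gz => g1 g2.
  by apply: filterS (near_good g1 g2) => z gz; apply: cdiff_derivable; exact: S_cdiff.
move=> i j; apply: (@cdiff_holomorphic _ (fun z => (ka i)^-1 * S_formula Y z i j * ka j)).
- move=> z hz; apply: cdiffM; last exact: cdiff_cst.
  by apply: cdiffM; [exact: cdiff_cst|exact: S_cdiff].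
- by rewrite circle_zeta.
by apply: filterS (near_F_unit Y (s_theta F t)) => w uF; exact: (S_aut_genericE latG).
Qed.

Lemma circle_pihalf : circle (pi / 2%:R : R) = 'i :> C.
Proof. by rewrite circleE cos_pihalf sin_pihalf. Qed.

Lemma good_i : good ('i : C).
Proof.
split; first exact: neq0Ci.
have -> : 2%:R - 'i * 'i = 3%:R :> C by rewrite -expr2 sqrCi opprK; ring.
by rewrite pnatr_eq0.
Qed.

Lemma scat_factor_i : scat_factor ('i : C) = 3%:R^-1.
Proof.
have [i0 ii] := good_i; rewrite scat_factorE // -expr2 sqrCi opprK.
by field.
Qed.

Let t : R := pi / 2%:R.

Lemma apt_S_mx i j : \forall z \near nbhs ('i : C), S_mx Y z i j = S_formula Y z i j.
Proof.
have [i0 ii] := good_i; have h := near_good i0 ii.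
have dS : \forall z \near nbhs ('i : C), derivable (fun w => S_formula Y w i j) z 1.
  by apply: filterS h => z gz; apply: cdiff_derivable; exact: S_cdiff.
have h2 := near_join dS; apply: filterS h2 => z dz; rewrite mxE.
by apply: continuationE; exact: derivable_continues.
Qed.

Lemma S_i i j : S_mx Y 'i i j = - (i == j)%:R + 3%:R^-1 * (vb i * vb j).
Proof. by rewrite (nbhs_singleton (apt_S_mx i j)) apt_S_formula scat_factor_i. Qed.

Lemma S_slope_i i j : rslope (fun u => S_mx Y (circle u) i j) t (('i / 9%:R) * (vb i * vb j)).
Proof.
have [i0 ii] := good_i; have ct : circle t = 'i := circle_pihalf.
have sp := scat_factor_slope i0 ii.
have s1 := cslopeD (cslope_cst (- (i == j)%:R) 'i) (cslopeM sp (cslope_cst (vb i * vb j) 'i)).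
rewrite -[X in cslope _ X _]ct in s1.
have s2 := rslope_comp s1 (circle_rslope t).
have e : \forall u \near nbhs t, - (i == j)%:R + scat_factor (circle u) * (vb i * vb j) = S_mx Y (circle u) i j.
  have cc := @cvg_circle R t; rewrite ct in cc.
  have e' : \forall u \near nbhs t, S_mx Y (circle u) i j = S_formula Y (circle u) i j.
    exact: (cc _ (apt_S_mx i j)).
  by apply: filterS e' => u ->; rewrite apt_S_formula.
have := rslope_near e s2; apply: rslope_eq => //.
(* At [z = i] the scalar factor has derivative [- i / 9], and the circle has velocity
   [i * i = -1]. *)
rewrite add0r mulr0 addr0 ct -expr2 sqrCi opprK.
by field.
Qed.

(** Let [v] be the vector [vb]. As [v v^T] squares to 6 times itself, [-1 + v v^T / 3] fixes
    [v v^T], and the scalars multiply to [i * (i / 9) = - 1 / 9]. *)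
Lemma time_delay_i i j : time_delay Y t i j = - (vb i * vb j) / 9%:R.
Proof.
rewrite mxE mxE.
have cE k : (\matrix_(i, j) cderive (fun u => S_mx Y (circle u) i j) t) k j = 'i / 9%:R * (vb k * vb j).
  by rewrite mxE (rslope_cderive (S_slope_i k j)).2.
have sE k : adjmx (S_mx Y (circle t)) i k = - (i == k)%:R + 3%:R^-1 * (vb i * vb k).
  have cD (x y : C) : (x + y)^* = x^* + y^* by exact: rmorphD.
  have cM (x y : C) : (x * y)^* = x^* * y^* by exact: rmorphM.
  have cN (m : nat) : (- m%:R : C)^* = - m%:R by rewrite -[LHS]/(Num.conj _) rmorphN rmorph_nat.
  have c3 : (3%:R^-1 : C)^* = 3%:R^-1.
    by rewrite -[X in X^*]/(3%:R^-1 : C) -[LHS]/(Num.conj _) fmorphV rmorph_nat.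
  rewrite [circle t]circle_pihalf /adjmx mxE mxE S_i cD !cM !vb_conj c3 cN.
  by rewrite eq_sym [vb k * _]mulrC.
under eq_bigr => k _ do rewrite sE cE.
have -> : \sum_k (- (i == k)%:R + 3%:R^-1 * (vb i * vb k)) * ('i / 9%:R * (vb k * vb j)) =
    - ('i / 9%:R * (vb i * vb j)) + 'i / 27%:R * (vb i * vb j) * \sum_k vb k ^+ 2.
  rewrite mulr_sumr; under eq_bigr => k _ do rewrite mulrDl.
  rewrite big_split /=; congr (_ + _); last by apply: eq_bigr => k _; field.
  rewrite (bigD1 i) //= eqxx big1 ?addr0 => [|k ki]; first by rewrite mulN1r.
  by rewrite eq_sym (negbTE ki) oppr0 mul0r.
rewrite vb_sum; have I2 := sqrCi C; move: ('i : C) I2 => I I2.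
have -> : I * (- (I / 9%:R * (vb i * vb j)) + I / 27%:R * (vb i * vb j) * 6%:R) =
  I ^+ 2 * (vb i * vb j / 9%:R) by field.
by rewrite I2; ring.
Qed.

(** The diagonal entries are [- 2 / 9] and [- 4 / 9], in the order fixed by [b]; half their
    difference survives. *)
Lemma traceless_delay_i :
  traceless (time_delay Y t) 0 0 = if b then - 9%:R^-1 else 9%:R^-1.
Proof.
rewrite /traceless mxE [X in _ + X]mxE [X in _ - X]mxE eqxx mulr1n /mxtrace big_ord_recl big_ord1.
have -> : (fintype.lift ord0 ord0 : 'I_2) = 1 by apply: val_inj.
rewrite -[ord0]/(0 : 'I_2) !time_delay_i -!expr2 /vb /positive_cusp.
by case: (b); rewrite /= sqrt_qE; field.
Qed.

(** Where [F] is invertible the determinant is [1 - 6 * scat_factor], free of [b] and of the widths.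
    Continued values are punctured limits of it, so the determinants of the two labellings agree
    wherever both matrices are holomorphic. *)
Lemma apt_S_aut_det (s : C) : (forall i j, holomorphic_at (fun w => S_aut_generic Y w i j) s) ->
  (1 - 6%:R * scat_factor (zeta w)) @[w --> s^'] --> \det (S_aut Y s).
Proof.
move=> h; have latG := Glat_is_lattice F2.
have FF : Filter s^' by exact: _.
have c i j : S_aut_generic Y w i j @[w --> s^'] --> S_aut Y s i j.
  have [l hl] := h i j; rewrite mxE (continuationE hl); exact: continues_cvg.
rewrite [X in \det X]mx2_eta det_mx2.
have h1 := cvg_mul FF (c 0 0) (c 1 1).
have h2 := cvg_mull_cst FF (k := -1) (cvg_mul FF (c 0 1) (c 1 0)).
have h3 := cvg_add FF h1 h2; rewrite mulN1r in h3.
apply: cvg_trans h3; apply: near_eq_cvg.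
apply: filterS (near_F_unit Y s) => w uF; rewrite !(S_aut_genericE latG) //.
rewrite -apt_det_S [X in \det X]mx2_eta det_mx2.
have k0 := qw_neq0 Y 0; have k1 := qw_neq0 Y 1.
move: (S_formula _ _ 0 0) (S_formula _ _ 0 1) (S_formula _ _ 1 0) (S_formula _ _ 1 1) => x y z' u.
by move: (toC _) (toC _) k0 k1 => k0 k1 n0 n1; field; rewrite n0 n1.
Qed.

Lemma apt_S_det (z : C) : (forall i j, holomorphic_at (fun w => S_formula Y w i j) z) ->
  (1 - 6%:R * scat_factor w) @[w --> z^'] --> \det (S_mx Y z).
Proof.
move=> h; have FF : Filter z^' by exact: _.
have c i j : S_formula Y w i j @[w --> z^'] --> S_mx Y z i j.
  have [l hl] := h i j; rewrite mxE (continuationE hl); exact: continues_cvg.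
rewrite [X in \det X]mx2_eta det_mx2.
have h1 := cvg_mul FF (c 0 0) (c 1 1).
have h2 := cvg_mull_cst FF (k := -1) (cvg_mul FF (c 0 1) (c 1 0)).
have h3 := cvg_add FF h1 h2; rewrite mulN1r in h3.
apply: cvg_trans h3; apply: near_eq_cvg; apply: nearW => w.
by rewrite -apt_det_S [X in \det X]mx2_eta det_mx2 mulN1r.
Qed.

End Example.

Lemma traceless_delay_neq (R : realType) (F : finFieldType) (F2 : forall c : F, c = 0 \/ c = 1) :
  traceless (time_delay (apt_quotient R F2 false) (pi / 2%:R)) <>
  traceless (time_delay (apt_quotient R F2 true) (pi / 2%:R)).
Proof.
move=> e; have h1 := traceless_delay_i R F2 false; have h2 := traceless_delay_i R F2 true.
rewrite e h2 in h1; move/eqP: h1.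
by rewrite eq_sym -subr_eq0 opprK -mulr2n mulrn_eq0 invr_eq0 pnatr_eq0.
Qed.

Lemma F2_cases (c : 'F_2) : c = 0 \/ c = 1.
Proof. by case: c => -[|[|//]] hc; [left|right]; apply: val_inj. Qed.

Lemma traceless_not_determined (R : realType) :
  exists (F : finFieldType) (r : nat) (G1 G2 : set (pgl F)) (d1 d2 : nat)
          (Y1 : cusped_quotient R G1 d1 r) (Y2 : cusped_quotient R G2 d2 r)
          (theta : R),
     [/\ nonuniform_arithmetic_lattice G1 /\ nonuniform_arithmetic_lattice G2,
         0 < theta < pi,
         holomorphic_point Y1 theta /\ holomorphic_point Y2 theta,
         (forall z : Cplx R, z != 0 ->
            (forall i j, holomorphic_at (fun w => S_formula Y1 w i j) z) ->
            (forall i j, holomorphic_at (fun w => S_formula Y2 w i j) z) ->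
            \det (S_mx Y1 z) = \det (S_mx Y2 z)) /\
         (forall s : Cplx R,
            (forall i j, holomorphic_at (fun w => S_aut_generic Y1 w i j) s) ->
            (forall i j, holomorphic_at (fun w => S_aut_generic Y2 w i j) s) ->
            \det (S_aut Y1 s) = \det (S_aut Y2 s)) &
         traceless (time_delay Y1 theta) <> traceless (time_delay Y2 theta)].
Proof.
have ci : circle (pi / 2%:R : R) != 0 /\ 2%:R - circle (pi / 2%:R : R) * circle (pi / 2%:R : R) != 0.
  rewrite circle_pihalf; exact: good_i.
(* The same lattice is used twice, with opposite labels of its cusps. At [pi / 2] the spectral
   parameter is [i], where [2 - z^2 = 3] does not vanish and the family is holomorphic. *)
exists 'F_2, 2%N, (@Glat 'F_2), (@Glat 'F_2), 1%N, 1%N,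
  (apt_quotient R F2_cases false), (apt_quotient R F2_cases true), (pi / 2%:R); split.
- by split; exact: (Glat_nonuniform_arithmetic F2_cases).
- by have := @pi_gt0 R; lra.
- by split; exact: apt_holomorphic_point.
- split=> [z _ h1 h2|s h1 h2].
    exact: (dnbhs_cvg_unique (apt_S_det h1) (apt_S_det h2)).
  exact: (dnbhs_cvg_unique (apt_S_aut_det h1) (apt_S_aut_det h2)).
exact: traceless_delay_neq.
Qed.

Theorem corollary2p23 (R : realType) :
  (forall (F : finFieldType) (G : set (pgl F)) (d r : nat)
          (Y : cusped_quotient R G d r) (theta : R),
     nonuniform_arithmetic_lattice G ->
     0 < theta < pi ->
     holomorphic_point Y theta ->
     [/\ (forall i j, cderivable (fun u => S_mx Y (circle u) i j) theta) /\
         cesaro_mean (fun N => renormalized_gram Y N theta) @ \oo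
           --> time_delay Y theta,
         (exists l, local_log (fun u => \det (S_mx Y (circle u))) l theta) /\
         (forall l, local_log (fun u => \det (S_mx Y (circle u))) l theta ->
            cderivable l theta /\
            \tr (time_delay Y theta) = 'i * cderive l theta),
         (exists l, local_log (fun u => \det (S_aut Y (s_theta F u))) l theta) /\
         (forall l, local_log (fun u => \det (S_aut Y (s_theta F u))) l theta ->
            cderivable l theta /\
            \tr (time_delay Y theta) = 'i * cderive l theta) &
         cesaro_mean (fun N => traceless (normalized_gram Y N theta)) @ \oo
           --> traceless (time_delay Y theta)]) /\
  (exists (F : finFieldType) (r : nat) (G1 G2 : set (pgl F)) (d1 d2 : nat)
          (Y1 : cusped_quotient R G1 d1 r) (Y2 : cusped_quotient R G2 d2 r)
          (theta : R),
     [/\ nonuniform_arithmetic_lattice G1 /\ nonuniform_arithmetic_lattice G2,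
         0 < theta < pi,
         holomorphic_point Y1 theta /\ holomorphic_point Y2 theta,
         (forall z : Cplx R, z != 0 ->
            (forall i j, holomorphic_at (fun w => S_formula Y1 w i j) z) ->
            (forall i j, holomorphic_at (fun w => S_formula Y2 w i j) z) ->
            \det (S_mx Y1 z) = \det (S_mx Y2 z)) /\
         (forall s : Cplx R,
            (forall i j, holomorphic_at (fun w => S_aut_generic Y1 w i j) s) ->
            (forall i j, holomorphic_at (fun w => S_aut_generic Y2 w i j) s) ->
            \det (S_aut Y1 s) = \det (S_aut Y2 s)) &
         traceless (time_delay Y1 theta) <> traceless (time_delay Y2 theta)]).
Proof.
split=> [F G d r Y theta [latG _ _] t0 hol|]; last exact: traceless_not_determined.
exact: cusped_quotient_scattering.
Qed.
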